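(* Let $k$ be an algebraically closed field and let $A$ be a basic connected finite dimensional triangular $k$-algebra which admits a strongly simply connected Galois covering for a given presentation $kQ_A/I_A$ of $A$ (given by an epimorphism $\nu:kQ_A\to A$ with kernel $I_A$), i.e. there is a Galois covering of bound quivers $F:(\widetilde Q_A,\widetilde I_A)\to(Q_A,I_A)$ with $\widetilde A\cong k\widetilde Q_A/\widetilde I_A$ strongly simply connected. Then $A$ is of the first kind (with respect to this presentation).
   Context: **Presentations.** $k$ is an algebraically closed field. A $k$-category is a category whose morphism sets are $k$-vector spaces with $k$-bilinear composition. It is locally bounded if all endomorphism algebras of objects are local, distinct objects are non-isomorphic, and for each object $x$ both $\sum_y\dim_k A(x,y)$ and $\sum_y\dim_k A(y,x)$ are finite. A basic finite dimensional algebra is viewed as a locally bounded category with finitely many objects. A presentation of a locally bounded category $A$ is an isomorphism $A\cong kQ_A/I$ where $Q_A$ is a locally finite quiver (the quiver of $A$) and $I$ is an admissible ideal of the path category $kQ_A$; $(Q_A,I)$ is called a bound quiver. $A$ is triangular if $Q_A$ has no oriented cycles. **Walks and homotopy.** Paths are composed from left to right. A walk is a trivial path $\varepsilon_a$ or a composable sequence $c_1\cdots c_r$ where each $c_i$ is an arrow or the formal inverse of an arrow. Let $(Q,I)$ be a connected locally finite bound quiver. A minimal relation is an element $\sum_{i=1}^n\lambda_ip_i\in I(a,b)$, with $\lambda_i\in k$ and $p_i$ paths from $a$ to $b$ of length at least two, such that $n\ge 2$ and $\sum_{j\in J}\lambda_jp_j\notin I(a,b)$ for every nonempty proper subset $J\subset\{1,\dots,n\}$.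 The homotopy relation $\sim$ is the smallest equivalence relation on walks such that: (a) $\alpha\alpha^{-1}\sim\varepsilon_a$ and $\alpha^{-1}\alpha\sim\varepsilon_b$ for every arrow $\alpha:a\to b$; (b) $p_i\sim p_j$ for all $i,j$ whenever $\sum_i\lambda_ip_i$ is a minimal relation; (c) $u\sim v$ implies $w_1uw_2\sim w_1vw_2$ for all walks $w_1,w_2$ for which these compositions make sense. The fundamental group $\pi_1(Q,I)$ is the group of homotopy classes of closed walks at a fixed vertex, under concatenation (it does not depend on the vertex). **Strongly simply connected.** A full subcategory $C$ of a locally bounded category $R$ is convex if every path in the quiver of $R$ with both end vertices in $C$ has all its vertices in $C$. A triangular locally bounded $k$-category $R\cong kQ/I$ is simply connected if for every finite convex subcategory $C$ of $R$ and any presentation $C\cong kQ'/I'$ the fundamental group of $(Q',I')$ is trivial. A triangular locally bounded $k$-category $R\cong kQ/I$ is strongly simply connected if (1) for any two vertices $x,y$ of $Q$ there are only finitely many paths in $Q$ from $x$ to $y$; and (2) every finite convex subcategory $C$ of $R$ is simply connected. **Galois coverings.** Let $A=kQ/I$ and $A'=kQ'/I'$. Let $F:A'\to A$ be a surjective map induced from a surjective quiver map $F_1:Q'\to Q$ with $kF_1(I')\subset I$. $F$ (also written $F:(Q',I')\to(Q,I)$) is a Galois covering defined by the action of a group $G$ of automorphisms of the bound quiver $(Q',I')$ if: (1) $Fg=F$ for any $g\in G$; (2) $F_1^{-1}(x)=Gx'$ and $F_1^{-1}(\alpha)=G\alpha'$ for vertices $x$ in $Q$ and $x'$ in $Q'$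 with $F_1x'=x$ and arrows $\alpha$ in $Q$ and $\alpha'$ in $Q'$ with $F_1\alpha'=\alpha$; (3) $G$ acts freely on $A'$, that is, if $g\in G$ fixes a vertex of $Q'$ then $g=1$. **Universal Galois covering.** For $B=kQ/I$ there is a Galois covering $\widetilde F:\widetilde B=k\widetilde Q/\widetilde I\to B$ defined by the action of $\pi_1(Q,I)$ such that for any other Galois covering $F':B'=kQ'/I'\to B$ there is a (Galois covering) map $\overline F:\widetilde B\to B'$ with $F'\overline F=\widetilde F$; it is called the universal Galois covering of $B$ with respect to $(Q,I)$. **First kind.** Modules are finitely generated left modules, and $P_x$ is the indecomposable projective $A$-module at the vertex $x$. For an $A$-module $X$, $A(X)$ is the convex full subcategory of $A$ induced by the vertices in $\operatorname{supp}X$; there is an induced presentation $\nu_X:kQ_X\to A(X)$ given by the restriction of $\nu$. An indecomposable $A$-module $X$ is of the first kind with respect to $\nu$ if there is a $\widetilde B$-module $Y$ such that $F'_\lambda Y=X$ for the push-down functor $F'_\lambda$ (given by $(F'_\lambda Y)(b)=\bigoplus_{b'\mapsto b}Y(b')$) associated to the universal Galois covering $\widetilde B\to B=A(X)$ with respect to $\nu_X$. The algebra $A$ is of the first kind with respect to $\nu$ if for every vertex $x$ in $Q_A$ and every indecomposable direct summand $X$ of $\operatorname{rad}P_x$, the module $X$ is of the first kind.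
   Formalization: Galois coverings are additionally required to be covering functors: the induced maps from the direct sum of A'(x',y') over F y'=y to A(F x',y) are injective; without this I' could be zero, universal coverings need not exist and the claim fails. *)

(* Defs.v *)
From HB Require Import structures.
From mathcomp Require Import all_boot all_algebra generic_quotient.
From mathcomp Require Import boolp classical_sets functions cardinality.
From mathcomp Require Import finmap monalg.

Set Implicit Arguments.
Unset Strict Implicit.
Unset Printing Implicit Defensive.

Import GRing.Theory.
Local Open Scope ring_scope.
Local Open Scope classical_set_scope.

Definition fin_dim (k : fieldType) (V : lmodType k) : Prop :=
  exists (n : nat) (b : 'I_n -> V),
    forall v, exists c : 'I_n -> k, v = \sum_i c i *: b i.

Section LinearOf.
Variables (k : fieldType) (U V : lmodType k) (f : U -> V) (flin : linear f).

Definition linear_of : U -> V := let _ := flin in f.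

HB.instance Definition _ := GRing.isLinear.Build k U V _ linear_of flin.

Definition linfun_of : {linear U -> V} := linear_of.

End LinearOf.

Section LinearExtension.
Variables (k : fieldType) (K : choiceType) (V : lmodType k).

Definition mlin (h : K -> V) (u : {malg k[K]}) : V :=
  \sum_(p <- msupp u) u@_p *: h p.

Lemma mlinEw (h : K -> V) (u : {malg k[K]}) (d : {fset K}) :
  (msupp u `<=` d)%fset -> mlin h u = \sum_(p <- d) u@_p *: h p.
Proof.
move=> sud; rewrite /mlin (big_fset_incl _ sud) // => p _ /mcoeff_outdom ->.
by rewrite scale0r.
Qed.

Lemma mlin_is_linear (h : K -> V) : linear (mlin h).
Proof.
move=> a u v; pose d := (msupp (a *: u + v) `|` (msupp u `|` msupp v))%fset.
rewrite (@mlinEw _ _ d) ?fsubsetUl //.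
rewrite (@mlinEw _ u d); last first.
  by rewrite (fsubset_trans (fsubsetUl _ (msupp v))) ?fsubsetUr.
rewrite (@mlinEw _ v d); last first.
  by rewrite (fsubset_trans (fsubsetUr (msupp u) _)) ?fsubsetUr.
rewrite scaler_sumr -big_split /=; apply: eq_bigr => p _.
by rewrite mcoeffD mcoeffZ scalerDl scalerA.
Qed.

HB.instance Definition _ (h : K -> V) :=
  GRing.isLinear.Build k {malg k[K]} V _ (mlin h) (mlin_is_linear h).

Lemma mlinU (h : K -> V) (p : K) : mlin h << p >> = h p.
Proof.
by rewrite (@mlinEw _ _ [fset p]%fset) ?msuppU_le // big_seq_fset1 mcoeffUU scale1r.
Qed.

End LinearExtension.

Lemma malg_linear_ext (k : fieldType) (K : choiceType) (V : lmodType k)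
    (f g : {linear {malg k[K]} -> V}) :
  (forall p, f << p >> = g << p >>) -> f =1 g.
Proof.
move=> fg u; rewrite [u]monalgE !linear_sum; apply: eq_bigr => p _.
have -> : << u@_p *g p >> = u@_p *: (<< p >> : {malg k[K]}).
  by apply/malgP => q; rewrite mcoeffZ !mcoeffU mulrnAr mulr1.
by rewrite !linearZ fg.
Qed.

(* Composition is written in diagrammatic order: [kcomp f g] is "f, then g". *)
Record kcat (k : fieldType) := KCat {
  ob :> Type;
  hom : ob -> ob -> lmodType k;
  cid : forall x, hom x x;
  kcomp : forall x y z, hom x y -> hom y z -> hom x z;
  comp_linl : forall x y z (g : hom y z), linear ((@kcomp x y z)^~ g);
  comp_linr : forall x y z (f : hom x y), linear (@kcomp x y z f);
  comp_idl : forall x y (f : hom x y), kcomp (cid x) f = f;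
  comp_idr : forall x y (f : hom x y), kcomp f (cid y) = f;
  kcompA : forall x y z t (f : hom x y) (g : hom y z) (h : hom z t),
    kcomp f (kcomp g h) = kcomp (kcomp f g) h
}.
Arguments hom {k} C x y : rename.
Arguments cid {k} C x : rename.
Arguments kcomp {k C x y z} f g : rename.

Record kfunctor (k : fieldType) (C D : kcat k) := KFunctor {
  fob :> C -> D;
  fhom : forall x y, {linear hom C x y -> hom D (fob x) (fob y)};
  fhom_id : forall x, fhom x x (cid C x) = cid D (fob x);
  fhom_comp : forall x y z (f : hom C x y) (g : hom C y z),
    fhom x z (kcomp f g) = kcomp (fhom x y f) (fhom y z g)
}.
Arguments fhom {k C D} F {x y} : rename.

Section Functors.
Variable k : fieldType.

Definition fcomp_hom (C D E : kcat k) (F : kfunctor C D) (G : kfunctor D E)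
    (x y : C) : {linear hom C x y -> hom E (G (F x)) (G (F y))} :=
  (fhom G \o fhom F)%FUN.

Lemma fcomp_id (C D E : kcat k) (F : kfunctor C D) (G : kfunctor D E) (x : C) :
  fcomp_hom F G x x (cid C x) = cid E (G (F x)).
Proof. by rewrite /= !fhom_id. Qed.

Lemma fcomp_comp (C D E : kcat k) (F : kfunctor C D) (G : kfunctor D E)
    (x y z : C) (f : hom C x y) (g : hom C y z) :
  fcomp_hom F G x z (kcomp f g) =
  kcomp (fcomp_hom F G x y f) (fcomp_hom F G y z g).
Proof. by rewrite /= !fhom_comp. Qed.

Definition fcomp (C D E : kcat k) (F : kfunctor C D) (G : kfunctor D E) :
    kfunctor C E :=
  KFunctor (fcomp_id F G) (@fcomp_comp _ _ _ F G).

Section FullSubcategory.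
Variables (C : kcat k) (S : set C).

Let sob := {x : C | S x}.
Let shom (x y : sob) := hom C (sval x) (sval y).

Definition fullsub : kcat k :=
  @KCat k sob shom (fun x => cid C (sval x)) (fun x y z f g => kcomp f g)
    (fun x y z g => comp_linl g) (fun x y z f => comp_linr f)
    (fun x y f => comp_idl f) (fun x y f => comp_idr f)
    (fun x y z t f g h => kcompA f g h).

Definition fullsub_incl : kfunctor fullsub C :=
  @KFunctor k fullsub C (fun x => sval x) (fun x y => idfun)
    (fun x => erefl) (fun x y z f g => erefl).

End FullSubcategory.

Definition invertible (C : kcat k) (x y : C) (f : hom C x y) : Prop :=
  exists g : hom C y x, kcomp f g = cid C x /\ kcomp g f = cid C y.

Definition local_end (C : kcat k) (x : C) : Prop :=
  cid C x <> 0 /\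
  forall f g : hom C x x, ~ invertible f -> ~ invertible g -> ~ invertible (f + g).

Record locally_bounded (C : kcat k) : Prop := LocallyBounded {
  lb_local : forall x : C, local_end x;
  lb_basic : forall (x y : C) (f : hom C x y), invertible f -> x = y;
  lb_fin_dim : forall x y : C, fin_dim (hom C x y);
  lb_out : forall x : C, finite_set [set y | exists f : hom C x y, f <> 0];
  lb_in : forall x : C, finite_set [set y | exists f : hom C y x, f <> 0]
}.

Definition connected_kcat (C : kcat k) : Prop :=
  inhabited C /\
  forall S : set C, (exists x, S x) ->
    (forall x y, S x ->
       (exists f : hom C x y, f <> 0) \/ (exists f : hom C y x, f <> 0) -> S y) ->
    forall x, S x.

End Functors.

Record quiver := Quiver {
  vertex :> Type;
  arrow : vertex -> vertex -> Type
}.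
Arguments arrow : clear implicits.

Inductive qpath (Q : quiver) : Q -> Q -> Type :=
| pnil x : qpath x x
| pcons x y z : arrow Q x y -> qpath y z -> qpath x z.

Fixpoint plength (Q : quiver) (x y : Q) (p : qpath x y) : nat :=
  if p is pcons _ _ _ _ p' then (plength p').+1 else 0%N.

Fixpoint pcat (Q : quiver) (x y z : Q) (p : qpath x y) : qpath y z -> qpath x z :=
  match p in qpath x y return qpath y z -> qpath x z with
  | pnil _ => fun q => q
  | pcons _ _ _ a p' => fun q => pcons a (pcat p' q)
  end.

Lemma pcat_nil (Q : quiver) (x y : Q) (p : qpath x y) : pcat p (pnil y) = p.
Proof. by elim: p => //= x' y' z' a p ->. Qed.

Lemma pcatA (Q : quiver) (x y z t : Q) (p : qpath x y) (q : qpath y z)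
    (r : qpath z t) :
  pcat p (pcat q r) = pcat (pcat p q) r.
Proof. by elim: p q => //= x' y' z' a p IHp q; rewrite IHp. Qed.

HB.instance Definition _ (Q : quiver) (x y : Q) := gen_eqMixin (qpath x y).
HB.instance Definition _ (Q : quiver) (x y : Q) := gen_choiceMixin (qpath x y).

Section PathCategory.
Variables (k : fieldType) (Q : quiver).

Definition kpath (x y : Q) : lmodType k := {malg k[qpath x y]}.

Definition kpath_id (x : Q) : kpath x x := << pnil x >>.

Definition kpath_comp (x y z : Q) (u : kpath x y) (v : kpath y z) : kpath x z :=
  mlin (fun p : qpath x y =>
    mlin (fun q : qpath y z => << pcat p q >> : kpath x z) v) u.

Lemma kpath_comp_linl (x y z : Q) (v : kpath y z) :
  linear ((@kpath_comp x y z)^~ v).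
Proof. by move=> a u u'; rewrite /kpath_comp linearP. Qed.

Lemma kpath_comp_linr (x y z : Q) (u : kpath x y) : linear (@kpath_comp x y z u).
Proof.
move=> a v v'; rewrite /kpath_comp /mlin scaler_sumr -big_split /=.
apply: eq_bigr => p _; rewrite -!/(mlin _ _) linearP scalerDr !scalerA.
by rewrite mulrC.
Qed.

Lemma kpath_compU (x y z : Q) (p : qpath x y) (q : qpath y z) :
  kpath_comp << p >> << q >> = << pcat p q >>.
Proof. by rewrite /kpath_comp !mlinU. Qed.

Lemma kpath_comp_idl (x y : Q) (u : kpath x y) : kpath_comp (kpath_id x) u = u.
Proof.
pose f := linfun_of (@kpath_comp_linr x x y (kpath_id x)).
apply: (@malg_linear_ext _ _ _ f idfun) => p /=.
by rewrite [LHS]kpath_compU.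
Qed.

Lemma kpath_comp_idr (x y : Q) (u : kpath x y) : kpath_comp u (kpath_id y) = u.
Proof.
pose f := linfun_of (@kpath_comp_linl x y y (kpath_id y)).
apply: (@malg_linear_ext _ _ _ f idfun) => p /=.
by rewrite [LHS]kpath_compU pcat_nil.
Qed.

Lemma kpath_compA (x y z t : Q) (u : kpath x y) (v : kpath y z) (w : kpath z t) :
  kpath_comp u (kpath_comp v w) = kpath_comp (kpath_comp u v) w.
Proof.
pose cl (a b c : Q) (h : kpath b c) := linfun_of (@kpath_comp_linl a b c h).
pose cr (a b c : Q) (h : kpath a b) := linfun_of (@kpath_comp_linr a b c h).
apply: (@malg_linear_ext _ _ _ (cl x y t (kpath_comp v w))
  (cl x z t w \o cl x y z v)%FUN) => p /=.
apply: (@malg_linear_ext _ _ _ (cr x y t << p >> \o cl y z t w)%FUN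
  (cl x z t w \o cr x y z << p >>)%FUN) => q /=.
apply: (@malg_linear_ext _ _ _ (cr x y t << p >> \o cr y z t << q >>)%FUN
  (cr x z t (kpath_comp << p >> << q >>))) => r /=.
by rewrite /linear_of !kpath_compU pcatA.
Qed.

Definition pathcat : kcat k :=
  KCat kpath_comp_linl kpath_comp_linr kpath_comp_idl kpath_comp_idr kpath_compA.

End PathCategory.

Record qmor (Q' Q : quiver) := QMor {
  qmv :> Q' -> Q;
  qma : forall x y, arrow Q' x y -> arrow Q (qmv x) (qmv y)
}.
Arguments qma {Q' Q} F {x y} a : rename.

(* Arrows bundled with their end points: equality of arrows with different
   end points is expressed in this type. *)
Definition tarrow (Q : quiver) := {x : Q & {y : Q & arrow Q x y}}.

Definition mk_tarrow (Q : quiver) (x y : Q) (a : arrow Q x y) : tarrow Q :=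
  existT _ x (existT _ y a).

Definition qmt (Q' Q : quiver) (F : qmor Q' Q) (a : tarrow Q') : tarrow Q :=
  mk_tarrow (qma F (projT2 (projT2 a))).

Definition qmor_eq (Q' Q : quiver) (F G : qmor Q' Q) : Prop :=
  qmv F =1 qmv G /\ qmt F =1 qmt G.

Definition qmid (Q : quiver) : qmor Q Q := @QMor Q Q id (fun _ _ => id).

Definition qmcomp (Q1 Q2 Q3 : quiver) (G : qmor Q2 Q3) (F : qmor Q1 Q2) :
    qmor Q1 Q3 :=
  @QMor Q1 Q3 (fun x => G (F x)) (fun _ _ a => qma G (qma F a)).

Fixpoint pmap_quiver (Q' Q : quiver) (F : qmor Q' Q) (x y : Q')
    (p : qpath x y) : qpath (F x) (F y) :=
  match p in qpath x y return qpath (F x) (F y) with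
  | pnil _ => pnil _
  | pcons _ _ _ a p' => pcons (qma F a) (pmap_quiver F p')
  end.

Lemma pmap_quiver_cat (Q' Q : quiver) (F : qmor Q' Q) (x y z : Q')
    (p : qpath x y) (q : qpath y z) :
  pmap_quiver F (pcat p q) = pcat (pmap_quiver F p) (pmap_quiver F q).
Proof. by elim: p q => //= x' y' z' a p IHp q; rewrite IHp. Qed.

Section QuiverFunctor.
Variables (k : fieldType) (Q' Q : quiver) (F : qmor Q' Q).

Definition kqmap (x y : Q') :
    {linear kpath k x y -> kpath k (F x) (F y)} :=
  mlin (fun p : qpath x y => << pmap_quiver F p >> : kpath k (F x) (F y)).

Lemma kqmapU (x y : Q') (p : qpath x y) :
  kqmap x y << p >> = << pmap_quiver F p >>.
Proof. exact: mlinU. Qed.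

Lemma kqmap_id (x : Q') : kqmap x x (kpath_id k x) = kpath_id k (F x).
Proof. exact: kqmapU. Qed.

Lemma kqmap_comp (x y z : Q') (u : kpath k x y) (v : kpath k y z) :
  kqmap x z (kpath_comp u v) = kpath_comp (kqmap x y u) (kqmap y z v).
Proof.
pose cl (Q0 : quiver) (a b c : Q0) (h : kpath k b c) := linfun_of (@kpath_comp_linl k Q0 a b c h).
pose cr (Q0 : quiver) (a b c : Q0) (h : kpath k a b) := linfun_of (@kpath_comp_linr k Q0 a b c h).
apply: (@malg_linear_ext _ _ _ (kqmap x z \o cl Q' x y z v)%FUN
  (cl Q (F x) (F y) (F z) (kqmap y z v) \o kqmap x y)%FUN) => p /=.
apply: (@malg_linear_ext _ _ _ (kqmap x z \o cr Q' x y z << p >>)%FUN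
  (cr Q (F x) (F y) (F z) (kqmap x y << p >>) \o kqmap y z)%FUN) => q /=.
rewrite /linear_of !kpath_compU.
rewrite [LHS]kqmapU [X in kpath_comp X]kqmapU [X in kpath_comp _ X]kqmapU.
by rewrite kpath_compU pmap_quiver_cat.
Qed.

Definition kquiver : kfunctor (pathcat k Q') (pathcat k Q) :=
  @KFunctor k (pathcat k Q') (pathcat k Q) F kqmap kqmap_id kqmap_comp.

End QuiverFunctor.

Section Subquiver.
Variables (Q : quiver) (T : set Q).

Definition subquiver : quiver :=
  @Quiver {x : Q | T x} (fun x y => arrow Q (sval x) (sval y)).

Definition subquiver_incl : qmor subquiver Q :=
  @QMor subquiver Q (fun x => sval x) (fun _ _ a => a).

End Subquiver.

Definition locally_finite (Q : quiver) : Prop :=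
  forall x : Q, finite_set [set: {y : Q & arrow Q x y}] /\
                finite_set [set: {y : Q & arrow Q y x}].

Definition triangular (Q : quiver) : Prop :=
  forall (x : Q) (p : qpath x x), plength p = 0%N.

Definition convex (Q : quiver) (T : set Q) : Prop :=
  forall (x z y : Q) (p : qpath x z) (q : qpath z y), T x -> T y -> T z.

Definition convex_hull (Q : quiver) (T : set Q) : set Q :=
  [set z | forall T' : set Q, convex T' -> T `<=` T' -> T' z].

Definition hom_sets (k : fieldType) (Q : quiver) : Type :=
  forall x y : Q, set (kpath k x y).

Section BoundQuivers.
Variables (k : fieldType) (Q : quiver) (I : hom_sets k Q).
Arguments I : clear implicits.

Record ideal : Prop := Ideal {
  ideal0 : forall x y : Q, I x y 0;
  idealP : forall (x y : Q) (c : k) (u v : kpath k x y), I x y u -> I x y v -> I x y (c *: u + v);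
  ideal_compl : forall (x y z : Q) (u : kpath k x y) (v : kpath k y z),
    I y z v -> I x z (kpath_comp u v);
  ideal_compr : forall (x y z : Q) (u : kpath k x y) (v : kpath k y z),
    I x y u -> I x z (kpath_comp u v)
}.

Record admissible : Prop := Admissible {
  adm_ideal : ideal;
  adm_length : forall (x y : Q) (u : kpath k x y), I x y u ->
    forall p, p \in msupp u -> (2 <= plength p)%N;
  adm_out : forall x : Q, exists n, forall (y : Q) (p : qpath x y),
    (n <= plength p)%N -> I x y << p >>;
  adm_in : forall x : Q, exists n, forall (y : Q) (p : qpath y x),
    (n <= plength p)%N -> I y x << p >>
}.

Definition bound_quiver : Prop := locally_finite Q /\ admissible.

Definition minimal_relation (a b : Q) (n : nat) (c : 'I_n -> k)
    (p : 'I_n -> qpath a b) : Prop :=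
  [/\ (2 <= n)%N,
      forall i, (2 <= plength (p i))%N,
      I a b (\sum_i c i *: << p i >>) &
      forall J : {set 'I_n}, J != finset.set0 -> J != [set: 'I_n]%SET ->
        ~ I a b (\sum_(j in J) c j *: << p j >>)].

End BoundQuivers.

Inductive walk (Q : quiver) : Q -> Q -> Type :=
| wnil x : walk x x
| wfwd x y z : arrow Q x y -> walk y z -> walk x z
| wbwd x y z : arrow Q y x -> walk y z -> walk x z.

Fixpoint wcat (Q : quiver) (x y z : Q) (w : walk x y) : walk y z -> walk x z :=
  match w in walk x y return walk y z -> walk x z with
  | wnil _ => fun v => v
  | wfwd _ _ _ a w' => fun v => wfwd a (wcat w' v)
  | wbwd _ _ _ a w' => fun v => wbwd a (wcat w' v)
  end.

Fixpoint winv (Q : quiver) (x y : Q) (w : walk x y) : walk y x :=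
  match w in walk x y return walk y x with
  | wnil _ => wnil _
  | wfwd _ _ _ a w' => wcat (winv w') (wbwd a (wnil _))
  | wbwd _ _ _ a w' => wcat (winv w') (wfwd a (wnil _))
  end.

Fixpoint walk_of (Q : quiver) (x y : Q) (p : qpath x y) : walk x y :=
  match p in qpath x y return walk x y with
  | pnil _ => wnil _
  | pcons _ _ _ a p' => wfwd a (walk_of p')
  end.

Lemma wcat_nil (Q : quiver) (x y : Q) (w : walk x y) : wcat w (wnil y) = w.
Proof. by elim: w => //= x' y' z' a w ->. Qed.

Lemma wcatA (Q : quiver) (x y z t : Q) (u : walk x y) (v : walk y z)
    (w : walk z t) :
  wcat u (wcat v w) = wcat (wcat u v) w.
Proof. by elim: u v => //= x' y' z' a u IHu v; rewrite IHu. Qed.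

HB.instance Definition _ (Q : quiver) (x y : Q) := gen_eqMixin (walk x y).
HB.instance Definition _ (Q : quiver) (x y : Q) := gen_choiceMixin (walk x y).

Definition connected_quiver (Q : quiver) : Prop :=
  inhabited Q /\ forall x y : Q, inhabited (walk x y).

Inductive homotopic (k : fieldType) (Q : quiver) (I : hom_sets k Q) :
    forall x y : Q, walk x y -> walk x y -> Prop :=
| ht_refl x y (w : walk x y) : homotopic I w w
| ht_sym x y (w v : walk x y) : homotopic I w v -> homotopic I v w
| ht_trans x y (w v u : walk x y) :
    homotopic I w v -> homotopic I v u -> homotopic I w u
| ht_fwd_bwd x y (a : arrow Q x y) :
    homotopic I (wfwd a (wbwd a (wnil x))) (wnil x)
| ht_bwd_fwd x y (a : arrow Q x y) :
    homotopic I (wbwd a (wfwd a (wnil y))) (wnil y)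
| ht_minrel x y n (c : 'I_n -> k) (p : 'I_n -> qpath x y) i j :
    minimal_relation I c p -> homotopic I (walk_of (p i)) (walk_of (p j))
| ht_congr x y z t (w1 : walk x y) (u v : walk y z) (w2 : walk z t) :
    homotopic I u v ->
    homotopic I (wcat w1 (wcat u w2)) (wcat w1 (wcat v w2)).

Section FundamentalGroup.
Variables (k : fieldType) (Q : quiver) (I : hom_sets k Q).

Lemma homotopic_wcat (x y z : Q) (w w' : walk x y) (v v' : walk y z) :
  homotopic I w w' -> homotopic I v v' -> homotopic I (wcat w v) (wcat w' v').
Proof.
move=> hw hv; apply: (ht_trans (v := wcat w' v)).
  exact: (ht_congr (wnil x) v hw).
by have := ht_congr w' (wnil z) hv; rewrite !wcat_nil.
Qed.

Lemma homotopic_wcatV (x y : Q) (w : walk x y) :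
  homotopic I (wcat (winv w) w) (wnil y).
Proof.
elim: w => [z|x' y' z a w IHw|x' y' z a w IHw] /=; first exact: ht_refl.
- apply: ht_trans IHw; rewrite -wcatA.
  exact: (ht_congr (winv w) w (ht_bwd_fwd I a)).
- apply: ht_trans IHw; rewrite -wcatA.
  exact: (ht_congr (winv w) w (ht_fwd_bwd I a)).
Qed.

Variable x : Q.

Definition homotopicb (w v : walk x x) : bool := `[< homotopic I w v >].

Lemma homotopicb_refl : reflexive homotopicb.
Proof. by move=> w; apply/asboolP/ht_refl. Qed.

Lemma homotopicb_sym : symmetric homotopicb.
Proof. by move=> w v; apply/asboolP/asboolP; exact: ht_sym. Qed.

Lemma homotopicb_trans : transitive homotopicb.
Proof. by move=> v w u /asboolP wv /asboolP vu; apply/asboolP/(ht_trans wv). Qed.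

Canonical homotopy_equiv :=
  EquivRel homotopicb homotopicb_refl homotopicb_sym homotopicb_trans.

Definition pi1 : Type := {eq_quot homotopy_equiv}%qT.

HB.instance Definition _ := Choice.on pi1.

Definition pi1_class (w : walk x x) : pi1 := (\pi w)%qT.
Definition pi1_repr (a : pi1) : walk x x := repr a.

Definition pi1_mul (a b : pi1) : pi1 :=
  pi1_class (wcat (pi1_repr a) (pi1_repr b)).
Definition pi1_one : pi1 := pi1_class (wnil x).
Definition pi1_inv (a : pi1) : pi1 := pi1_class (winv (pi1_repr a)).

Lemma pi1_classK : cancel pi1_repr pi1_class.
Proof. exact: reprK. Qed.

Lemma pi1_classE (w v : walk x x) :
  pi1_class w = pi1_class v <-> homotopic I w v.
Proof.
split=> [/eqmodP /asboolP //|wv].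
by apply/eqmodP/asboolP.
Qed.

Lemma pi1_reprK (w : walk x x) : homotopic I (pi1_repr (pi1_class w)) w.
Proof. by apply/pi1_classE; rewrite pi1_classK. Qed.

Lemma pi1_mulE (w v : walk x x) :
  pi1_mul (pi1_class w) (pi1_class v) = pi1_class (wcat w v).
Proof. by apply/pi1_classE/homotopic_wcat; apply: pi1_reprK. Qed.

Lemma pi1_mulA : associative pi1_mul.
Proof.
move=> a b c; rewrite -[a]pi1_classK -[b]pi1_classK -[c]pi1_classK.
by rewrite !pi1_mulE wcatA.
Qed.

Lemma pi1_mul1 : left_id pi1_one pi1_mul.
Proof. by move=> a; rewrite -[a]pi1_classK pi1_mulE. Qed.

Lemma pi1_mulr1 : right_id pi1_one pi1_mul.
Proof. by move=> a; rewrite -[a]pi1_classK pi1_mulE wcat_nil. Qed.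

Lemma winvK_homotopic (y z : Q) (w : walk y z) :
  homotopic I (wcat w (winv w)) (wnil y).
Proof.
elim: w => [t|x' y' z' a w IHw|x' y' z' a w IHw] /=; first exact: ht_refl.
- apply: ht_trans (ht_fwd_bwd I a); rewrite wcatA.
  exact: (ht_congr (wfwd a (wnil y')) (wbwd a (wnil x')) IHw).
- apply: ht_trans (ht_bwd_fwd I a); rewrite wcatA.
  exact: (ht_congr (wbwd a (wnil y')) (wfwd a (wnil x')) IHw).
Qed.

Lemma pi1_mulV : left_inverse pi1_one pi1_inv pi1_mul.
Proof.
move=> a; rewrite -[a in pi1_mul _ a]pi1_classK pi1_mulE.
exact/pi1_classE/homotopic_wcatV.
Qed.

Lemma pi1_mulrV : right_inverse pi1_one pi1_inv pi1_mul.
Proof.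
move=> a; rewrite -[a in pi1_mul a]pi1_classK pi1_mulE.
exact/pi1_classE/winvK_homotopic.
Qed.

HB.instance Definition _ := isGroup.Build pi1
  pi1_mulA pi1_mul1 pi1_mulr1 pi1_mulV pi1_mulrV.

End FundamentalGroup.

Definition kernel (k : fieldType) (Q : quiver) (A : kcat k)
    (nu : kfunctor (pathcat k Q) A) : hom_sets k Q :=
  fun x y => [set u | fhom nu u = 0].

Arguments kernel {k Q A} nu x y.

(* nu induces an isomorphism of kQ/I onto A, where I = kernel nu. *)
Record presentation (k : fieldType) (Q : quiver) (A : kcat k)
    (nu : kfunctor (pathcat k Q) A) : Prop := Presentation {
  pres_bound : bound_quiver (kernel nu);
  pres_ob : bijective (fob nu);
  pres_full : forall (x y : Q) (f : hom A (nu x) (nu y)),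
    exists u : kpath k x y, fhom nu u = f
}.

Section StronglySimplyConnected.
Variable k : fieldType.

(* S is a finite set of objects of R spanning a convex full subcategory;
   the quiver of R is read off from the presentation nu. *)
Definition finite_convex (R : kcat k) (Q : quiver)
    (nu : kfunctor (pathcat k Q) R) (S : set R) : Prop :=
  finite_set S /\ convex [set v : Q | S (nu v)].

(* The fundamental group is required to vanish at every vertex, so that a
   disconnected C is treated component by component. *)
Definition simply_connected (R : kcat k) : Prop :=
  locally_bounded R /\
  exists (Q : quiver) (nu : kfunctor (pathcat k Q) R),
    [/\ presentation nu, triangular Q &
      forall S : set R, finite_convex nu S ->
      forall (Q' : quiver) (nu' : kfunctor (pathcat k Q') (fullsub S)),
        presentation nu' ->
      forall (x : Q') (g : pi1 (kernel nu') x), g = 1%g].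

Definition strongly_simply_connected (R : kcat k) (Q : quiver)
    (nu : kfunctor (pathcat k Q) R) : Prop :=
  locally_bounded R /\
  [/\ presentation nu, triangular Q,
    forall x y : Q, finite_set [set: qpath x y] &
    forall S : set R, finite_convex nu S -> simply_connected (fullsub S)].

End StronglySimplyConnected.

Section Coverings.
Variable k : fieldType.

Definition fiber (V' V : Type) (F : V' -> V) (y : V) := {y' : V' | F y' = y}.

Definition kqmap_to (Q' Q : quiver) (F : qmor Q' Q) (x' : Q') (y : Q)
    (t : fiber F y) (u : kpath k x' (sval t)) : kpath k (F x') y :=
  eq_rect _ (fun z => kpath k (F x') z) (kqmap k F x' (sval t) u) _ (svalP t).

(* [gc_faithful] says that the maps
     (+)_(F y' = y) (kQ'/I')(x', y') -> (kQ/I)(F x', y)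
   induced by F are injective.  Without it the ideal I' could be arbitrarily
   small (for instance zero), so it is part of what it means for
   F : kQ'/I' -> kQ/I to be a covering functor.  The surjectivity of these maps
   and the dual statement for the maps ending at x' follow from the remaining
   clauses. *)
Record galois_covering (Q' Q : quiver) (I' : hom_sets k Q') (I : hom_sets k Q)
    (F : qmor Q' Q) (G : groupType) (act : G -> qmor Q' Q') : Prop :=
  GaloisCovering {
  gc_bound : bound_quiver I';
  gc_act1 : qmor_eq (act 1%g) (qmid Q');
  gc_actM : forall g h, qmor_eq (act (g * h)%g) (qmcomp (act g) (act h));
  gc_actI : forall g (x y : Q') (u : kpath k x y),
    I' x y u -> I' (act g x) (act g y) (kqmap k (act g) x y u);
  gc_surjv : forall x : Q, exists x' : Q', F x' = x;
  gc_surja : forall a : tarrow Q, exists a' : tarrow Q', qmt F a' = a;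
  gc_ideal : forall (x y : Q') (u : kpath k x y),
    I' x y u -> I (F x) (F y) (kqmap k F x y u);
  gc_faithful : forall (x' : Q') (y : Q) (n : nat) (t : 'I_n -> fiber F y)
      (u : forall i, kpath k x' (sval (t i))),
    injective t -> I (F x') y (\sum_i kqmap_to (u i)) ->
    forall i, I' x' (sval (t i)) (u i);
  gc_inv : forall g, qmor_eq (qmcomp F (act g)) F;
  gc_fiberv : forall x y : Q', F x = F y -> exists g, act g x = y;
  gc_fibera : forall a b : tarrow Q', qmt F a = qmt F b ->
    exists g, qmt (act g) a = b;
  gc_free : forall g (x : Q'), act g x = x -> g = 1%g
}.

(* The universal property only concerns connected coverings: a connected quiver
   has no surjective morphism onto a disconnected one. *)
Definition universal_galois_covering (Qt Q : quiver) (It : hom_sets k Qt)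
    (I : hom_sets k Q) (Ft : qmor Qt Q) : Prop :=
  connected_quiver Qt /\
  (exists (G : groupType) (act : G -> qmor Qt Qt),
    galois_covering It I Ft act /\
    forall x : Q, exists phi : pi1 I x -> G,
      bijective phi /\ forall a b, phi (a * b)%g = (phi a * phi b)%g) /\
  forall (Q' : quiver) (I' : hom_sets k Q') (F' : qmor Q' Q)
      (G' : groupType) (act' : G' -> qmor Q' Q'),
    connected_quiver Q' -> galois_covering I' I F' act' ->
    exists Fb : qmor Qt Q', qmor_eq (qmcomp F' Fb) Ft /\
      exists (H : groupType) (actH : H -> qmor Qt Qt),
        galois_covering It I' Fb actH.

End Coverings.

(* Left modules, with morphisms composed in diagrammatic order: a morphism
   f : x -> y acts as a map M y -> M x. *)
Record kmod (k : fieldType) (C : kcat k) := KMod {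
  mob :> C -> lmodType k;
  mact : forall x y, hom C x y -> mob y -> mob x;
  mact_linl : forall x y (m : mob y), linear (fun f : hom C x y => mact f m);
  mact_linr : forall x y (f : hom C x y), linear (mact f);
  mact_id : forall x (m : mob x), mact (cid C x) m = m;
  mact_comp : forall x y z (f : hom C x y) (g : hom C y z) (m : mob z),
    mact (kcomp f g) m = mact f (mact g m)
}.
Arguments mact {k C} M {x y} f m : rename.

Section Modules.
Variables (k : fieldType) (C : kcat k).
Implicit Type M : kmod C.

Definition kproj (x : C) : kmod C :=
  @KMod k C (fun y => hom C y x) (fun y z f g => kcomp f g)
    (fun y z g => comp_linl g) (fun y z f => comp_linr f)
    (fun y g => comp_idl g) (fun y z t f g h => esym (kcompA f g h)).

Definition fin_gen M : Prop :=
  exists (n : nat) (xs : 'I_n -> C) (ms : forall i, M (xs i)),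
    forall (y : C) (m : M y), exists f : forall i, hom C y (xs i),
      m = \sum_i mact M (f i) (ms i).

Definition subsets M : Type := forall x : C, set (M x).

Record submodule M (N : subsets M) : Prop := Submodule {
  submod0 : forall x, N x 0;
  submodP : forall x (a : k) (u v : M x), N x u -> N x v -> N x (a *: u + v);
  submod_act : forall x y (f : hom C x y) (u : M y), N y u -> N x (mact M f u)
}.

Definition zero_sub M : subsets M := fun x => [set 0].
Definition full_sub M : subsets M := fun x => setT.

Definition maximal_submodule M (N : subsets M) : Prop :=
  [/\ submodule N, N <> @full_sub M &
      forall N' : subsets M, submodule N' -> (forall x, N x `<=` N' x) ->
        N' = N \/ N' = @full_sub M].

Definition radical M : subsets M :=
  fun x => [set m | forall N : subsets M, maximal_submodule N -> N x m].

Definition internal_dsum M (R N1 N2 : subsets M) : Prop :=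
  forall x, (forall m, R x m <-> exists a b, [/\ N1 x a, N2 x b & m = a + b]) /\
            (forall m, N1 x m -> N2 x m -> m = 0).

Definition indecomposable M : Prop :=
  (exists (x : C) (m : M x), m <> 0) /\
  forall N1 N2 : subsets M, submodule N1 -> submodule N2 ->
    internal_dsum (@full_sub M) N1 N2 -> N1 = @zero_sub M \/ N2 = @zero_sub M.

Record kmor M M' := KMor {
  kmor_map :> forall x, {linear M x -> M' x};
  kmor_act : forall x y (f : hom C x y) (m : M y),
    kmor_map x (mact M f m) = mact M' f (kmor_map y m)
}.

Definition kmor_image M M' (i : kmor M M') : subsets M' :=
  fun x => range (i x).

(* X is isomorphic to a direct summand of the submodule R of M. *)
Definition direct_summand (X M : kmod C) (R : subsets M) : Prop :=
  exists (i : kmor X M) (N : subsets M),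
    [/\ forall x, injective (i x), submodule N &
        internal_dsum R (kmor_image i) N].

End Modules.

Arguments zero_sub {k C} M x.
Arguments full_sub {k C} M x.
Arguments radical {k C} M x.

Section PullBack.
Variables (k : fieldType) (C D : kcat k) (F : kfunctor C D) (M : kmod D).

Let pob (x : C) : lmodType k := M (F x).
Let pact (x y : C) (f : hom C x y) (m : pob y) : pob x := mact M (fhom F f) m.

Lemma pull_linl (x y : C) (m : pob y) : linear (fun f : hom C x y => pact f m).
Proof. by move=> a f g; rewrite /pact linearP (mact_linl m). Qed.

Lemma pull_id (x : C) (m : pob x) : pact (cid C x) m = m.
Proof. by rewrite /pact fhom_id mact_id. Qed.

Lemma pull_comp (x y z : C) (f : hom C x y) (g : hom C y z) (m : pob z) :
  pact (kcomp f g) m = pact f (pact g m).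
Proof. by rewrite /pact fhom_comp mact_comp. Qed.

Definition pull : kmod C :=
  @KMod k C pob pact pull_linl (fun x y f => mact_linr (fhom F f))
    pull_id pull_comp.

End PullBack.

Section FirstKind.
Variable k : fieldType.

(* The maps iota j exhibit V as the (possibly infinite) direct sum of the
   modules Y j. *)
Definition is_direct_sum (J : Type) (Y : J -> lmodType k) (V : lmodType k)
    (iota : forall j, {linear Y j -> V}) : Prop :=
  (forall v, exists (n : nat) (t : 'I_n -> J) (y : forall i, Y (t i)),
     v = \sum_i iota (t i) (y i)) /\
  (forall (n : nat) (t : 'I_n -> J) (y : forall i, Y (t i)),
     injective t -> \sum_i iota (t i) (y i) = 0 -> forall i, y i = 0).

(* X is isomorphic to the push-down of Y along F: X b is the direct sum of the
   Y b' with F b' = b, and F f acts on the summands as f does. *)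
Definition is_pushdown (C' C : kcat k) (F : kfunctor C' C) (Y : kmod C')
    (X : kmod C) : Prop :=
  exists iota : forall (b : C) (t : fiber F b), {linear Y (sval t) -> X b},
    (forall b, is_direct_sum (iota b)) /\
    forall (b1 b2 : C') (f : hom C' b1 b2) (m : Y b2),
      mact X (fhom F f) (iota (F b2) (exist _ b2 erefl) m) =
      iota (F b1) (exist _ b1 erefl) (mact Y f m).

(* A module over kQ/I is a module over kQ annihilated by I. *)
Definition annihilated (Q : quiver) (I : hom_sets k Q)
    (M : kmod (pathcat k Q)) : Prop :=
  forall (x y : Q) (u : kpath k x y), I x y u ->
    forall m : M y, mact M (x := x) (y := y) u m = 0.

Variables (Q : quiver) (A : kcat k) (nu : kfunctor (pathcat k Q) A).

Section Restriction.
Variable T : set Q.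

Let AT := fullsub [set nu v | v in T].

Let rob (v : subquiver T) : AT :=
  exist _ (nu (sval v)) (ex_intro2 _ _ (sval v) (svalP v) erefl).

Let rfun := fcomp (kquiver k (subquiver_incl T)) nu.

Definition restricted_presentation : kfunctor (pathcat k (subquiver T)) AT :=
  @KFunctor k (pathcat k (subquiver T)) AT rob (fun x y => fhom rfun)
    (fun x => fhom_id rfun x) (fun x y z f g => fhom_comp rfun f g).

End Restriction.

(* The vertices of A(X): the convex hull of the support of X. *)
Definition support_hull (X : kmod A) : set Q :=
  convex_hull [set v : Q | exists m : X (nu v), m <> 0].

Definition module_first_kind (X : kmod A) : Prop :=
  let nuX := restricted_presentation (support_hull X) in
  exists (Qt : quiver) (It : hom_sets k Qt)
      (Ft : qmor Qt (subquiver (support_hull X))),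
    universal_galois_covering It (kernel nuX) Ft /\
    exists Y : kmod (pathcat k Qt),
      [/\ annihilated It Y, fin_gen Y &
        is_pushdown (kquiver k Ft) Y (pull nuX (pull (fullsub_incl _) X))].

Definition first_kind : Prop :=
  forall (x : Q) (X : kmod A),
    fin_gen X -> indecomposable X ->
    direct_summand X (radical (kproj (nu x))) -> module_first_kind X.

End FirstKind.

(* Main.v *)
(** Fix a vertex x and a vertex xt above it.  The radical of P_x is the push-down
    of the radical of P_xt, so an indecomposable summand X of it is a summand of
    the push-down of some summand M of rad P_xt, and a minimal such M is
    indecomposable.  Decomposing the endomorphisms of the push-down of M into
    their components M -> gM shows that this push-down is indecomposable, hence
    isomorphic to X, as soon as no gM with g <> 1 is isomorphic to M.  In fact M
    and gM have different supports: otherwise the cover contains a square of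
    arrows w, fw -> xt, f^-1 xt none of which is part of a longer path in the
    convex hull of its vertices, and this hull would not be simply connected.

    Let C be the convex hull of the support of X and D the connected component,
    containing the support of M, of the preimage of C.  Then D is convex, and
    since every closed walk lies in a finite convex hull, the fundamental group
    of D is trivial.  Hence D -> C is the universal Galois covering of C, and X
    is the push-down of the restriction of M to D. *)

From HB Require Import structures.
From mathcomp Require Import all_boot all_algebra boolp classical_sets cardinality.
From mathcomp Require Import finmap monalg.
Require Import Defs.

Set Implicit Arguments.
Unset Strict Implicit.
Unset Printing Implicit Defensive.

Import GRing.Theory.
Local Open Scope ring_scope.
Local Open Scope classical_set_scope.

(** * Modules over a k-category *)

(** The theorem of Krull, Remak and Schmidt is replaced by the property [fitting]: every
    endomorphism is bijective or nilpotent, so a bijective sum of two endomorphisms has a bijective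
    term. It selects an indecomposable [M] in the radical of the cover, keeps the pivots of a
    Gaussian elimination invertible, and decides between an idempotent and its complement. The
    push-down of [M] is not built as a module. It is the image of an idempotent [E] of the radical
    [R], and [X] is isomorphic to the image of an idempotent [e] below [E]; what is proved is that
    [e] is the identity on the image of [E]. The group may be infinite, so an endomorphism of [R]
    may have infinitely many components. The radical in the cover has finite support, hence over one
    vertex only finitely many of them matter, and injectivity is checked vertex by vertex. A second
    obstacle is formal: lifts and translates have end points that agree only up to a proved
    equality. Walks are therefore compared through their lists of signed arrows, and elements of
    path categories together with their end points. *)

Section SubLmodule.
Variables (k : fieldType) (V : lmodType k) (S : set V).

Definition is_subspace : Prop :=
  S 0 /\ forall (a : k) (u v : V), S u -> S v -> S (a *: u + v).

Hypothesis S_subspace : is_subspace.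

(** The dummy [let] makes the predicate depend on [S_subspace], so that the closure instance stays
    attached to it after the section is closed. *)
Definition in_sub : {pred V} := let _ := S_subspace in fun v => `[< S v >].

Lemma in_sub_closed : submod_closed in_sub.
Proof.
have [S0 SP] := S_subspace; split; first exact/asboolP.
by move=> a u v /asboolP Su /asboolP Sv; apply/asboolP/SP.
Qed.

HB.instance Definition _ := GRing.isSubmodClosed.Build k V in_sub in_sub_closed.

Record sub_lmod := SubLmod { sub_val : V; sub_valP : sub_val \in in_sub }.

HB.instance Definition _ := [isSub for sub_val].
HB.instance Definition _ := [Choice of sub_lmod by <:].
HB.instance Definition _ := [SubChoice_isSubLmodule of sub_lmod by <:].

Definition sub_inc : {linear sub_lmod -> V} := (val : {linear sub_lmod -> V}).

Lemma sub_incP (u : sub_lmod) : S (sub_inc u).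
Proof. exact/asboolP/(sub_valP u). Qed.

Lemma sub_inc_inj : injective sub_inc.
Proof. exact: val_inj. Qed.

Definition sub_in (v : V) (Sv : S v) : sub_lmod :=
  @SubLmod v (introT (asboolP (S v)) Sv).

Lemma sub_inK (v : V) (Sv : S v) : sub_inc (sub_in Sv) = v.
Proof. by []. Qed.

End SubLmodule.

Section ModuleMorphisms.
Variables (k : fieldType) (C : kcat k).
Implicit Types M N P : kmod C.

Definition mact_r M x y (f : hom C x y) : {linear M y -> M x} :=
  linfun_of (@mact_linr k C M x y f).

Definition mact_l M x y (m : M y) : {linear hom C x y -> M x} :=
  linfun_of (@mact_linl k C M x y m).

Lemma mactD M x y (f : hom C x y) (m n : M y) :
  mact M f (m + n) = mact M f m + mact M f n.
Proof. exact: (linearD (mact_r M f)). Qed.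

Lemma mactN M x y (f : hom C x y) (m : M y) : mact M f (- m) = - mact M f m.
Proof. exact: (linearN (mact_r M f)). Qed.

Lemma mact0 M x y (f : hom C x y) : mact M f 0 = 0.
Proof. exact: (linear0 (mact_r M f)). Qed.

Definition kid M : kmor M M := @KMor k C M M (fun x => idfun) (fun x y f m => erefl).

Lemma kcmp_act M N P (g : kmor N P) (f : kmor M N) x y (a : hom C x y) (m : M y) :
  (g x \o f x)%FUN (mact M a m) = mact P a ((g y \o f y)%FUN m).
Proof. by rewrite /= !kmor_act. Qed.

Definition kcmp M N P (g : kmor N P) (f : kmor M N) : kmor M P :=
  @KMor k C M P (fun x => (g x \o f x)%FUN) (@kcmp_act M N P g f).

Lemma kadd_act M N (f g : kmor M N) x y (a : hom C x y) (m : M y) :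
  (f x \+ g x)%FUN (mact M a m) = mact N a ((f y \+ g y)%FUN m).
Proof. by rewrite /= !kmor_act mactD. Qed.

Definition kadd M N (f g : kmor M N) : kmor M N :=
  @KMor k C M N (fun x => (f x \+ g x)%FUN) (@kadd_act M N f g).

Lemma ksub_act M N (f g : kmor M N) x y (a : hom C x y) (m : M y) :
  (f x \- g x)%FUN (mact M a m) = mact N a ((f y \- g y)%FUN m).
Proof. by rewrite /= !kmor_act mactD mactN. Qed.

Definition ksub M N (f g : kmor M N) : kmor M N :=
  @KMor k C M N (fun x => (f x \- g x)%FUN) (@ksub_act M N f g).

Definition kbij M N (f : kmor M N) : Prop :=
  exists g : kmor N M, (forall x, cancel (f x) (g x)) /\ (forall x, cancel (g x) (f x)).

Lemma kbijP M N (f : kmor M N) :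
  (forall x, injective (f x)) -> (forall x n, exists m, f x m = n) -> kbij f.
Proof.
move=> fi fs; pose g x n := projT1 (boolp.cid (fs x n)).
have fg x n : f x (g x n) = n by rewrite /g; case: boolp.cid.
have gl x : linear (g x) by move=> a u v; apply: (fi); rewrite linearP !fg.
have ga x y (a : hom C x y) n :
    linfun_of (gl x) (mact N a n) = mact M a (linfun_of (gl y) n).
  by apply: (fi); rewrite kmor_act /= /linear_of !fg.
exists (KMor ga); split=> x m /=; rewrite /linear_of ?fg //.
by apply: (fi); rewrite fg.
Qed.

Fixpoint kiter M (f : kmor M M) (n : nat) : kmor M M :=
  if n is n'.+1 then kcmp f (kiter f n') else kid M.

Definition knilp M (f : kmor M M) : Prop := exists n, forall x m, kiter f n x m = 0.

(* For indecomposable modules of finite length this is Fitting's lemma. *)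
Definition fitting M : Prop := forall f : kmor M M, kbij f \/ knilp f.

Lemma kiterE M (f : kmor M M) n x m : kiter f n x m = iter n (f x) m.
Proof. by elim: n => //= n ->. Qed.

Lemma kbij_inj M N (f : kmor M N) x : kbij f -> injective (f x).
Proof. by case=> g [fg _]; exact: can_inj (fg x). Qed.

Lemma kbij_ext M N (f g : kmor M N) : (forall x, f x =1 g x) -> kbij f -> kbij g.
Proof.
by move=> fg [h [fh hf]]; exists h; split=> x m; rewrite -?fg ?fh // ?hf.
Qed.

(** Since [g f] is bijective, [f] is injective and [g] surjective. If [f g] were nilpotent, some
    [(f g)^n f = f (g f)^n] would vanish although it is injective on a nonzero module; so [f g] is
    bijective as well. *)
Lemma kbij_cmp_inv M N (f : kmor M N) (g : kmor N M) :
  (exists x (m : M x), m <> 0) ->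
  kbij (kcmp g f) -> fitting N -> kbij f /\ kbij g.
Proof.
move=> [x0 [m0 m0n0]] [h [hl hr]] fN.
have gf x (m : M x) : h x (g x (f x m)) = m := hl x m.
have gh x (m : M x) : g x (f x (h x m)) = m := hr x m.
have fi x : injective (f x) by move=> u v /(congr1 (fun z => h x (g x z))); rewrite !gf.
case: (fN (kcmp f g)) => [fgb|[n fgn]].
  have gi x : injective (g x).
    by move=> u v uv; apply: (kbij_inj (x := x) fgb) => /=; rewrite uv.
  split; apply: kbijP => // x m.
    by case: fgb => r [_ /(_ x m) rr]; exists (g x (r x m)).
  by exists (f x (h x m)).
suff m00 : m0 = 0 by [].
have e j (u : M x0) : iter j (fun z => f x0 (g x0 z)) (f x0 u) = f x0 (iter j (fun z => g x0 (f x0 z)) u).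
  by elim: j => //= j ->.
have gfi j : injective (iter j (fun z => g x0 (f x0 z))).
  by elim: j => //= j IH u v /(congr1 (h x0)); rewrite !gf; apply: IH.
have := fgn x0 (f x0 m0); rewrite kiterE [iter _ _ _](e n m0) -[RHS](linear0 (f x0)) => /fi.
have e0 : iter n (fun z => g x0 (f x0 z)) 0 = 0 by elim: (n) => //= j ->; rewrite !linear0.
by rewrite -e0 => /gfi.
Qed.

(** With [h] the inverse of the sum, [h f + h g] is the identity. Either [h f] is bijective, or it
    is nilpotent and [h g] is inverted by a geometric series. *)
Lemma fitting_add M (f g : kmor M M) :
  fitting M -> kbij (kadd f g) -> kbij f \/ kbij g.
Proof.
move=> fM [h [hl hr]].
have [Mn0|M0] := pselect (exists x (m : M x), m <> 0); last first.
  have z x (m : M x) : m = 0 by apply: contrapT => mn0; apply: M0; exists x, m.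
  left; apply: kbijP => x; first by move=> u v _; rewrite (z x u) (z x v).
  by move=> u; exists 0; rewrite (z x u) linear0.
have [hf|[n hfn]] := fM (kcmp h f).
  by left; case: (kbij_cmp_inv Mn0 hf fM).
right.
have e x m : h x (g x m) = m - h x (f x m).
  by apply/eqP; rewrite eq_sym subr_eq -linearD addrC; apply/eqP; rewrite -[LHS](hl x m).
have hgb : kbij (kcmp h g).
  pose u := kcmp h f.
  (* [s j] is the sum of the powers of [u] with exponent below [j]; the empty sum is written as a
     difference of identities. *)
  pose fix s j := if j is j1.+1 then kadd (s j1) (kiter u j1) else ksub (kid M) (kid M).
  have su j x m : s j x (m - u x m) = m - kiter u j x m.
    elim: j => [|j IH] /=; first by rewrite !subrr.
    rewrite IH linearB -[kiter u j x (u x m)]/(kiter u j x (u x m)).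
    have -> : kiter u j x (u x m) = h x (f x (kiter u j x m)).
      by rewrite !kiterE -iterSr.
    by rewrite addrA subrK.
  have us j x m : s j x m - u x (s j x m) = m - kiter u j x m.
    elim: j => [|j IH]; first by rewrite /= !(subrr, linear0, subr0).
    rewrite -[s j.+1 x m]/(s j x m + kiter u j x m) linearD opprD addrACA IH.
    by rewrite addrA subrK.
  exists (s n); split=> x m /=; rewrite ?e.
    by rewrite su hfn subr0.
  by rewrite us hfn subr0.
by case: (kbij_cmp_inv Mn0 hgb fM).
Qed.

End ModuleMorphisms.

Section SubModules.
Variables (k : fieldType) (C : kcat k).
Implicit Types M : kmod C.

(* Gaussian elimination: the Schur complement of a diagonal isomorphism subtracts
   a map factoring through a different [M a] from each diagonal entry, and such a
   map is not an isomorphism. *)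
Lemma azumaya (J : eqType) (M : J -> kmod C) :
  (forall j, fitting (M j)) ->
  (forall i j, i != j -> forall (f : kmor (M i) (M j)) (g : kmor (M j) (M i)),
     ~ kbij (kcmp g f)) ->
  forall s : seq J, uniq s -> forall Phi : forall i j, kmor (M j) (M i),
  (forall i, i \in s -> kbij (Phi i i)) ->
  forall x (m : forall j, M j x),
  (forall i, i \in s -> \sum_(j <- s) Phi i j x (m j) = 0) ->
  forall j, j \in s -> m j = 0.
Proof.
move=> fM dM; elim=> [//|a s IH] /= /andP[aNs us] Phi Pd x m Pm.
have [b [lb rb]] := Pd a (mem_head _ _).
pose Psi i j := ksub (Phi i j) (kcmp (Phi i a) (kcmp b (Phi a j))).
have ma : m a = - b x (\sum_(j <- s) Phi a j x (m j)).
  have := Pm a (mem_head _ _); rewrite big_cons => /(congr1 (b x)).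
  by rewrite linearD linear0 lb => /eqP; rewrite addr_eq0 => /eqP.
have ms j : j \in s -> m j = 0.
  apply: (IH us Psi) => [i si|i si].
    have ia : i != a by apply: contraNneq aNs => <-.
    case: (@fitting_add _ _ _ (Psi i i) (kcmp (Phi i a) (kcmp b (Phi a i))) (fM i)) => //.
      apply: kbij_ext (Pd i _); last by rewrite inE si orbT.
      by move=> y u /=; rewrite subrK.
    by move/(dM _ _ ia).
  have := Pm i; rewrite inE si orbT big_cons ma => /(_ isT).
  rewrite (linearN (Phi i a x)) (linear_sum (b x)) (linear_sum (Phi i a x)) addrC -sumrN.
  rewrite -big_split /=.
  by move=> E; rewrite -[RHS]E; apply: eq_bigr.
move=> j; rewrite inE => /orP[/eqP ->|/ms //].
rewrite ma big1_seq ?linear0 ?oppr0 // => i /andP[_ si].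
by rewrite ms ?linear0.
Qed.

Section SubModule.
Variables (M : kmod C) (N : subsets M).
Arguments N : clear implicits.
Hypothesis N_sub : submodule N.

Lemma submod_subspace x : is_subspace (N x).
Proof. by have [N0 NP NA] := N_sub; split; [exact: N0|exact: NP]. Qed.

Let pob (x : C) : lmodType k := sub_lmod (submod_subspace x).

Let pact (x y : C) (f : hom C x y) (m : pob y) : pob x :=
  sub_in (submod_subspace x) (submod_act N_sub f (sub_incP m)).

Lemma submod_linl x y (m : pob y) : linear (fun f : hom C x y => pact f m).
Proof. by move=> a f g; apply: sub_inc_inj; rewrite linearP !sub_inK mact_linl. Qed.

Lemma submod_linr x y (f : hom C x y) : linear (pact f).
Proof. by move=> a u v; apply: sub_inc_inj; rewrite linearP !sub_inK linearP mact_linr. Qed.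

Lemma submod_id x (m : pob x) : pact (cid C x) m = m.
Proof. by apply: sub_inc_inj; rewrite sub_inK mact_id. Qed.

Lemma submod_comp x y z (f : hom C x y) (g : hom C y z) (m : pob z) :
  pact (kcomp f g) m = pact f (pact g m).
Proof. by apply: sub_inc_inj; rewrite !sub_inK mact_comp. Qed.

Definition subkmod : kmod C := KMod submod_linl submod_linr submod_id submod_comp.

Definition subkmod_inc : kmor subkmod M :=
  @KMor k C subkmod M (fun x => sub_inc (submod_subspace x)) (fun x y f m => erefl).

Lemma subkmod_incP x m : N x (subkmod_inc x m).
Proof. exact: sub_incP. Qed.

Lemma subkmod_inc_inj x : injective (subkmod_inc x).
Proof. exact: sub_inc_inj. Qed.

Lemma subkmod_in x m : N x m -> exists u, subkmod_inc x u = m.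
Proof. by move=> Nm; exists (sub_in (submod_subspace x) Nm). Qed.

Lemma subkmod_lift (M' : kmod C) (f : kmor M' M) : (forall x m, N x (f x m)) ->
  exists g : kmor M' subkmod, forall x m, subkmod_inc x (g x m) = f x m.
Proof.
move=> Nf; pose g x (m : M' x) : subkmod x := sub_in (submod_subspace x) (Nf x m).
have gl x : linear (g x) by move=> a u v; apply: sub_inc_inj; rewrite linearP; exact: (linearP (f x)).
have ga x y (a : hom C x y) m :
    linfun_of (gl x) (mact M' a m) = mact subkmod a (linfun_of (gl y) m).
  by apply: sub_inc_inj; exact: (kmor_act f).
by exists (KMor ga).
Qed.

End SubModule.

(** The projection along [N2]. Its value is the only element of [N1] whose difference with the
    argument lies in [N2], and this uniqueness makes the chosen map linear and compatible with the
    action. *)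
Lemma dsum_proj M (R N1 N2 : subsets M) (sR : submodule R) (s1 : submodule N1)
    (s2 : submodule N2) : internal_dsum R N1 N2 ->
  exists p : kmor (subkmod sR) (subkmod s1), forall x m,
    N2 x (subkmod_inc sR x m - subkmod_inc s1 x (p x m)).
Proof.
move=> dR.
have ex x (m : subkmod sR x) : exists u : subkmod s1 x,
    N2 x (subkmod_inc sR x m - subkmod_inc s1 x u).
  have [/(_ (subkmod_inc sR x m)) [/(_ (subkmod_incP m)) [a [b [Na Nb ->]]] _] _] := dR x.
  by have [u <-] := subkmod_in s1 Na; exists u; rewrite addrAC subrr add0r.
pose p x m := projT1 (boolp.cid (ex x m)).
have pP x m : N2 x (subkmod_inc sR x m - subkmod_inc s1 x (p x m)).
  by rewrite /p; case: boolp.cid.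
have N2B x u v : N2 x u -> N2 x v -> N2 x (u - v).
  by move=> Nu Nv; have := submodP s2 (-1) Nv Nu; rewrite scaleN1r addrC.
have pU x m u : N2 x (subkmod_inc sR x m - subkmod_inc s1 x u) -> p x m = u.
  move=> Nu; apply: (subkmod_inc_inj (N_sub := s1)); apply/eqP; rewrite -subr_eq0; apply/eqP.
  have [_] := dR x; apply; first by rewrite -linearB; apply: subkmod_incP.
  by have := N2B _ _ _ Nu (pP x m); rewrite opprB addrC addrA subrK.
have pl x : linear (p x).
  move=> a u v; apply: pU; have := submodP s2 a (pP x u) (pP x v).
  congr (N2 x _); rewrite [in RHS](linearP (subkmod_inc sR x)) [in RHS](linearP (subkmod_inc s1 x)).
  by rewrite scalerBr addrACA -opprD.
have pa x y (a : hom C x y) m :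
    linfun_of (pl x) (mact (subkmod sR) a m) = mact (subkmod s1) a (linfun_of (pl y) m).
  apply: pU; rewrite !kmor_act -mactN -mactD; exact/(submod_act s2)/pP.
by exists (KMor pa).
Qed.

Lemma full_submodule M : submodule (@full_sub k C M).
Proof. by []. Qed.

Lemma dsumC M (R N1 N2 : subsets M) : internal_dsum R N1 N2 -> internal_dsum R N2 N1.
Proof.
move=> d x; have [d1 d2] := d x; split=> [m|m N2m N1m]; last exact: d2.
split=> [/d1 [a [b [Na Nb ->]]]|[a [b [Na Nb ->]]]].
  by exists b, a; rewrite addrC.
by apply/d1; exists b, a; rewrite addrC.
Qed.

Lemma dsum_split M (N1 N2 : subsets M) (s1 : submodule N1) (s2 : submodule N2) :
  internal_dsum (@full_sub k C M) N1 N2 ->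
  exists (p1 : kmor M (subkmod s1)) (p2 : kmor M (subkmod s2)),
  [/\ forall x m, subkmod_inc s1 x (p1 x m) + subkmod_inc s2 x (p2 x m) = m,
      forall x m, p1 x (subkmod_inc s1 x m) = m,
      forall x m, p2 x (subkmod_inc s2 x m) = m,
      forall x m, p1 x (subkmod_inc s2 x m) = 0 &
      forall x m, p2 x (subkmod_inc s1 x m) = 0].
Proof.
move=> d.
(* [dsum_proj] starts from a submodule, so [M] is first identified with its full submodule. *)
have [j jP] := @subkmod_lift M (@full_sub k C M) (@full_submodule M) M (kid M) (fun _ _ => Logic.I).
have [q1 q1P] := dsum_proj (@full_submodule M) s1 s2 d.
have [q2 q2P] := dsum_proj (@full_submodule M) s2 s1 (dsumC d).
pose p1 := kcmp q1 j; pose p2 := kcmp q2 j.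
have p1P x m : N2 x (m - subkmod_inc s1 x (p1 x m)).
  by have := q1P x (j x m); rewrite jP.
have p2P x m : N1 x (m - subkmod_inc s2 x (p2 x m)).
  by have := q2P x (j x m); rewrite jP.
have d0 x u : N1 x u -> N2 x u -> u = 0 by have [_] := d x; apply.
have subB (N : subsets M) (sN : submodule N) x u v : N x u -> N x v -> N x (u - v).
  by move=> Nu Nv; have := submodP sN (-1) Nv Nu; rewrite scaleN1r addrC.
have subK (N : subsets M) (sN : submodule N) x u v : N x u -> N x (u - v) -> N x v.
  by move=> Nu Nv; rewrite -[v](subKr u); apply: subB.
exists p1, p2; split=> x m.
- apply/eqP; rewrite eq_sym -subr_eq0 opprD addrA; apply/eqP/d0.
    by rewrite addrAC; apply: subB => //; apply: subkmod_incP.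
  by apply: subB => //; apply: subkmod_incP.
- apply: (subkmod_inc_inj (N_sub := s1)); apply/eqP; rewrite eq_sym -subr_eq0; apply/eqP/d0 => //.
  by apply: subB => //; apply: subkmod_incP.
- apply: (subkmod_inc_inj (N_sub := s2)); apply/eqP; rewrite eq_sym -subr_eq0; apply/eqP/d0 => //.
  by apply: subB => //; apply: subkmod_incP.
- apply: (subkmod_inc_inj (N_sub := s1)); rewrite linear0; apply: d0; first exact: subkmod_incP.
  by apply: subK (p1P x _) => //; apply: subkmod_incP.
- apply: (subkmod_inc_inj (N_sub := s2)); rewrite linear0; apply: d0; last exact: subkmod_incP.
  by apply: subK (p2P x _) => //; apply: subkmod_incP.
Qed.

End SubModules.

(** * Fitting's lemma *)

Section Fitting.
Variable k : fieldType.

Lemma iter_linear (V : lmodType k) (f : {linear V -> V}) n : linear (iter n f).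
Proof. by elim: n => //= n IH a u v /=; rewrite IH linearP. Qed.

(** A spanning family suffices: [f] lifts to a matrix [A] along the surjection [H] from row vectors,
    and Cayley-Hamilton for [A] descends to [f]. *)
Lemma annihilating_poly (V : lmodType k) (f : {linear V -> V}) : fin_dim V ->
  exists2 P : {poly k}, P != 0 & forall v, \sum_(i < size P) P`_i *: iter i f v = 0.
Proof.
move=> [[|n] [b bV]].
  exists 1; first exact: oner_neq0.
  move=> v; have [c ->] := bV v; rewrite big_ord0 big1 // => i _.
  by have -> : iter i f 0 = 0; [elim: (nat_of_ord i) => //= j ->; rewrite linear0|rewrite scaler0].
have /choice [B BP] : forall i, exists c : 'I_n.+1 -> k, f (b i) = \sum_j c j *: b j by move=> i.
pose A := \matrix_(i, j) B i j.
pose h (c : 'rV_n.+1) : V := \sum_j c 0 j *: b j.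
have hl : linear h.
  move=> a u v; rewrite /h scaler_sumr -big_split; apply: eq_bigr => i _ /=.
  by rewrite !mxE scalerDl scalerA.
pose H := linfun_of hl.
have fh c : f (H c) = H (c *m A).
  rewrite /= /linear_of /h linear_sum.
  under [RHS]eq_bigr => j _ do rewrite mxE scaler_suml.
  rewrite exchange_big /=; apply: eq_bigr => i _.
  rewrite linearZ_LR /= BP scaler_sumr; apply: eq_bigr => j _.
  by rewrite mxE scalerA.
have fhn i c : iter i f (H c) = H (c *m A ^+ i).
  elim: i => [|i IH] /=; first by rewrite expr0 mulmx1.
  by rewrite IH fh exprSr -mulmxA.
exists (char_poly A); first exact/monic_neq0/char_poly_monic.
move=> v; have [c vc] := bV v; have -> : v = H (\row_i c i).
  by rewrite vc; apply: eq_bigr => i _; rewrite mxE.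
under eq_bigr => i _ do rewrite fhn -linearZ_LR scalemxAr.
rewrite -linear_sum -mulmx_sumr.
have -> : \sum_(i < size (char_poly A)) (char_poly A)`_i *: A ^+ i = horner_mx A (char_poly A).
  rewrite -[in RHS](coefK (char_poly A)) poly_def linear_sum; apply: eq_bigr => i _.
  by rewrite linearZ_LR /= rmorphXn /= horner_mx_X.
by rewrite Cayley_Hamilton mulmx0 linear0.
Qed.

(** Let [a] be the least index of a nonzero coefficient of an annihilating polynomial. Solving for
    that term gives [f^a = f^(a+1) s] with [s] a polynomial in [f], hence [f^n = f^(2n) s^n] for all
    [n >= a]. Both claims follow: the image of [f^n] is stable and meets its kernel trivially. *)
Lemma fitting_space (V : lmodType k) (f : {linear V -> V}) : fin_dim V ->
  exists n0, forall n, (n0 <= n)%N ->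
    (forall v, exists w, iter n f v = iter n f (iter n f w)) /\
    (forall v, iter n f (iter n f v) = 0 -> iter n f v = 0).
Proof.
move=> /(annihilating_poly f) [P Pn0 Pf].
have exa : exists i, P`_i != 0 by exists (size P).-1; rewrite lead_coef_eq0.
case: (ex_minnP exa) => a Pa amin.
(* The predecessor is harmless, since only indices [i > a] occur; it leaves one factor [f] outside
   [s]. *)
pose s v := - \sum_(i < size P | (a < i)%N) (P`_i / P`_a) *: iter (i - a).-1 f v.
have sl : linear s.
  move=> c u v; rewrite /s scalerN -opprD scaler_sumr -big_split; congr (- _).
  apply: eq_bigr => i _ /=; rewrite iter_linear scalerDr !scalerA; congr (_ *: _ + _).
  by rewrite mulrC.
pose S := linfun_of sl.
have sf v : S (f v) = f (S v).
  rewrite /= /linear_of /s (linearN f) (linear_sum f); congr (- _); apply: eq_bigr => i _.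
  by rewrite (linearZ_LR f) -iterSr.
have fas v : iter a f v = iter a.+1 f (S v).
  pose L m := linfun_of (iter_linear f m).
  have aP : (a < size P)%N by rewrite ltnNge; apply: contra Pa => /leq_sizeP/(_ a (leqnn a)) ->.
  have := Pf v; rewrite (bigD1 (Ordinal aP)) //= => /eqP; rewrite addr_eq0 => /eqP e.
  apply: (scalerI Pa); rewrite e -[f (iter a f _)]/(L a.+1 (s v)) /s.
  rewrite (linearN (L a.+1)) (linear_sum (L a.+1)) scalerN scaler_sumr.
  congr (- _); rewrite [LHS](bigID (fun i : 'I_(size P) => (a < i)%N)) /= [X in _ + X]big1 ?addr0.
    apply: eq_big => [i|i /andP[_ ai]].
      by apply: andb_idl => ai; rewrite -val_eqE /= gtn_eqF.
    rewrite (linearZ_LR (L a.+1)) scalerA mulrCA divff // mulr1 /= /linear_of -iterD; congr (_ *: iter _ _ _).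
    by rewrite -subnS subnKC.
  move=> i /andP[ia]; rewrite -leqNgt leq_eqVlt (negPf (_ : (i : nat) != a)) //= => ltia.
  suff -> : P`_i = 0 by rewrite scale0r.
  by apply: contraTeq ltia => /amin; rewrite -leqNgt.
have sfn n v : iter n f (S v) = S (iter n f v) by elim: n => //= n ->; rewrite sf.
have fnS n v : (a <= n)%N -> iter n f v = iter n.+1 f (S v).
  by move=> an; rewrite -(subnK an) iterD fas -iterD addnS.
have fnn n j v : (a <= n)%N -> iter n f v = iter (n + j) f (iter j S v).
  move=> an; elim: j => [|j IH]; first by rewrite addn0.
  by rewrite IH fnS ?(leq_trans an) ?leq_addr // addnS.
exists a => n an; split=> v; first by exists (iter n S v); rewrite -iterD; apply: fnn.
move=> e; rewrite (fnn n n) // iterD.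
have -> : forall m w, iter n f (iter m S w) = iter m S (iter n f w).
  by elim=> //= m IH w; rewrite sfn IH.
have -> : forall m w, iter n f (iter m S w) = iter m S (iter n f w).
  by elim=> //= m IH w; rewrite sfn IH.
by rewrite e; elim: (n) => //= m ->; rewrite linear0.
Qed.

Lemma finite_enum (T : Type) (A : set T) : finite_set A ->
  exists s : seq {classic T}, uniq s /\ forall x, A x <-> x \in s.
Proof.
move=> /(finite_seqP (T := {classic T})) [s As]; exists (undup s); split; first exact: undup_uniq.
by move=> x; rewrite As /= (mem_undup s).
Qed.

Lemma finite_bound (T : Type) (A : set T) (P : T -> nat -> Prop) : finite_set A ->
  (forall x, exists n0, forall n, (n0 <= n)%N -> P x n) ->
  exists n, forall x, A x -> P x n.+1.
Proof.
move=> /finite_enum [s [_ As]] H.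
suff [n nP] : exists n, forall x m, x \in s -> (n <= m)%N -> P x m.
  by exists n => x /As xs; apply: nP.
elim: s {As} => [|y s [n IH]]; first by exists 0%N.
have [n0 n0P] := H y; exists (maxn n n0) => x m.
rewrite inE geq_max => /orP[/eqP -> |xs] /andP[nm n0m]; first exact: n0P.
exact: IH.
Qed.

Variable C : kcat k.

Definition supp (M : kmod C) : set C := [set x | exists m : M x, m <> 0].

Definition fin_length (M : kmod C) : Prop :=
  finite_set (supp M) /\ forall x, fin_dim (M x).

Lemma notin_supp (M : kmod C) x (m : M x) : ~ supp M x -> m = 0.
Proof. by move=> nx; apply: contrapT => mn0; apply: nx; exists m. Qed.

(** A high power [F] of [f] splits [M] into its kernel and its image. Indecomposability kills one of
    them: without kernel [f] is bijective, without image it is nilpotent. *)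
Lemma indecomposable_fitting (M : kmod C) :
  fin_length M -> indecomposable M -> fitting M.
Proof.
move=> [fM dM] [_ iM] f.
(* One exponent serves all vertices of the support. It is taken positive so that bijectivity of the
   power passes to [f]. *)
have [n nP] := finite_bound fM (fun x => fitting_space (f x) (dM x)).
have fS x : (forall v, exists w, iter n.+1 (f x) v = iter n.+1 (f x) (iter n.+1 (f x) w)) /\
    (forall v, iter n.+1 (f x) (iter n.+1 (f x) v) = 0 -> iter n.+1 (f x) v = 0).
  have [/nP //|nx] := pselect (supp M x).
  by split=> [v|v _]; [exists 0; rewrite !(notin_supp (iter n.+1 (f x) _) nx)|exact: notin_supp].
pose F := kiter f n.+1.
have FS x : (forall v, exists w, F x v = F x (F x w)) /\ (forall v, F x (F x v) = 0 -> F x v = 0).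
  have [f1 f2] := fS x; split=> v; last by rewrite !kiterE; apply: f2.
  by have [w wP] := f1 v; exists w; rewrite !kiterE.
pose N1 : subsets M := fun x => [set m | F x m = 0].
pose N2 : subsets M := fun x => range (F x).
have s1 : submodule N1.
  split=> [x|x a u v e1 e2|x y a u e]; first exact: (linear0 (F x)).
    by change (F x (a *: u + v) = 0); rewrite linearP (e1 : F x u = 0) (e2 : F x v = 0) scaler0 addr0.
  by change (F x (mact M a u) = 0); rewrite kmor_act (e : F y u = 0) mact0.
have s2 : submodule N2.
  split=> [x|x a _ _ [u _ <-] [v _ <-]|x y a _ [u _ <-]].
  - by exists 0 => //; rewrite linear0.
  - by exists (a *: u + v) => //; rewrite linearP.
  - by exists (mact M a u) => //; rewrite kmor_act.
case: (iM _ _ s1 s2) => [x|N10|N20].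
- split=> [m|m N1m [w _ wm]]; last first.
    by move: N1m; rewrite -wm => /(proj2 (FS x)).
  split=> // _; have [w Fw] := (proj1 (FS x)) m.
  exists (m - F x w), (F x w); split; last by rewrite subrK.
    by change (F x (m - F x w) = 0); rewrite linearB Fw subrr.
  by exists w.
- left; have Fi x : injective (F x).
    move=> u v uv; apply/eqP; rewrite -subr_eq0; apply/eqP.
    have : N1 x (u - v) by change (F x (u - v) = 0); rewrite linearB uv subrr.
    by rewrite N10.
  apply: kbijP => x.
    by move=> u v uv; apply: Fi; rewrite !kiterE !iterSr uv.
  move=> v; have [w] := (proj1 (FS x)) v; move=> /Fi ->.
  by exists (kiter f n x w).
- right; exists n.+1 => x m; have : N2 x (F x m) by exists m.
  by rewrite N20.
Qed.

End Fitting.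

(** * Path categories and Galois coverings *)

Lemma existT_inj (A : Type) (P : A -> Type) (a : A) (x y : P a) :
  existT P a x = existT P a y -> x = y.
Proof. by move=> e; have := projT2_eq e; rewrite (Prop_irrelevance (projT1_eq e) erefl). Qed.

Lemma mk_tarrow_inj (Q : quiver) (x y : Q) (a b : arrow Q x y) :
  mk_tarrow a = mk_tarrow b -> a = b.
Proof. by move=> e; exact: existT_inj (existT_inj e). Qed.

Lemma mk_tarrow_ends (Q : quiver) (x y x' y' : Q) (a : arrow Q x y) (b : arrow Q x' y') :
  mk_tarrow a = mk_tarrow b -> x = x' /\ y = y'.
Proof.
move=> e; split; first exact: (congr1 (fun t : tarrow Q => projT1 t) e).
exact: (congr1 (fun t : tarrow Q => projT1 (projT2 t)) e).
Qed.

Lemma qmor_eqE (Q' Q : quiver) (F G : qmor Q' Q) : qmor_eq F G -> F = G.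
Proof.
case: F G => [f fa] [g ga] [/= fg e]; have {}fg := funext fg; case: _ / fg in ga e *.
congr QMor; apply: functional_extensionality_dep => x.
apply: functional_extensionality_dep => y; apply: functional_extensionality_dep => a.
exact/mk_tarrow_inj/(e (mk_tarrow a)).
Qed.

Section PullIndecomposable.
Variables (k : fieldType) (C D : kcat k) (F : kfunctor C D).
Hypothesis F_inj : injective (fob F).
Hypothesis F_surj : forall y, exists x, F x = y.
Hypothesis F_full : forall x y (f : hom D (F x) (F y)), exists g : hom C x y, fhom F g = f.

(** A full functor that is bijective on objects identifies submodules on both sides, and with them
    direct decompositions. *)
Lemma pull_indecomposable (M : kmod D) : indecomposable M -> indecomposable (pull F M).
Proof.
move=> [[y [m mn0]] iM]; split.
  by have [x e] := F_surj y; case: _ / e in m mn0; exists x, m.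
(* Quantifying over all preimages of [y], of which there is exactly one, avoids choosing an inverse
   on objects. *)
pose up (N : subsets (pull F M)) : subsets M := fun y =>
  [set m | forall x (e : y = F x), N x (eq_rect y (fun z => M z) m (F x) e)].
have upE N x m0 : up N (F x) m0 <-> N x m0.
  split=> [/(_ x erefl) //|Nm x' e]; have exx := F_inj e.
  by case: _ / exx in e *; rewrite (Prop_irrelevance e erefl).
have upS N : submodule N -> submodule (up N).
  move=> [N0 NP NA]; split=> [z|z a u v|z t f u].
  - by have [x e] := F_surj z; case: _ / e; apply/upE/N0.
  - have [x e] := F_surj z; case: _ / e in u v * => /upE Nu /upE Nv.
    exact/upE/NP.
  - have [x e] := F_surj z; case: _ / e in f *.
    have [x' e'] := F_surj t; case: _ / e' in f u *.
    by have [g <-] := F_full f => /upE Nu; apply/upE; apply: NA.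
move=> N1 N2 s1 s2 d.
have up0 N : up N = @zero_sub k D M -> N = @zero_sub k C (pull F M).
  move=> e; apply: functional_extensionality_dep => x; apply/predeqP => m0.
  by rewrite -upE e.
case: (iM _ _ (upS _ s1) (upS _ s2)) => [z|/up0|/up0]; [|by left|by right].
have [x e] := F_surj z; case: _ / e; have [d1 d2] := d x; split=> [m0|m0 /upE n1 /upE n2].
  split=> // _; have [/(_ Logic.I) [a [b [Na Nb e]]] _] := d1 m0.
  by exists a, b; split=> //; apply/upE.
exact: d2.
Qed.

End PullIndecomposable.

Lemma pull_fin_length (k : fieldType) (C D : kcat k) (F : kfunctor C D) (M : kmod D) :
  injective (fob F) -> fin_length M -> fin_length (pull F M).
Proof.
move=> Fi [fM dM]; split=> [|x]; last exact: dM.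
have -> : supp (pull F M) = fob F @^-1` supp M by [].
by apply: finite_preimage => // x y _ _ /Fi.
Qed.

Section PathModules.
Variables (k : fieldType) (Q : quiver).
Implicit Types M : kmod (pathcat k Q).

Definition arr (x y : Q) (a : arrow Q x y) : hom (pathcat k Q) x y :=
  << pcons a (pnil y) >>.

Definition pel (x y : Q) (p : qpath x y) : hom (pathcat k Q) x y := << p >>.

Lemma pel_cons x y z (a : arrow Q x y) (p : qpath y z) :
  pel (pcons a p) = @kcomp k (pathcat k Q) _ _ _ (arr a) (pel p).
Proof. by rewrite /= kpath_compU. Qed.

Lemma mact_pel_cons M x y z (a : arrow Q x y) (p : qpath y z) (m : M z) :
  mact M (pel (pcons a p)) m = mact M (arr a) (mact M (pel p) m).
Proof. by rewrite pel_cons mact_comp. Qed.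

(** Paths are composites of arrows and span the morphisms, so compatibility with arrows is enough.
    Later morphisms of modules over path categories are obtained this way. *)
Lemma arrow_act (M M' : kmod (pathcat k Q)) (f : forall x : Q, {linear M x -> M' x}) :
  (forall x y (a : arrow Q x y) (m : M y),
    f x (mact M (arr a) m) = mact M' (arr a) (f y m)) ->
  forall x y (u : hom (pathcat k Q) x y) (m : M y), f x (mact M u m) = mact M' u (f y m).
Proof.
move=> fa x y u m.
have fp (p : qpath x y) : f x (mact M (pel p) m) = mact M' (pel p) (f y m).
  elim: p m => [z m|x' y' z' a p IH m].
    by rewrite (@mact_id k _ M z m) (@mact_id k _ M' z (f z m)).
  by rewrite (@mact_pel_cons M _ _ _ a p m) fa IH -mact_pel_cons.
pose f1 := (f x \o @mact_l k _ M x y m : {linear hom (pathcat k Q) x y -> M' x})%FUN.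
pose f2 := @mact_l k _ M' x y (f y m) : {linear hom (pathcat k Q) x y -> M' x}.
exact: (@malg_linear_ext k (qpath x y) (M' x) f1 f2 fp).
Qed.

Definition arrow_kmor (M M' : kmod (pathcat k Q)) (f : forall x : Q, {linear M x -> M' x})
    (fa : forall x y (a : arrow Q x y) (m : M y),
      f x (mact M (arr a) m) = mact M' (arr a) (f y m)) : kmor M M' :=
  KMor (arrow_act fa).

End PathModules.

Lemma kquiver_arr (k : fieldType) (Q' Q : quiver) (F : qmor Q' Q) x y (a : arrow Q' x y) :
  fhom (kquiver k F) (arr k a) = arr k (qma F a).
Proof. exact: kqmapU. Qed.

Lemma kquiver_pel (k : fieldType) (Q' Q : quiver) (F : qmor Q' Q) x y (p : qpath x y) :
  fhom (kquiver k F) (pel k p) = pel k (pmap_quiver F p).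
Proof. exact: kqmapU. Qed.

Lemma sval_inj (T : Type) (P : T -> Prop) (u v : {x | P x}) : sval u = sval v -> u = v.
Proof. by case: u v => [x p] [y q] /= e; case: _ / e in q *; rewrite (Prop_irrelevance p q). Qed.

Arguments kqmap : simpl never.

Section TotalPaths.
Variable k : fieldType.

(* Elements of path categories up to equality of their end points. *)
Definition tpath (Q : quiver) := {x : Q & {y : Q & kpath k x y}}.

Definition tk (Q : quiver) (x y : Q) (u : kpath k x y) : tpath Q :=
  existT _ x (existT _ y u).

Lemma tk_inj (Q : quiver) (x y : Q) (u v : kpath k x y) : tk u = tk v -> u = v.
Proof. by move=> e; exact: existT_inj (existT_inj e). Qed.

(** Membership in an ideal read on total elements, so that an equation between [tk] terms can be
    rewritten inside it although the end points differ. *)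
Definition in_tot (Q : quiver) (I : hom_sets k Q) (t : tpath Q) : Prop :=
  I _ _ (projT2 (projT2 t)).

Lemma tk_castr (Q : quiver) (x y z : Q) (e : y = z) (u : kpath k x y) :
  tk (eq_rect y (fun t => kpath k x t) u z e) = tk u.
Proof. by case: _ / e. Qed.

Lemma tk_castl (Q : quiver) (x y z : Q) (e : x = z) (u : kpath k x y) :
  tk (eq_rect x (fun t => kpath k t y) u z e) = tk u.
Proof. by case: _ / e. Qed.

Lemma tk_kqmap (Q' Q : quiver) (F : qmor Q' Q) x y x' y'
    (u : kpath k x y) (v : kpath k x' y') :
  tk u = tk v -> tk (kqmap k F x y u) = tk (kqmap k F x' y' v).
Proof.
pose f (t : tpath Q') := tk (kqmap k F _ _ (projT2 (projT2 t))).
by move=> /(congr1 f).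
Qed.

Lemma pmap_qmcomp (Q1 Q2 Q3 : quiver) (H : qmor Q2 Q3) (F : qmor Q1 Q2) x y (p : qpath x y) :
  pmap_quiver (qmcomp H F) p = pmap_quiver H (pmap_quiver F p).
Proof. by elim: p => //= x' y' z' a p ->. Qed.

Lemma kqmap_qmcomp (Q1 Q2 Q3 : quiver) (H : qmor Q2 Q3) (F : qmor Q1 Q2) x y
    (u : kpath k x y) :
  kqmap k (qmcomp H F) x y u = kqmap k H _ _ (kqmap k F x y u).
Proof.
pose f := (kqmap k H (F x) (F y) \o kqmap k F x y)%FUN.
apply: (malg_linear_ext (f := kqmap k (qmcomp H F) x y) (g := f)) => p.
change (kqmap k (qmcomp H F) x y << p >> = kqmap k H _ _ (kqmap k F x y << p >>)).
by rewrite !kqmapU -pmap_qmcomp.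
Qed.

Lemma kqmap_qmid (Q : quiver) (x y : Q) (u : kpath k x y) : kqmap k (qmid Q) x y u = u.
Proof.
apply: (malg_linear_ext (f := kqmap k (qmid Q) x y) (g := idfun)) => p.
rewrite kqmapU; congr << _ >>; by elim: p => //= x' y' z' a p ->.
Qed.

Lemma tk_kqmap_eq (Q' Q : quiver) (F H : qmor Q' Q) x y (u : kpath k x y) :
  F = H -> tk (kqmap k F x y u) = tk (kqmap k H x y u).
Proof. by move->. Qed.

Lemma tk_kqmap_to (Q' Q : quiver) (F : qmor Q' Q) (x' : Q') (y : Q)
    (t : fiber F y) (u : kpath k x' (sval t)) :
  tk (kqmap_to u) = tk (kqmap k F x' (sval t) u).
Proof. exact: tk_castr. Qed.

Definition kqmap_from (Q' Q : quiver) (F : qmor Q' Q) (x' : Q') (y : Q)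
    (t : fiber F y) (u : kpath k (sval t) x') : kpath k y (F x') :=
  eq_rect _ (fun z => kpath k z (F x')) (kqmap k F (sval t) x' u) _ (svalP t).

Lemma tk_kqmap_from (Q' Q : quiver) (F : qmor Q' Q) (x' : Q') (y : Q)
    (t : fiber F y) (u : kpath k (sval t) x') :
  tk (kqmap_from u) = tk (kqmap k F (sval t) x' u).
Proof. exact: tk_castl. Qed.

End TotalPaths.

Section Galois.
Variables (k : fieldType) (Q' Q : quiver) (I' : hom_sets k Q') (I : hom_sets k Q).
Arguments I : clear implicits.
Arguments I' : clear implicits.
Variables (F : qmor Q' Q) (G : groupType) (act : G -> qmor Q' Q').
Hypothesis gc : galois_covering I' I F act.

Lemma gc_act1E : act 1%g = qmid Q'.
Proof. exact/qmor_eqE/(gc_act1 gc). Qed.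

Lemma gc_actME g h : act (g * h)%g = qmcomp (act g) (act h).
Proof. exact/qmor_eqE/(gc_actM gc). Qed.

Lemma gc_invE g : qmcomp F (act g) = F.
Proof. exact/qmor_eqE/(gc_inv gc). Qed.

Lemma gc_invv g x : F (act g x) = F x.
Proof. exact: (congr1 (fun H : qmor Q' Q => H x) (gc_invE g)). Qed.

Lemma gc_inva g a : qmt F (qmt (act g) a) = qmt F a.
Proof. by rewrite -[RHS](congr1 (fun H : qmor Q' Q => qmt H a) (gc_invE g)). Qed.

Lemma gc_actVK g : qmcomp (act g^-1%g) (act g) = qmid Q'.
Proof. by rewrite -gc_actME mulVg gc_act1E. Qed.

Lemma gc_actKV g : qmcomp (act g) (act g^-1%g) = qmid Q'.
Proof. by rewrite -gc_actME mulgV gc_act1E. Qed.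

Lemma gc_actVKv g x : act g^-1%g (act g x) = x.
Proof. exact: (congr1 (fun H : qmor Q' Q' => H x) (gc_actVK g)). Qed.

Lemma gc_actKVv g x : act g (act g^-1%g x) = x.
Proof. exact: (congr1 (fun H : qmor Q' Q' => H x) (gc_actKV g)). Qed.

Lemma gc_act_free g h x : act g x = act h x -> g = h.
Proof.
move=> e; have /(gc_free gc) : act (h^-1 * g)%g x = x.
  by rewrite gc_actME /= e gc_actVKv.
by move=> e1; rewrite -[g]mul1g -(mulgV h) -mulgA e1 mulg1.
Qed.

(** Some arrow lies over [a], and the group, transitive on fibres, moves its source to [x']. *)
Lemma lift_arrow_out x y (a : arrow Q x y) (x' : Q') : F x' = x ->
  exists y' (a' : arrow Q' x' y'), qmt F (mk_tarrow a') = mk_tarrow a.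
Proof.
move=> ex; have [[s [t b]] eb] := gc_surja gc (mk_tarrow a).
have [Fs _] := mk_tarrow_ends eb.
have [g gs] : exists g, act g s = x' by apply: (gc_fiberv gc); rewrite Fs.
have := gc_inva g (mk_tarrow b); rewrite eb /=.
by case: _ / gs => e; exists (act g t), (qma (act g) b).
Qed.

Lemma lift_arrow_in x y (a : arrow Q x y) (y' : Q') : F y' = y ->
  exists x' (a' : arrow Q' x' y'), qmt F (mk_tarrow a') = mk_tarrow a.
Proof.
move=> ex; have [[s [t b]] eb] := gc_surja gc (mk_tarrow a).
have [_ Ft] := mk_tarrow_ends eb.
have [g gt] : exists g, act g t = y' by apply: (gc_fiberv gc); rewrite Ft.
have := gc_inva g (mk_tarrow b); rewrite eb /=.
by case: _ / gt => e; exists (act g s), (qma (act g) b).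
Qed.

(** Two lifts of one arrow differ by a group element; having the same source, they force it to fix a
    vertex, hence to be trivial. *)
Lemma arrow_uniq_out x y1 y2 (a : arrow Q' x y1) (b : arrow Q' x y2) :
  qmt F (mk_tarrow a) = qmt F (mk_tarrow b) -> mk_tarrow a = mk_tarrow b.
Proof.
move=> /(gc_fibera gc) [g e]; have [gx _] := mk_tarrow_ends e.
by move: e; rewrite (gc_free gc gx) gc_act1E.
Qed.

Lemma arrow_uniq_in x1 x2 y (a : arrow Q' x1 y) (b : arrow Q' x2 y) :
  qmt F (mk_tarrow a) = qmt F (mk_tarrow b) -> mk_tarrow a = mk_tarrow b.
Proof.
move=> /(gc_fibera gc) [g e]; have [_ gx] := mk_tarrow_ends e.
by move: e; rewrite (gc_free gc gx) gc_act1E.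
Qed.

(* Translating the summands by the group makes them start at the same vertex. *)
Lemma gc_faithful_in (x' : Q') (y : Q) (n : nat) (t : 'I_n -> fiber F y)
    (u : forall i, kpath k (sval (t i)) x') :
  injective t -> I y (F x') (\sum_i kqmap_from (u i)) -> forall i, I' _ x' (u i).
Proof.
move=> ti; have [b0 eb] := gc_surjv gc y; case: _ / eb in t u ti *.
have /choice [g gt] i : exists g, act g b0 = sval (t i).
  by apply: (gc_fiberv gc); rewrite (svalP (t i)).
have tV i : act (g i)^-1%g (sval (t i)) = b0 by rewrite -gt gc_actVKv.
have ft i : F (act (g i)^-1%g x') = F x' := gc_invv _ _.
pose v i := eq_rect _ (fun z => kpath k z (act (g i)^-1%g x'))
  (kqmap k (act (g i)^-1%g) _ _ (u i)) _ (tV i).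
pose t' i : fiber F (F x') := exist _ (act (g i)^-1%g x') (ft i).
have t'i : injective t'.
  move=> i j /(congr1 sval) /= /gc_act_free /invg_inj gij.
  by apply: ti; apply: sval_inj; rewrite -!gt gij.
have vE i : @kqmap_to k _ _ F b0 (F x') (t' i) (v i) = kqmap_from (u i).
  apply: tk_inj; rewrite tk_kqmap_to tk_kqmap_from.
  rewrite (tk_kqmap F (tk_castl _ _)) -kqmap_qmcomp.
  exact: (tk_kqmap_eq (u i) (gc_invE _)).
rewrite -(eq_bigr _ (fun i _ => vE i)) => /(gc_faithful gc t'i) I'v i.
have := @gc_actI _ _ _ _ _ _ _ _ gc (g i) _ _ _ (I'v i).
rewrite -[I' _ _ _]/(in_tot I' (tk _)) (tk_kqmap (act (g i)) (tk_castl _ _)) -kqmap_qmcomp.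
by rewrite (tk_kqmap_eq _ (gc_actKV (g i))) kqmap_qmid.
Qed.

End Galois.

(** * Summands of push-downs *)

(** Outside the finite list [L] the summands vanish, so every vector is a finite sum with unique
    coordinates, and these are linear in the vector. *)
Lemma direct_sum_proj (k : fieldType) (J : choiceType) (Y : J -> lmodType k) (V : lmodType k)
    (iota : forall j, {linear Y j -> V}) (L : seq J) :
  is_direct_sum iota -> uniq L -> (forall j (y : Y j), j \notin L -> y = 0) ->
  exists pr : forall j, {linear V -> Y j},
  [/\ forall j y, pr j (iota j y) = y,
      forall i j y, i != j -> pr j (iota i y) = 0 &
      forall v, v = \sum_(j <- L) iota j (pr j v)].
Proof.
move=> [ds1 ds2] uL L0.
pose ev (y : forall j, Y j) := \sum_(j <- L) iota j (y j).
have evD a (y z : forall j, Y j) : ev (fun j => a *: y j + z j) = a *: ev y + ev z.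
  by rewrite /ev scaler_sumr -big_split; apply: eq_bigr => j _; rewrite linearP.
pose dl i (y : Y i) : forall j, Y j := @dfwith J (fun j => Y j) (fun j => 0 : Y j) i y.
have evdl i (y : Y i) : ev (dl i y) = iota i y.
  have [iL|/(L0 _ y) ->] := boolP (i \in L).
    rewrite /ev (bigD1_seq i) //= /dl dfwith_in big1 ?addr0 // => j ji.
    by rewrite dfwith_out 1?eq_sym // linear0.
  rewrite /ev linear0 big1 // => j _; rewrite /dl.
  have [<-|ij] := eqVneq i j; first by rewrite dfwith_in linear0.
  by rewrite dfwith_out // linear0.
have ev0 : ev (fun j => 0) = 0 by rewrite /ev big1 // => j _; rewrite linear0.
have ex v : exists y, v = ev y.
  have [n [t [y ->]]] := ds1 v; elim/big_ind: _ => [|_ _ [y1 ->] [y2 ->]|i _].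
  - by exists (fun j => 0).
  - by exists (fun j => 1 *: y1 j + y2 j); rewrite evD scale1r.
  - by exists (dl _ (y i)); rewrite evdl.
have un y : ev y = 0 -> forall j, y j = 0.
  move=> e j; have [jL|/(L0 _ (y j)) //] := boolP (j \in L).
  rewrite /ev big_tnth in e.
  have ti : injective (tnth (in_tuple L)) by apply/tuple_uniqP.
  have [i ->] : exists i, j = tnth (in_tuple L) i by apply/tnthP.
  exact: (ds2 _ (tnth (in_tuple L)) (fun i => y (tnth (in_tuple L) i)) ti e i).
have unE y z : ev y = ev z -> forall j, y j = z j.
  move=> e j; apply/eqP; rewrite -subr_eq0 addrC -scaleN1r; apply/eqP.
  by apply: (un (fun j => -1 *: z j + y j)); rewrite evD scaleN1r e addNr.
pose p j v := projT1 (boolp.cid (ex v)) j.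
have pE v : v = ev (p^~ v) by rewrite /p; case: boolp.cid.
have pU v y : v = ev y -> forall j, p j v = y j by move=> vy j; apply: unE (j); rewrite -pE.
have pl j : linear (p j).
  by move=> a u v; apply: (pU _ (fun j => a *: p j u + p j v)); rewrite evD -!pE.
exists (fun j => linfun_of (pl j)); split=> [j y|i j y ij|v]; last exact: pE.
  by rewrite /= /linear_of (pU _ (dl _ y)) ?evdl // /dl dfwith_in.
by rewrite /= /linear_of (pU _ (dl _ y)) ?evdl // /dl dfwith_out.
Qed.

Section Spanned.
Variable k : fieldType.

(** An upper bound for the dimension. It takes the place of the dimension in the descent on length
    below. *)
Definition spanned (V : lmodType k) (n : nat) : Prop :=
  exists b : 'I_n -> V, forall v, exists c : 'I_n -> k, v = \sum_i c i *: b i.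

Lemma spanned_image (U V : lmodType k) (p : {linear U -> V}) n :
  (forall v, exists u, p u = v) -> spanned U n -> spanned V n.
Proof.
move=> ps [b bP]; exists (p \o b) => v; have [u <-] := ps v; have [c ->] := bP u.
by exists c; rewrite linear_sum; apply: eq_bigr => i _; rewrite linearZ_LR.
Qed.

Lemma spanned_proper_image (U V : lmodType k) (p : {linear U -> V}) n (z : U) :
  (forall v, exists u, p u = v) -> z <> 0 -> p z = 0 -> spanned U n ->
  (0 < n)%N /\ spanned V n.-1.
Proof.
move=> ps zn0 pz [b bP]; have [c zc] := bP z.
case: n => [|n] in b bP c zc *; first by case: zn0; rewrite zc big_ord0.
split=> //=; have [i0 ci0] : exists i, c i != 0.
  apply: contrapT => nc; apply: zn0; rewrite zc big1 // => i _.
  have [->|ci] := eqVneq (c i) 0; first by rewrite scale0r.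
  by case: nc; exists i.
have pb : p (b i0) = \sum_j (- (c i0)^-1 * c (lift i0 j)) *: p (b (lift i0 j)).
  have : (c i0)^-1 *: p z = 0 by rewrite pz scaler0.
  rewrite zc linear_sum (bigD1_ord i0) //= linearZ_LR scalerDr scalerA mulVf // scale1r.
  move/eqP; rewrite addr_eq0 => /eqP ->; rewrite scaler_sumr -sumrN; apply: eq_bigr => j _.
  by rewrite (linearZ_LR p) /= scalerA mulNr scaleNr.
exists (fun j => p (b (lift i0 j))) => v; have [u <-] := ps v; have [d ->] := bP u.
exists (fun j => d i0 * (- (c i0)^-1 * c (lift i0 j)) + d (lift i0 j)).
rewrite linear_sum (bigD1_ord i0) //= linearZ_LR /= pb scaler_sumr -big_split; apply: eq_bigr => j _.
by rewrite (linearZ_LR p) /= scalerA scalerDl.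
Qed.

End Spanned.

Section PullMorphisms.
Variables (k : fieldType) (C D : kcat k) (F : kfunctor C D) (M N : kmod D).

Definition kpull (f : kmor M N) : kmor (pull F M) (pull F N) :=
  @KMor k C (pull F M) (pull F N) (fun x => f (F x)) (fun x y a m => kmor_act f (fhom F a) m).

Lemma kpull_bij (f : kmor M N) : kbij f -> kbij (kpull f).
Proof.
move=> [g [fg gf]]; pose h : kmor (pull F N) (pull F M) :=
  @KMor k C (pull F N) (pull F M) (fun x => g (F x)) (fun x y a m => kmor_act g (fhom F a) m).
by exists h; split=> x m; [exact: fg|exact: gf].
Qed.

End PullMorphisms.

Section Gradable.
Variables (k : fieldType) (Q' Q : quiver) (I' : hom_sets k Q') (I : hom_sets k Q).
Variables (F : qmor Q' Q) (G : groupType) (act : G -> qmor Q' Q').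
Hypothesis gc : galois_covering I' I F act.
Variables (Rt : kmod (pathcat k Q')) (R : kmod (pathcat k Q)).
Variable iota : forall (b : Q) (t : fiber F b), {linear Rt (sval t) -> R b}.
Hypothesis Rt_fin : fin_length Rt.
Hypothesis iota_sum : forall b, is_direct_sum (@iota b).
(** The equations [e1] and [e2] are arbitrary, so that the rule applies at any point of a fibre and
    not only at [y] seen over [F y]. *)
Hypothesis iota_act : forall (b1' b2' : Q') (a : arrow Q' b1' b2') (b1 b2 : Q)
  (a0 : arrow Q b1 b2) (e1 : F b1' = b1) (e2 : F b2' = b2),
  qmt F (mk_tarrow a) = mk_tarrow a0 -> forall m : Rt b2',
  mact R (arr k a0) (iota (exist _ b2' e2) m) = iota (exist _ b1' e1) (mact Rt (arr k a) m).

Lemma fiber_proj : exists (L : forall b, seq {classic fiber F b})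
    (pr : forall b (t : fiber F b), {linear R b -> Rt (sval t)}),
  [/\ forall b, uniq (L b),
      forall b (t : fiber F b) m, pr b t (iota t m) = m,
      forall b (t s : fiber F b) m, t <> s -> pr b s (iota t m) = 0 &
      forall b v, v = \sum_(t <- L b) iota t (pr b t v)].
Proof.
have [fR _] := Rt_fin.
have ex b : exists L : seq {classic fiber F b}, uniq L /\
    forall t : {classic fiber F b}, t \notin L -> forall y : Rt (sval t), y = 0.
  have fL : finite_set [set t : fiber F b | supp Rt (sval t)].
    have -> : [set t : fiber F b | supp Rt (sval t)] = sval @^-1` supp Rt by [].
    by apply: finite_preimage => // x y _ _ /sval_inj.
  have [L [uL LP]] := finite_enum fL; exists L; split=> // t tL y.
  by apply: notin_supp => st; move/negP: tL; apply; apply/LP.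
pose L b := projT1 (boolp.cid (ex b)).
have LP b : uniq (L b) /\
    forall t : {classic fiber F b}, t \notin L b -> forall y : Rt (sval t), y = 0.
  by rewrite /L; case: boolp.cid.
have ex2 b := @direct_sum_proj k {classic fiber F b} _ _ (@iota b) (L b) (iota_sum b) (proj1 (LP b))
  (fun j y jL => proj2 (LP b) j jL y).
exists L, (fun b => projT1 (boolp.cid (ex2 b))); split=> [b|b t m|b t s m|b v].
- by case: (LP b).
- by case: boolp.cid => pr /= [].
- by move=> ts; case: boolp.cid => pr /= [_ h _]; apply: h; apply/eqP.
- by case: boolp.cid => pr /= [].
Qed.

Section Graded.
Variables (L : forall b, seq {classic fiber F b})
    (pr : forall b (t : fiber F b), {linear R b -> Rt (sval t)}).
Hypothesis L_uniq : forall b, uniq (L b).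
Hypothesis prK : forall b (t : fiber F b) m, pr t (iota t m) = m.
Hypothesis pr0 : forall b (t s : fiber F b) m, t <> s -> pr s (iota t m) = 0.
Hypothesis prE : forall b (v : R b), v = \sum_(t <- L b) iota t (pr t v).

Lemma iota_ext b (V : lmodType k) (f g : {linear R b -> V}) :
  (forall t m, f (iota t m) = g (iota t m)) -> f =1 g.
Proof.
by move=> fg v; rewrite (prE v) !linear_sum; apply: eq_bigr => t _; apply: fg.
Qed.

(** Checked on the summand at a point [c] over [b2], where [a0] has a unique lift ending in [c]. If
    [c = b2'] this lift is [a]. Otherwise it cannot start in [b1'], by uniqueness of lifts with
    given source, and both sides vanish. *)
Lemma pr_act (b1' b2' : Q') (a : arrow Q' b1' b2') (b1 b2 : Q)
  (a0 : arrow Q b1 b2) (e1 : F b1' = b1) (e2 : F b2' = b2) :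
  qmt F (mk_tarrow a) = mk_tarrow a0 -> forall r : R b2,
  pr (exist _ b1' e1) (mact R (arr k a0) r) = mact Rt (arr k a) (pr (exist _ b2' e2) r).
Proof.
move=> aa0; pose f := (pr (exist _ b1' e1) \o mact_r R (arr k a0))%FUN.
pose g := (mact_r Rt (arr k a) \o pr (exist _ b2' e2))%FUN.
apply: (@iota_ext _ _ f g) => -[c ec] m.
change (pr (exist _ b1' e1) (mact R (arr k a0) (iota (exist _ c ec) m)) =
  mact Rt (arr k a) (pr (exist _ b2' e2) (iota (exist _ c ec) m))).
clear f g.
have [d [a' aa']] := lift_arrow_in gc a0 ec.
have Fd : F d = b1 by case: (mk_tarrow_ends aa').
rewrite (iota_act Fd ec aa').
have [tc|tc] := pselect (exist _ c ec = exist _ b2' e2 :> fiber F b2).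
  have cb : c = b2' := congr1 sval tc; subst b2'.
  have ma : mk_tarrow a' = mk_tarrow a by apply: (arrow_uniq_in gc); rewrite aa' aa0.
  have [db _] := mk_tarrow_ends ma; subst b1'.
  rewrite (Prop_irrelevance e1 Fd) (Prop_irrelevance e2 ec) !prK.
  by rewrite (mk_tarrow_inj ma).
rewrite (pr0 _ tc) mact0 pr0 // => /(congr1 sval) /= db.
subst b1'; apply: tc; apply: sval_inj => /=.
have ma : mk_tarrow a' = mk_tarrow a by apply: (arrow_uniq_out gc); rewrite aa' aa0.
by have [] := mk_tarrow_ends ma.
Qed.

(** The effect of push-down on the endomorphism [f]. Applied to an idempotent [inc prj] of [Rt], it
    gives the idempotent of [R] whose image is the push-down of a summand. *)
Lemma pushdown_endo (f : kmor Rt Rt) : exists E : kmor R R,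
  (forall b (t : fiber F b) m, E b (iota t m) = iota t (f _ m)) /\
  (forall b (t : fiber F b) r, pr t (E b r) = f _ (pr t r)).
Proof.
pose E b v := \sum_(t <- L b) iota t (f _ (pr t v)).
have El b : linear (E b).
  by move=> a u v; rewrite /E scaler_sumr -big_split; apply: eq_bigr => t _; rewrite !linearP.
pose El' b : {linear R b -> R b} := linfun_of (El b).
have EE b (t : fiber F b) m : El' b (iota t m) = iota t (f _ m).
  change (E b (iota t m) = iota t (f _ m)).
  have s0 (s : fiber F b) : s <> t -> iota s (f _ (pr s (iota t m))) = 0.
    by move=> st; rewrite pr0 ?linear0 // => ts; apply: st.
  have [tL|tL] := boolP ((t : {classic fiber F b}) \in L b).
    rewrite /E (bigD1_seq (t : {classic fiber F b})) //= prK big1 ?addr0 // => s /eqP st.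
    exact: s0.
  (* Here [t] is not listed, so every listed coordinate of [iota t m] is zero. *)
  have m0 : m = 0.
    rewrite -[LHS](prK m) [X in pr t X](prE (iota t m)) linear_sum big1_seq // => s /andP[_ sL].
    rewrite pr0 ?linear0 // => st; move: tL; rewrite -[t]st; by rewrite sL.
  rewrite m0 !linear0 /E big1 // => s _; by rewrite !linear0.
have Ea b1 b2 (a0 : arrow Q b1 b2) r :
    El' b1 (mact R (arr k a0) r) = mact R (arr k a0) (El' b2 r).
  apply: (@iota_ext _ _ (El' b1 \o mact_r R (arr k a0))%FUN (mact_r R (arr k a0) \o El' b2)%FUN).
  move=> [c ec] m; have [d [a aa]] := lift_arrow_in gc a0 ec; have Fd : F d = b1 by case: (mk_tarrow_ends aa).
  change (El' b1 (mact R (arr k a0) (iota (exist _ c ec) m)) =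
    mact R (arr k a0) (El' b2 (iota (exist _ c ec) m))).
  by rewrite EE !(iota_act Fd ec aa) EE kmor_act.
exists (arrow_kmor Ea); split=> [//|b t r].
apply: (@iota_ext _ _ (pr t \o El' b)%FUN (f _ \o pr t)%FUN) => s m.
change (pr t (El' b (iota s m)) = f _ (pr t (iota s m))); rewrite EE.
have [st|st] := pselect (s = t); last by rewrite !pr0 ?linear0.
by case: _ / st in m *; rewrite !prK.
Qed.

(** Its value at [y] is [M (act g y)]: this is [M] translated by the inverse of [g]. *)
Definition shift (M : kmod (pathcat k Q')) (g : G) : kmod (pathcat k Q') :=
  pull (kquiver k (act g)) M.

(** With [y] fixed, this indexes the fibre over [F y] by the group, as the action is free and
    transitive on it. *)
Definition shifted_fiber (y : Q') (g : G) : fiber F (F y) :=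
  exist _ (act g y) (gc_invv gc g y).

Lemma component_act (phi : kmor R R) (h g : G) y1 y2 (a : arrow Q' y1 y2)
    (m : shift Rt g y2) :
  pr (shifted_fiber y1 h) (phi _ (iota (shifted_fiber y1 g) (mact (shift Rt g) (arr k a) m))) =
  mact (shift Rt h) (arr k a) (pr (shifted_fiber y2 h) (phi _ (iota (shifted_fiber y2 g) m))).
Proof.
have e i : qmt F (mk_tarrow (qma (act i) a)) = mk_tarrow (qma F a) := gc_inva gc i (mk_tarrow a).
have sa i (n : shift Rt i y2) :
    mact (shift Rt i) (arr k a) n = mact Rt (arr k (qma (act i) a)) n.
  by rewrite -kquiver_arr.
rewrite !sa -(iota_act (gc_invv gc g y1) (gc_invv gc g y2) (e g)) kmor_act.
exact: (pr_act (gc_invv gc h y1) (gc_invv gc h y2) (e h)).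
Qed.

Definition component_map (phi : kmor R R) (h g : G) (y : Q') :
    {linear Rt (act g y) -> Rt (act h y)} :=
  (pr (shifted_fiber y h) \o (phi (F y) \o iota (shifted_fiber y g)))%FUN.

(** The entry in row [h] and column [g] of [phi], viewed as a matrix of maps between shifts of
    [Rt]. *)
Definition component (phi : kmor R R) (h g : G) : kmor (shift Rt g) (shift Rt h) :=
  @arrow_kmor k Q' (shift Rt g) (shift Rt h) (component_map phi h g)
    (fun y1 y2 a m => component_act phi h a m).

Lemma diagonal_act (phi : kmor R R) y1 y2 (a : arrow Q' y1 y2) (m : Rt y2) :
  pr (exist _ y1 erefl : fiber F (F y1)) (phi _ (iota (exist _ y1 erefl) (mact Rt (arr k a) m))) =
  mact Rt (arr k a) (pr (exist _ y2 erefl : fiber F (F y2)) (phi _ (iota (exist _ y2 erefl) m))).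
Proof.
have e : qmt F (mk_tarrow a) = mk_tarrow (qma F a) by [].
by rewrite -(iota_act erefl erefl e) kmor_act (pr_act erefl erefl e).
Qed.

Definition diagonal_map (phi : kmor R R) (y : Q') : {linear Rt y -> Rt y} :=
  (pr (exist _ y erefl : fiber F (F y)) \o
    (phi (F y) \o iota (exist _ y erefl : fiber F (F y))))%FUN.

Definition diagonal (phi : kmor R R) : kmor Rt Rt :=
  @arrow_kmor k Q' Rt Rt (diagonal_map phi) (diagonal_act phi).

(** All diagonal entries are translates of the one map [diagonal phi], so a single bijectivity
    assumption controls them. *)
Lemma component_diagonal (phi : kmor R R) g (y : Q') (m : Rt (act g y)) :
  component phi g g y m = diagonal phi (act g y) m.
Proof.
change (pr (shifted_fiber y g) (phi (F y) (iota (shifted_fiber y g) m)) =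
  pr (exist _ (act g y) erefl : fiber F (F (act g y)))
    (phi (F (act g y)) (iota (exist _ (act g y) erefl : fiber F (F (act g y))) m))).
rewrite /shifted_fiber; move: (gc_invv gc g y) m; generalize (act g y).
move=> z e; by case: _ / e.
Qed.

(* On the fibre over one vertex, phi is a matrix of maps between shifts of M whose
   diagonal entries are isomorphisms, and only finitely many entries matter. *)
Lemma graded_injective (M : kmod (pathcat k Q')) (inc : kmor M Rt) (prj : kmor Rt M)
    (E phi : kmor R R) :
  (forall b (t : fiber F b) m, E b (iota t m) = iota t (inc _ (prj _ m))) ->
  (forall b (t : fiber F b) r, pr t (E b r) = inc _ (prj _ (pr t r))) ->
  (forall y m, prj y (inc y m) = m) ->
  (forall g, fitting (shift M g)) ->
  (forall g h, g != h -> forall (f : kmor (shift M g) (shift M h))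
     (f' : kmor (shift M h) (shift M g)), ~ kbij (kcmp f' f)) ->
  kbij (kcmp prj (kcmp (diagonal phi) inc)) ->
  forall b (r : R b), E b r = r -> E b (phi b r) = 0 -> r = 0.
Proof.
move=> EI EP pi fM dM dphi b r Er Ephi.
have [y ey] := gc_surjv gc b; case: _ / ey in r Er Ephi *.
have /choice [ga gaP] (t : fiber F (F y)) : exists g, act g y = sval t.
  by apply: (gc_fiberv gc); rewrite (svalP t).
have gaK (t : fiber F (F y)) : shifted_fiber y (ga t) = t by apply: sval_inj; exact: gaP.
pose m (g : G) : shift M g y := prj _ (pr (shifted_fiber y g) r).
pose Phi h g : kmor (shift M g) (shift M h) :=
  kcmp (kpull (kquiver k (act h)) prj) (kcmp (component phi h g) (kpull (kquiver k (act g)) inc)).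
pose S := [seq ga t | t <- L (F y)].
(* As [E] fixes [r], the vector [r] is recovered from its coordinates [m g] in the shifts of [M]. *)
have rS (V : lmodType k) (f : {linear R (F y) -> V}) :
    f r = \sum_(g <- S) f (iota (shifted_fiber y g) (inc _ (m g))).
  rewrite -{1}Er [X in E _ X](prE r) !linear_sum big_map; apply: eq_bigr => t _.
  rewrite EI; have fE (s : fiber F (F y)) : s = t ->
      f (iota t (inc _ (prj _ (pr t r)))) = f (iota s (inc _ (prj _ (pr s r)))) by move=> ->.
  exact: fE (gaK t).
have uS : uniq S.
  rewrite /S (@map_inj_uniq {classic fiber F (F y)} G ga) ?L_uniq // => t s /(congr1 (shifted_fiber y)).
  by rewrite (gaK t) (gaK s).
suff m0 g : g \in S -> m g = 0.
  rewrite [LHS](rS _ idfun) big1_seq // => g /andP[_ /m0 ->].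
  by rewrite !linear0.
apply: (@azumaya k _ G (shift M) fM dM S uS Phi _ y m) => [h _|h _].
  apply: kbij_ext (kpull_bij (kquiver k (act h)) dphi) => z n.
  rewrite /= -[RHS]/(prj _ (component phi h h z (inc _ n))); congr (prj _ _).
  by rewrite component_diagonal.
(* The vanishing of [E (phi r)] gives one linear equation between the [m g] for each row [h]. *)
have p0 : prj _ (pr (shifted_fiber y h) (phi _ r)) = 0.
  have := EP _ (shifted_fiber y h) (phi _ r); rewrite Ephi linear0 => /(congr1 (prj _)).
  by rewrite pi linear0.
rewrite -[RHS]p0; exact: esym (rS _ (prj _ \o (pr (shifted_fiber y h) \o phi _))%FUN).
Qed.

End Graded.
End Gradable.

Lemma shift_indecomposable (k : fieldType) (Q' Q : quiver) (I' : hom_sets k Q')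
    (I : hom_sets k Q) (F : qmor Q' Q) (G : groupType) (act : G -> qmor Q' Q')
    (M : kmod (pathcat k Q')) (g : G) :
  galois_covering I' I F act ->
  (indecomposable M -> indecomposable (shift act M g)) /\
  (fin_length M -> fin_length (shift act M g)).
Proof.
move=> gc; have gi : injective (fob (kquiver k (act g))).
  by move=> x y /(congr1 (act g^-1%g)); rewrite !(gc_actVKv gc).
split; last exact: pull_fin_length.
apply: pull_indecomposable => // [y|x y f].
  by exists (act g^-1%g y); exact: (gc_actKVv gc).
pose f1 := eq_rect _ (fun z => kpath k z y) (eq_rect _ (fun z => kpath k _ z)
  (kqmap k (act g^-1%g) _ _ f) _ (gc_actVKv gc g y)) _ (gc_actVKv gc g x).
exists f1; apply: tk_inj.
have e : tk f1 = tk (kqmap k (act g^-1%g) _ _ f) by rewrite /f1 tk_castl tk_castr.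
by rewrite (tk_kqmap (act g) e) -kqmap_qmcomp (tk_kqmap_eq f (gc_actKV gc g)) kqmap_qmid.
Qed.

Lemma notin_indecomposable (k : fieldType) (C : kcat k) (M : kmod C) :
  (exists x (m : M x), m <> 0) -> ~ indecomposable M ->
  exists N1 N2 : subsets M, [/\ submodule N1, submodule N2,
    internal_dsum (@full_sub k C M) N1 N2, (exists x (m : M x), N1 x m /\ m <> 0) &
    exists x (m : M x), N2 x m /\ m <> 0].
Proof.
move=> Mn0 nM; apply: contrapT => nN; apply: nM; split=> // N1 N2 s1 s2 d.
have nz (N : subsets M) : submodule N ->
    N <> @zero_sub k C M -> exists x (m : M x), N x m /\ m <> 0.
  move=> [N0 _ _] nN0; apply: contrapT => nx; apply: nN0.
  apply: functional_extensionality_dep => x; apply/predeqP => m; split=> [Nm|->]; last exact: N0.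
  by apply: contrapT => mn0; apply: nx; exists x, m.
apply: contrapT => /not_orP[n1 n2]; apply: nN; exists N1, N2; split=> //; exact: nz.
Qed.

Section GradableSummand.
Variables (k : fieldType) (Q' Q : quiver) (I' : hom_sets k Q') (I : hom_sets k Q).
Variables (F : qmor Q' Q) (G : groupType) (act : G -> qmor Q' Q').
Hypothesis gc : galois_covering I' I F act.
Variables (Rt : kmod (pathcat k Q')) (R : kmod (pathcat k Q)).
Variable iota : forall (b : Q) (t : fiber F b), {linear Rt (sval t) -> R b}.
Hypothesis Rt_fin : fin_length Rt.
Hypothesis iota_sum : forall b, is_direct_sum (@iota b).
Hypothesis iota_act : forall (b1' b2' : Q') (a : arrow Q' b1' b2') (b1 b2 : Q)
  (a0 : arrow Q b1 b2) (e1 : F b1' = b1) (e2 : F b2' = b2),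
  qmt F (mk_tarrow a) = mk_tarrow a0 -> forall m : Rt b2',
  mact R (arr k a0) (iota (exist _ b2' e2) m) = iota (exist _ b1' e1) (mact Rt (arr k a) m).
Variables (X : kmod (pathcat k Q)) (j : kmor X R) (p : kmor R X).
Hypothesis X_fitting : fitting X.
Hypothesis X_nonzero : exists x (m : X x), m <> 0.

Let is_ext (M : kmod (pathcat k Q')) (inc : kmor M Rt) (prj : kmor Rt M) (E : kmor R R) :=
  forall b (t : fiber F b) m, E b (iota t m) = iota t (inc _ (prj _ m)).

(** The second clause says that [X] is, up to an automorphism, a direct summand of the push-down of
    [M], the latter being the image of [E]. *)
Let good (M : kmod (pathcat k Q')) (inc : kmor M Rt) (prj : kmor Rt M) :=
  (forall y m, prj y (inc y m) = m) /\
  exists E, is_ext inc prj E /\ kbij (kcmp p (kcmp E j)).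

(** A bound for the total dimension, which drops whenever a nonzero summand is split off. *)
Let length_le (M : kmod (pathcat k Q')) (n : nat) :=
  exists (s : seq {classic Q'}) (d : {classic Q'} -> nat),
  [/\ uniq s, forall y : Q', spanned (M y) (d y),
      forall y : Q', supp M y -> (y : {classic Q'}) \in s &
      (\sum_(y <- s) d y <= n)%N].

Lemma length_leP (M : kmod (pathcat k Q')) n : length_le M n -> fin_length M.
Proof.
move=> [s [d [_ sd sM _]]]; split=> [|y]; last by exists (d y); exact: sd.
apply: (sub_finite_set (B := [set` s])); first by move=> y /sM.
exact: (finite_seq s).
Qed.

Lemma length_le_ex : exists n, length_le Rt n.
Proof.
have [/finite_enum [s [us sP]] dR] := Rt_fin.
have [d dP] := choice dR.
exists (\sum_(y <- s) d y)%N, s, d; split=> //.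
by move=> y /sP.
Qed.

Lemma length_le_summand (M M1 : kmod (pathcat k Q')) (i : kmor M1 M) (q : kmor M M1) n :
  (forall y m, q y (i y m) = m) -> (exists y (z : M y), q y z = 0 /\ z <> 0) ->
  length_le M n -> exists2 n1, (n1 < n)%N & length_le M1 n1.
Proof.
move=> qi [y0 [z [qz zn0]]] [s [d [us sd sM sn]]].
have qs y (v : M1 y) : exists u, q y u = v by exists (i y v).
have [d0 sd0] := spanned_proper_image (@qs y0) zn0 qz (sd y0).
pose d1 (y : {classic Q'}) := if y == y0 then (d y).-1 else d y.
have y0s : (y0 : {classic Q'}) \in s by apply: sM; exists z.
exists (\sum_(y <- s) d1 y)%N.
  apply: leq_trans sn; rewrite !(bigD1_seq (y0 : {classic Q'})) //= /d1 eqxx.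
  rewrite (eq_bigr d) => [|y /negPf ->//].
  by rewrite ltn_add2r prednK.
exists s, d1; split=> // y; rewrite /d1.
  have [->|_] := eqVneq (y : {classic Q'}) y0; first exact: sd0.
  exact: spanned_image (@qs y) (sd y).
by move=> [m mn0]; apply: sM; exists (i y m) => im0; apply: mn0; rewrite -(qi y m) im0 linear0.
Qed.

(** A decomposition of [M] writes [E] as [E1 + E2], hence the automorphism [p E j] of [X] as a sum.
    By [fitting_add] one of the two terms is bijective, and the descent continues with the
    corresponding shorter summand. *)
Lemma indecomposable_good n (M : kmod (pathcat k Q')) (inc : kmor M Rt) (prj : kmor Rt M) :
  length_le M n -> good inc prj ->
  exists (M' : kmod (pathcat k Q')) (inc' : kmor M' Rt) (prj' : kmor Rt M'),
  [/\ good inc' prj', indecomposable M' & fin_length M'].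
Proof.
have [L [pr [uL prK pr0 prE]]] := fiber_proj Rt_fin iota_sum.
elim/ltn_ind: n M inc prj => n IH M inc prj lM [pi [E [EI Ebij]]].
have [iM|niM] := pselect (indecomposable M).
  by exists M, inc, prj; split=> //; [split=> //; exists E|exact: length_leP lM].
have Mn0 : exists y (m : M y), m <> 0.
  apply: contrapT => nM; have M0 y (m : M y) : m = 0.
    by apply: contrapT => mn0; apply: nM; exists y, m.
  have [x [m mn0]] := X_nonzero; apply: mn0.
  apply: (kbij_inj (x := x) Ebij); rewrite linear0 /= [j x m](prE) !linear_sum big1 // => t _.
  by rewrite EI (M0 _ (prj _ _)) !linear0.
have [N1 [N2 [s1 s2 d [y1 [m1 [N1m1 m1n0]]] [y2 [m2 [N2m2 m2n0]]]]]] := notin_indecomposable Mn0 niM.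
have [q1 [q2 [q12 q1K q2K q12_0 q21_0]]] := dsum_split s1 s2 d.
have [m1' m1E] := subkmod_in s1 N1m1; have [m2' m2E] := subkmod_in s2 N2m2.
pose i1 := subkmod_inc s1; pose i2 := subkmod_inc s2.
have [E1 [E1I _]] := pushdown_endo gc iota_act uL prK pr0 prE (kcmp (kcmp inc i1) (kcmp q1 prj)).
have [E2 [E2I _]] := pushdown_endo gc iota_act uL prK pr0 prE (kcmp (kcmp inc i2) (kcmp q2 prj)).
have EE b r : E b r = E1 b r + E2 b r.
  apply: (iota_ext prE (f := E b) (g := (E1 b \+ E2 b)%FUN)) => t m.
  rewrite EI -[RHS]/(E1 b (iota t m) + E2 b (iota t m)) E1I E2I -linearD /=.
  by rewrite -linearD q12.
have l1 : exists2 n1, (n1 < n)%N & length_le (subkmod s1) n1.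
  apply: (length_le_summand (i := i1) (q := q1) _ _ lM); first exact: q1K.
  by exists y2, m2; split=> //; rewrite -m2E q12_0.
have l2 : exists2 n1, (n1 < n)%N & length_le (subkmod s2) n1.
  apply: (length_le_summand (i := i2) (q := q2) _ _ lM); first exact: q2K.
  by exists y1, m1; split=> //; rewrite -m1E q21_0.
have : kbij (kadd (kcmp p (kcmp E1 j)) (kcmp p (kcmp E2 j))).
  by apply: kbij_ext Ebij => x m /=; rewrite EE linearD.
case/(fitting_add X_fitting) => b12.
  have [n1 ltn1 ln1] := l1; apply: (IH n1 ltn1 _ (kcmp inc i1) (kcmp q1 prj) ln1).
  by split=> [y m /=|]; [rewrite pi q1K|exists E1].
have [n1 ltn1 ln1] := l2; apply: (IH n1 ltn1 _ (kcmp inc i2) (kcmp q2 prj) ln1).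
by split=> [y m /=|]; [rewrite pi q2K|exists E2].
Qed.

(** The condition on supports makes distinct shifts of a summand non-isomorphic, so
    [graded_injective] applies. On [M] the diagonals of [e] and [1 - e] add up to the identity,
    hence one is bijective. If it is that of [e], then [e] is injective on the image of [E] and,
    being idempotent, the identity there. If it is that of [1 - e], then [e] vanishes and so does
    [X]. *)
Theorem gradable_summand :
  (forall x m, p x (j x m) = m) ->
  (forall (M : kmod (pathcat k Q')) (inc : kmor M Rt) (prj : kmor Rt M),
    (forall y m, prj y (inc y m) = m) -> indecomposable M ->
    forall g h, g != h -> ~ (forall y, supp M (act g y) <-> supp M (act h y))) ->
  exists (M : kmod (pathcat k Q')) (inc : kmor M Rt),
  [/\ forall y, injective (inc y), indecomposable M, fin_length M &
  exists iotaX : forall (b : Q) (t : fiber F b), {linear M (sval t) -> X b},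
  (forall b, is_direct_sum (@iotaX b)) /\
  forall (b1' b2' : Q') (a : arrow Q' b1' b2') (b1 b2 : Q)
    (a0 : arrow Q b1 b2) (e1 : F b1' = b1) (e2 : F b2' = b2),
    qmt F (mk_tarrow a) = mk_tarrow a0 -> forall m : M b2',
    mact X (arr k a0) (iotaX _ (exist _ b2' e2) m) = iotaX _ (exist _ b1' e1) (mact M (arr k a) m)].
Proof.
move=> pj HZ.
have [L [pr [uL prK pr0 prE]]] := fiber_proj Rt_fin iota_sum.
have [n ln] := length_le_ex.
have : good (kid Rt) (kid Rt).
  split=> //; exists (kid R); split=> //; exists (kid X); split=> x m /=; exact: pj.
case/(indecomposable_good ln) => M [inc [prj [[pi [E0 [E0I Ebij0]]] iM fM]]].
have [E [EI EP]] := pushdown_endo gc iota_act uL prK pr0 prE (kcmp inc prj).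
have EE0 b : E0 b =1 E b by apply: (iota_ext prE) => t m; rewrite EI E0I.
have : kbij (kcmp p (kcmp E j)) by apply: kbij_ext Ebij0 => x m /=; rewrite EE0.
move=> [a' [a'l a'r]].
have a'lE x m : a' x (p x (E x (j x m))) = m := a'l x m.
have a'rE x m : p x (E x (j x (a' x m))) = m := a'r x m.
have EE b r : E b (E b r) = E b r.
  apply: (iota_ext prE (f := (E b \o E b)%FUN) (g := E b)) => t m.
  by rewrite /= !EI /= pi.
have fsh g : fitting (shift act M g).
  have [i1 i2] := shift_indecomposable M g gc.
  by apply: indecomposable_fitting; [exact: i2|exact: i1].
have dsh g h : g != h -> forall (f : kmor (shift act M g) (shift act M h))
     (f' : kmor (shift act M h) (shift act M g)), ~ kbij (kcmp f' f).
  move=> gh f f' ff'; apply: (HZ M inc prj pi iM g h gh) => y.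
  have nz : exists x (m : shift act M g x), m <> 0.
    by case: (proj1 (shift_indecomposable M g gc) iM).
  have [[f1 [f1l f1r]] _] := kbij_cmp_inv nz ff' (fsh h).
  split=> -[m mn0].
    by exists (f y m) => fm0; apply: mn0; rewrite -(f1l y m) fm0 linear0.
  by exists (f1 y m) => fm0; apply: mn0; rewrite -(f1r y m) fm0 linear0.
(* As [a'] inverts [p E j], this is an idempotent below [E] that factors through [X]. *)
pose e := kcmp E (kcmp j (kcmp a' (kcmp p E))).
have eE b r : e b r = E b (j b (a' b (p b (E b r)))) by [].
have eI b r : E b (e b r) = e b r by rewrite !eE EE.
have ee b r : e b (e b r) = e b r by rewrite !eE !EE a'rE.
pose th phi := kcmp prj (kcmp (diagonal gc iota_act prK pr0 prE phi) inc).
have inj phi : kbij (th phi) ->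
    forall b (r : R b), E b r = r -> E b (phi b r) = 0 -> r = 0.
  by move=> thb b r; apply: (graded_injective uL EI EP pi fsh dsh thb).
have eid b r : E b r = r -> e b r = r.
  move=> Er; have : kbij (kadd (th e) (th (ksub (kid R) e))).
    have thE (y : Q') (m : M y) : th e y m + th (ksub (kid R) e) y m = m.
      pose t : fiber F (F y) := exist _ y erefl.
      change (prj y (pr _ t (e _ (iota t (inc y m)))) +
        prj y (pr _ t (iota t (inc y m) - e _ (iota t (inc y m)))) = m).
      by rewrite -linearD -linearD addrC subrK prK pi.
    by exists (kid M); split=> y m; exact: thE.
  case/(fitting_add (indecomposable_fitting fM iM)) => /inj h.
    apply/eqP; rewrite -subr_eq0; apply/eqP/h; first by rewrite linearB eI Er.
    by rewrite linearB ee subrr linear0.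
  exfalso; have e0 c s : e c s = 0.
    apply: h; first exact: eI.
    by change (E c (e c s - e c (e c s)) = 0); rewrite ee subrr linear0.
  have [x [m]] := X_nonzero; apply.
  by rewrite -(a'lE x m) -[p _ _]a'rE -(EE x (j x m)) -eE e0 !linear0.
(* These maps span because [p E j a'] is the identity of [X], and are independent because [e], which
   factors through [p E], is the identity on the image of [E]. *)
pose iX b (t : fiber F b) : {linear M (sval t) -> X b} := (p b \o (iota t \o inc (sval t)))%FUN.
have iXE b t m : iX b t m = p b (iota t (inc _ m)) by [].
exists M, inc; split=> //.
  by move=> y; apply: can_inj (pi y).
exists iX; split=> [b|b1' b2' a b1 b2 a0 e1 e2 aa0 m].
  split=> [v|i t y ti].
    exists (size (L b)), (fun i => tnth (in_tuple (L b)) i).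
    exists (fun i => prj _ (pr b (tnth (in_tuple (L b)) i) (j b (a' b v)))).
    rewrite -[LHS]a'rE [X in E b X]prE !linear_sum big_tnth; apply: eq_bigr => i _.
    by rewrite EI.
  pose r := \sum_i iota (t i) (inc _ (y i)).
  move=> y0; have pr0r : p b r = 0 by rewrite /r linear_sum.
  have Er : E b r = r.
    by rewrite /r linear_sum; apply: eq_bigr => l _; rewrite EI /= pi.
  have r0 : r = 0 by rewrite -(eid b r Er) eE Er pr0r !linear0.
  move=> l; apply: (can_inj (pi _)); rewrite linear0 -(prK _ (t l) (inc _ (y l))).
  have := congr1 (pr b (t l)) r0; rewrite linear0 linear_sum (bigD1 l) //= big1 ?addr0 //.
  by move=> q ql; apply: (pr0 b _ _ _) => /ti /eqP; rewrite (negPf ql).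
by rewrite !iXE -kmor_act (iota_act e1 e2 aa0) kmor_act.
Qed.

End GradableSummand.

(** * Walks and homotopy *)

Lemma cons_pair_inj (A B : Type) (b b' : B) (a a' : A) (s s' : seq (B * A)) :
  (b, a) :: s = (b', a') :: s' -> [/\ b = b', a = a' & s = s'].
Proof. by case. Qed.

Section Walks.

(* Walks with different end points are compared through their signed arrows. *)
Fixpoint enc (Q : quiver) (x y : Q) (w : walk x y) : seq (bool * tarrow Q) :=
  match w with
  | wnil _ => [::]
  | wfwd _ _ _ a w' => (true, mk_tarrow a) :: enc w'
  | wbwd _ _ _ a w' => (false, mk_tarrow a) :: enc w'
  end.

Lemma enc_total_inj (Q : quiver) (x y x' y' : Q) (w : walk x y) (v : walk x' y') :
  enc w = enc v -> x = x' ->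
  existT (fun x => {y : Q & walk x y}) x (existT _ y w) =
  existT (fun x => {y : Q & walk x y}) x' (existT _ y' v).
Proof.
elim: w x' y' v => [z|{}x z {}y a w IH|{}x z {}y a w IH] x' y' [] //=.
- by move=> t _ ->.
- move=> {}x' t {}y' b v e0; have [_ e ew] := cons_pair_inj e0; have [_ zt] := mk_tarrow_ends e.
  move=> _; have := IH _ _ _ ew zt; have [xx _] := mk_tarrow_ends e; subst t; subst x'.
  move=> E0; have E := existT_inj E0; have yy := congr1 (fun s : {y : Q & walk z y} => projT1 s) E.
  by rewrite /= in yy; subst y'; rewrite (existT_inj E) (mk_tarrow_inj e).
- move=> {}x' t {}y' b v e0; have [_ e ew] := cons_pair_inj e0; have [zt _] := mk_tarrow_ends e.
  move=> _; have := IH _ _ _ ew zt; have [_ xx] := mk_tarrow_ends e; subst t; subst x'.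
  move=> E0; have E := existT_inj E0; have yy := congr1 (fun s : {y : Q & walk z y} => projT1 s) E.
  by rewrite /= in yy; subst y'; rewrite (existT_inj E) (mk_tarrow_inj e).
Qed.

Lemma enc_inj (Q : quiver) (x y : Q) (w v : walk x y) : enc w = enc v -> w = v.
Proof. by move=> e; exact: existT_inj (existT_inj (enc_total_inj e erefl)). Qed.

Lemma enc_cat (Q : quiver) (x y z : Q) (w : walk x y) (v : walk y z) :
  enc (wcat w v) = enc w ++ enc v.
Proof. by elim: w v => //= *; congr cons; auto. Qed.

Lemma walk_of_inj (Q : quiver) (x y : Q) : injective (@walk_of Q x y).
Proof.
have H (z t z' t' : Q) (r : qpath z t) (s : qpath z' t') : z = z' ->
    enc (walk_of r) = enc (walk_of s) ->
    existT (fun x => {y : Q & qpath x y}) z (existT _ t r) =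
    existT (fun x => {y : Q & qpath x y}) z' (existT _ t' s).
  elim: r z' t' s => [z0|z0 z1 z2 a r IH] z' t' [] //=; first by move=> z3 ->.
  move=> z3 z4 z5 b s0 _ e0; have [_ ea es] := cons_pair_inj e0.
  have [ez et] := mk_tarrow_ends ea.
  have := IH _ _ s0 et es; subst z3; subst z4 => E0; have E := existT_inj E0.
  have yy := congr1 (fun s : {y : Q & qpath z1 y} => projT1 s) E.
  by rewrite /= in yy; subst z5; rewrite (existT_inj E) (mk_tarrow_inj ea).
move=> p q e1; exact: existT_inj (existT_inj (H _ _ _ _ p q erefl (congr1 (@enc _ _ _) e1))).
Qed.

Fixpoint wmap (Q' Q : quiver) (F : qmor Q' Q) (x y : Q') (w : walk x y) :
    walk (F x) (F y) :=
  match w with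
  | wnil _ => wnil _
  | wfwd _ _ _ a w' => wfwd (qma F a) (wmap F w')
  | wbwd _ _ _ a w' => wbwd (qma F a) (wmap F w')
  end.

Definition emap (Q' Q : quiver) (F : qmor Q' Q) (c : bool * tarrow Q') : bool * tarrow Q :=
  (c.1, qmt F c.2).

Lemma enc_wmap (Q' Q : quiver) (F : qmor Q' Q) (x y : Q') (w : walk x y) :
  enc (wmap F w) = map (emap F) (enc w).
Proof. by elim: w => //= x' y' z' a w ->. Qed.

Lemma wmap_cat (Q' Q : quiver) (F : qmor Q' Q) (x y z : Q') (w : walk x y) (v : walk y z) :
  wmap F (wcat w v) = wcat (wmap F w) (wmap F v).
Proof. by elim: w v => //= x' y' z' a w IH v; rewrite IH. Qed.

Lemma wmap_walk_of (Q' Q : quiver) (F : qmor Q' Q) (x y : Q') (p : qpath x y) :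
  wmap F (walk_of p) = walk_of (pmap_quiver F p).
Proof. by elim: p => //= x' y' z' a p ->. Qed.

Lemma plength_pmap (Q' Q : quiver) (F : qmor Q' Q) (x y : Q') (p : qpath x y) :
  plength (pmap_quiver F p) = plength p.
Proof. by elim: p => //= x' y' z' a p ->. Qed.

Lemma kqmap_sum (k : fieldType) (Q' Q : quiver) (F : qmor Q' Q) (x y : Q') n
    (P : pred 'I_n) (c : 'I_n -> k) (p : 'I_n -> qpath x y) :
  kqmap k F x y (\sum_(i | P i) c i *: << p i >>) =
  \sum_(i | P i) c i *: << pmap_quiver F (p i) >>.
Proof.
by rewrite linear_sum; apply: eq_bigr => i _; rewrite linearZ_LR kqmapU.
Qed.

(** Minimality needs the ideal to be reflected and not only preserved: a proper partial sum in [I]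
    must already lie in [I']. *)
Lemma minimal_relation_map (k : fieldType) (Q' Q : quiver) (I' : hom_sets k Q')
    (I : hom_sets k Q) (F : qmor Q' Q) (x y : Q') n (c : 'I_n -> k) (p : 'I_n -> qpath x y) :
  (forall u : kpath k x y, I' x y u <-> I (F x) (F y) (kqmap k F x y u)) ->
  minimal_relation I' c p -> minimal_relation I c (fun i => pmap_quiver F (p i)).
Proof.
move=> II [n2 p2 Ip minp]; split=> // [i||J J0 JT].
- by rewrite plength_pmap.
- by rewrite -kqmap_sum; apply/II.
- by rewrite -kqmap_sum => /II; apply: minp.
Qed.

Lemma homotopic_map (k : fieldType) (Q' Q : quiver) (I' : hom_sets k Q')
    (I : hom_sets k Q) (F : qmor Q' Q) :
  (forall x y (u : kpath k x y), I' x y u <-> I (F x) (F y) (kqmap k F x y u)) ->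
  forall (x y : Q') (w v : walk x y), homotopic I' w v -> homotopic I (wmap F w) (wmap F v).
Proof.
move=> II x y w v; elim=> {x y w v}.
- by move=> *; exact: ht_refl.
- by move=> *; exact: ht_sym.
- by move=> x y w v u _ h1 _ h2; exact: ht_trans h1 h2.
- by move=> x y a; exact: ht_fwd_bwd.
- by move=> x y a; exact: ht_bwd_fwd.
- move=> x y n c p i j /(minimal_relation_map (II x y)) /(ht_minrel i j).
  by rewrite !wmap_walk_of.
- by move=> x y z t w1 u v w2 _ h; rewrite !wmap_cat; exact: ht_congr.
Qed.

End Walks.

Section SubQuivers.
Variables (k : fieldType) (Q : quiver).
Implicit Types (I : hom_sets k Q) (T : set Q).

(** For [I = kernel nu] this is, by conversion, the kernel of the restricted presentation. *)
Definition sub_ideal I T : hom_sets k (subquiver T) :=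
  fun x y => [set u | I (sval x) (sval y) (kqmap k (subquiver_incl T) x y u)].

Definition subquiver_mono T T' (TT' : T `<=` T') : qmor (subquiver T) (subquiver T') :=
  @QMor (subquiver T) (subquiver T') (fun x => exist _ (sval x) (TT' _ (svalP x)))
    (fun _ _ a => a).

Lemma sub_ideal_mono I T T' (TT' : T `<=` T') (x y : subquiver T) (u : kpath k x y) :
  sub_ideal I u <-> sub_ideal I (kqmap k (subquiver_mono TT') x y u).
Proof.
by rewrite /sub_ideal /= -(kqmap_qmcomp (subquiver_incl T') (subquiver_mono TT')).
Qed.

Lemma subquiver_path T (x y : Q) (p : qpath x y) (Tx : T x) (Ty : T y) :
  convex T -> exists p' : qpath (exist _ x Tx : subquiver T) (exist _ y Ty : subquiver T),
    pmap_quiver (subquiver_incl T) p' = p.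
Proof.
move=> cT; elim: p Tx Ty => [z|{}x z {}y a p IH] Tx Ty.
  by rewrite (Prop_irrelevance Ty Tx); exists (pnil _).
have Tz : T z := cT _ _ _ (pcons a (pnil z)) p Tx Ty.
have [p' <-] := IH Tz Ty.
by exists (@pcons (subquiver T) (exist _ x Tx) (exist _ z Tz) _ a p').
Qed.

(** Convexity enters here: a path between vertices of [T] stays in [T], so the path category of the
    subquiver is full. *)
Lemma subquiver_full T (x y : subquiver T) (u : kpath k (sval x) (sval y)) :
  convex T -> exists u' : kpath k x y, kqmap k (subquiver_incl T) x y u' = u.
Proof.
move=> cT; have ex (p : qpath (sval x) (sval y)) : exists p' : qpath x y,
    pmap_quiver (subquiver_incl T) p' = p.
  by case: x y {u} p => [x Tx] [y Ty] /= p; exact: subquiver_path.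
have [g gP] := choice ex.
pose h : {linear kpath k (sval x) (sval y) -> kpath k x y} :=
  mlin (fun p : qpath (sval x) (sval y) => << g p >> : kpath k x y).
exists (h u); pose f := (kqmap k (subquiver_incl T) x y \o h)%FUN.
apply: (malg_linear_ext (f := f) (g := idfun)) => p.
change (kqmap k (subquiver_incl T) x y (h << p >>) = << p >>).
have -> : h << p >> = << g p >> := mlinU _ p.
by rewrite kqmapU gP.
Qed.

Lemma pmap_incl_inj T (x y : subquiver T) : injective (@pmap_quiver _ _ (subquiver_incl T) x y).
Proof.
move=> p q e.
have we (z t : subquiver T) (r : walk z t) : enc (wmap (subquiver_incl T) r) =
    map (emap (subquiver_incl T)) (enc r) by rewrite enc_wmap.
have einj : injective (emap (subquiver_incl T)).
  move=> [b1 [[x1 T1] [[y1 S1] a1]]] [b2 [[x2 T2] [[y2 S2] a2]]] e0.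
  have bb : b1 = b2 := congr1 fst e0.
  have e1 : qmt (subquiver_incl T) (mk_tarrow a1) = qmt (subquiver_incl T) (mk_tarrow a2) := congr1 snd e0.
  rewrite bb; clear bb e0; have [/= xx yy] := mk_tarrow_ends e1; subst x2; subst y2.
  have aa := mk_tarrow_inj e1; rewrite /= in aa.
  by subst a2; rewrite (Prop_irrelevance T1 T2) (Prop_irrelevance S1 S2).
have : walk_of p = walk_of q.
  apply: enc_inj; apply: (inj_map einj); rewrite -!we !wmap_walk_of.
  by rewrite (e : pmap_quiver (subquiver_incl T) p = pmap_quiver (subquiver_incl T) q).
exact: walk_of_inj.
Qed.

Lemma coef_kqmap (Q' : quiver) (F : qmor Q' Q) (x y : Q') (u : kpath k x y) (p : qpath x y) :
  injective (@pmap_quiver _ _ F x y) -> (kqmap k F x y u)@_(pmap_quiver F p) = u@_p.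
Proof.
move=> Fi; rewrite /kqmap /= /mlin raddf_sum /=.
under eq_bigr => q _ do rewrite mcoeffZ mcoeffU (inj_eq Fi).
have [pu|/mcoeff_outdom pu] := boolP (p \in msupp u).
  rewrite (bigD1_seq p) ?fset_uniq //= eqxx mulr1 big1 ?addr0 // => q /negPf ->.
  by rewrite mulr0.
rewrite pu big1_seq // => q /andP[_ qu]; have [qp|_] := eqVneq q p; last by rewrite mulr0.
by rewrite qp pu mul0r.
Qed.

Lemma sub_ideal_bound I T : bound_quiver I -> bound_quiver (sub_ideal I (T := T)).
Proof.
move=> [lfQ [[I0 IP Il Ir] len ao ai]]; split.
  move=> x; have [f1 f2] := lfQ (sval x); split.
  - pose h (s : {y : subquiver T & arrow (subquiver T) x y}) : {y : Q & arrow Q (sval x) y} :=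
      existT _ (sval (projT1 s)) (projT2 s).
    have -> : [set: {y : subquiver T & arrow (subquiver T) x y}] = h @^-1` setT by [].
    apply: finite_preimage f1 => -[[y1 S1] a1] [[y2 S2] a2] _ _ /= e.
    have yy := congr1 (fun s : {y : Q & arrow Q (sval x) y} => projT1 s) e.
    rewrite /= in yy; subst y2; have := existT_inj e; rewrite /= => ->.
    by rewrite (Prop_irrelevance S1 S2).
  - pose h (s : {y : subquiver T & arrow (subquiver T) y x}) : {y : Q & arrow Q y (sval x)} :=
      existT _ (sval (projT1 s)) (projT2 s).
    have -> : [set: {y : subquiver T & arrow (subquiver T) y x}] = h @^-1` setT by [].
    apply: finite_preimage f2 => -[[y1 S1] a1] [[y2 S2] a2] _ _ /= e.
    have yy := congr1 (fun s : {y : Q & arrow Q y (sval x)} => projT1 s) e.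
    rewrite /= in yy; subst y2; have := existT_inj e; rewrite /= => ->.
    by rewrite (Prop_irrelevance S1 S2).
split.
- split=> [x y|x y c u v|x y z u v|x y z u v]; rewrite /sub_ideal /=.
  + by rewrite linear0.
  + by rewrite linearP; exact: IP.
  + move=> Iv; have := kqmap_comp (subquiver_incl T) u v; rewrite /= => ->; exact: Il.
  + move=> Iu; have := kqmap_comp (subquiver_incl T) u v; rewrite /= => ->; exact: Ir.
- move=> x y u Iu p pu; rewrite -(plength_pmap (subquiver_incl T)).
  have Iu' : I (sval x) (sval y) (kqmap k (subquiver_incl T) x y u) := Iu.
  apply: (len _ _ _ Iu'); rewrite -mcoeff_neq0.
  rewrite [X in X != 0](coef_kqmap u p (@pmap_incl_inj T x y)) mcoeff_neq0.
  exact: pu.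
- move=> x; have [n nP] := ao (sval x); exists n => y p np.
  change (I (sval x) (sval y) (kqmap k (subquiver_incl T) x y << p >>)).
  rewrite kqmapU; apply: nP; exact: (leq_trans np (eq_leq (esym (plength_pmap (subquiver_incl T) p)))).
- move=> x; have [n nP] := ai (sval x); exists n => y p np.
  change (I (sval y) (sval x) (kqmap k (subquiver_incl T) y x << p >>)).
  rewrite kqmapU; apply: nP; exact: (leq_trans np (eq_leq (esym (plength_pmap (subquiver_incl T) p)))).
Qed.

End SubQuivers.

Lemma inj_surj_bijective (A B : Type) (f : A -> B) :
  injective f -> (forall y, exists x, f x = y) -> bijective f.
Proof.
move=> fi fs; have [g gP] := choice fs.
by exists g => // x; apply: fi.
Qed.

Section ConvexSubcategories.
Variables (k : fieldType) (R : kcat k) (Q : quiver) (nu : kfunctor (pathcat k Q) R).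
Hypothesis nu_pres : presentation nu.

Lemma nu_inj : injective (fob nu).
Proof. by case: nu_pres => _ [g nug _] _; exact: can_inj nug. Qed.

Lemma nu_surj y : exists x, nu x = y.
Proof. by case: nu_pres => _ [g _ gnu] _; exists (g y). Qed.

Variable S : set Q.
Hypothesis S_convex : convex S.
Hypothesis S_finite : finite_set S.

Let T0 : set R := [set nu v | v in S].
Let rnu := restricted_presentation nu S.

(** Simple connectedness quantifies over subsets of objects, so the category on [T0] is met as its
    own full subcategory on all objects; its presentation has to land there. *)
Definition full_presentation :
    kfunctor (pathcat k (subquiver S)) (fullsub (C := fullsub T0) setT) :=
  @KFunctor k (pathcat k (subquiver S)) (fullsub (C := fullsub T0) setT)
    (fun x => exist _ (rnu x) Logic.I) (fun x y => fhom rnu)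
    (fun x => fhom_id rnu x) (fun x y z f g => fhom_comp rnu f g).

Lemma full_presentationP : presentation full_presentation.
Proof.
split.
- by apply: (@sub_ideal_bound k Q (kernel nu) S); case: nu_pres.
- apply: inj_surj_bijective => [x y|[[y [x Sx xy]] tt]].
    by move=> /(congr1 (fun z => sval (sval z))) /nu_inj /sval_inj.
  exists (exist _ x Sx); apply: sval_inj; apply: sval_inj; exact: xy.
- move=> x y f; have [u uf] := pres_full nu_pres (f : hom R (nu (sval x)) (nu (sval y))).
  have [u' u'u] := subquiver_full (x := x) (y := y) u S_convex.
  by exists u'; rewrite -uf -u'u.
Qed.

Lemma convex_null_homotopic : simply_connected (fullsub T0) ->
  forall (x : subquiver S) (w : walk x x),
  homotopic (@sub_ideal k Q (kernel nu) S) w (wnil x).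
Proof.
move=> [_ [Q0 [nu0 [_ _ H]]]] x w.
have fc : finite_convex nu0 setT.
  split; last by [].
  have -> : [set: fullsub T0] = (fun z : fullsub T0 => sval z) @^-1` T0.
    by apply/predeqP => z; split=> // _; exact: (svalP z).
  by apply: finite_preimage => [z t _ _ /sval_inj //|]; exact: finite_image.
have := H _ fc _ _ full_presentationP x (pi1_class _ w).
by move=> /pi1_classE.
Qed.

End ConvexSubcategories.

Section Hull.
Variable Q : quiver.
Implicit Types V D : set Q.

(** One interpolation by paths is already convex, as paths can be concatenated; [convex_hullE]
    identifies it with [convex_hull]. *)
Definition hull V : set Q :=
  [set z | exists a b, exists (p : qpath a z) (q : qpath z b), V a /\ V b].

Lemma hull_sub V : V `<=` hull V.
Proof. by move=> x Vx; exists x, x, (pnil x), (pnil x). Qed.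

Lemma hull_convex V : convex (hull V).
Proof.
move=> x z y p q [a [b [r [s [Va Vb]]]]] [c [d [r' [s' [Vc Vd]]]]].
by exists a, d, (pcat r p), (pcat q s').
Qed.

Lemma hull_min V D : V `<=` D -> convex D -> hull V `<=` D.
Proof. by move=> VD cD z [a [b [p [q [/VD Da /VD Db]]]]]; exact: cD p q Da Db. Qed.

Lemma convex_hullE V : convex_hull V = hull V.
Proof.
apply/predeqP => z; split=> [|[a [b [p [q [Va Vb]]]]] T cT VT].
  by apply; [exact: hull_convex|exact: hull_sub].
by apply: cT p q (VT _ Va) (VT _ Vb).
Qed.

Fixpoint pverts (x y : Q) (p : qpath x y) : set Q :=
  match p with
  | pnil x => [set x]
  | pcons x _ _ _ p' => [set x] `|` pverts p'
  end.

Lemma pverts_cat (x y z : Q) (p : qpath x y) (q : qpath y z) : pverts (pcat p q) y.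
Proof.
elim: p q => [t|x' y' z' a p IH] q /=; last by right; exact: IH.
by case: q => [//|? ? ? ? ?]; left.
Qed.

Lemma pverts_finite (x y : Q) (p : qpath x y) : finite_set (pverts p).
Proof.
elim: p => [t|x' y' z' a p IH] /=; first exact: finite_set1.
by rewrite finite_setU; split=> //; exact: finite_set1.
Qed.

(** This is where the finiteness of the number of paths between two vertices, part of strong simple
    connectedness, is used. *)
Lemma hull_finite V : (forall x y : Q, finite_set [set: qpath x y]) ->
  finite_set V -> finite_set (hull V).
Proof.
move=> fQ fV; apply: (@sub_finite_set _ _
  (\bigcup_(a in V) \bigcup_(b in V) \bigcup_(p in [set: qpath a b]) pverts p)).
  move=> z [a [b [p [q [Va Vb]]]]]; exists a => //; exists b => //.
  by exists (pcat p q) => //; exact: pverts_cat.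
apply: bigcup_finite => // a _; apply: bigcup_finite => // b _.
by apply: bigcup_finite => // p _; exact: pverts_finite.
Qed.

End Hull.

Fixpoint wverts (Q : quiver) (x y : Q) (w : walk x y) : set Q :=
  match w with
  | wnil x => [set x]
  | wfwd x _ _ _ w' => [set x] `|` wverts w'
  | wbwd x _ _ _ w' => [set x] `|` wverts w'
  end.

Lemma wverts_finite (Q : quiver) (x y : Q) (w : walk x y) : finite_set (wverts w).
Proof.
by elim: w => [t|x' y' z' a w IH|x' y' z' a w IH] /=; [exact: finite_set1| |];
  rewrite finite_setU; split=> //; exact: finite_set1.
Qed.

Lemma wverts_start (Q : quiver) (x y : Q) (w : walk x y) : wverts w x.
Proof. by case: w => //= *; left. Qed.

Lemma walk_restrict (Q : quiver) (D S : set Q) (SD : S `<=` D) (x y : subquiver D) (w : walk x y) :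
  wverts w `<=` [set z | S (sval z)] ->
  forall x' y' : subquiver S, subquiver_mono SD x' = x -> subquiver_mono SD y' = y ->
  exists w' : walk x' y', enc (wmap (subquiver_mono SD) w') = enc w.
Proof.
elim: w => [z|{}x z {}y a w IH|{}x z {}y a w IH] ww x' y' ex ey.
- have xy : x' = y' by apply: sval_inj; rewrite -[sval x']/(sval (subquiver_mono SD x')) ex -ey.
  by subst y'; exists (wnil x').
- have Sz : S (sval z) by apply: (ww z); right; exact: wverts_start.
  pose z' : subquiver S := exist _ (sval z) Sz.
  have ez : subquiver_mono SD z' = z by apply: sval_inj.
  have [|w' ew'] := IH _ z' y' ez ey; first by move=> t wt; apply: (ww t); right.
  clear IH ww; subst x y; move: ez w' ew'; generalize z' => z1 ez w' ew'; subst z.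
  by exists (@wfwd (subquiver S) x' z1 y' a w'); rewrite /= ew'.
- have Sz : S (sval z) by apply: (ww z); right; exact: wverts_start.
  pose z' : subquiver S := exist _ (sval z) Sz.
  have ez : subquiver_mono SD z' = z by apply: sval_inj.
  have [|w' ew'] := IH _ z' y' ez ey; first by move=> t wt; apply: (ww t); right.
  clear IH ww; subst x y; move: ez w' ew'; generalize z' => z1 ez w' ew'; subst z.
  by exists (@wbwd (subquiver S) x' z1 y' a w'); rewrite /= ew'.
Qed.

Lemma ssc_null_homotopic (k : fieldType) (R : kcat k) (Q : quiver)
    (nu : kfunctor (pathcat k Q) R) (S : set Q) :
  strongly_simply_connected nu -> convex S -> finite_set S ->
  forall (x : subquiver S) (w : walk x x),
  homotopic (@sub_ideal k Q (kernel nu) S) w (wnil x).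
Proof.
move=> [_ [pres tri fp ssc]] cS fS; apply: (convex_null_homotopic pres) => //.
apply: ssc; split; first exact: finite_image.
move=> x z y p q [x' Sx /(nu_inj pres) xx] [y' Sy /(nu_inj pres) yy].
by exists z => //; subst x' y'; exact: cS p q Sx Sy.
Qed.

Lemma null_homotopic_cast (k : fieldType) (Q' Q : quiver) (I : hom_sets k Q)
    (F : qmor Q' Q) (z : Q') (x : Q) (v : walk z z) (w : walk x x) : F z = x ->
  enc (wmap F v) = enc w -> homotopic I (wmap F v) (wnil _) -> homotopic I w (wnil x).
Proof. by move=> ez; subst x => /enc_inj <-. Qed.

Lemma convex_component_null_homotopic (k : fieldType) (R : kcat k) (Q : quiver)
    (nu : kfunctor (pathcat k Q) R) (D : set Q) :
  strongly_simply_connected nu -> convex D ->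
  forall (x : subquiver D) (w : walk x x),
  homotopic (@sub_ideal k Q (kernel nu) D) w (wnil x).
Proof.
move=> ssc cD x w; have [_ [_ _ fp _]] := ssc.
pose V : set Q := [set sval z | z in wverts w].
have fV : finite_set V by apply: finite_image; exact: wverts_finite.
have VD : V `<=` D by move=> _ [z _ <-]; exact: svalP.
pose S := hull V; have SD : S `<=` D by exact: hull_min.
have Sx : S (sval x) by apply: hull_sub; exists x => //; exact: wverts_start.
pose x' : subquiver S := exist _ (sval x) Sx.
have ex : subquiver_mono SD x' = x by apply: sval_inj.
have wS : wverts w `<=` [set z | S (sval z)] by move=> z wz; apply: hull_sub; exists z.
have [w' ew'] := walk_restrict wS ex ex.
have h := ssc_null_homotopic ssc (@hull_convex _ V) (hull_finite fp fV) w'.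
apply: (null_homotopic_cast ex ew').
exact: (homotopic_map (F := subquiver_mono SD) (fun x y u => sub_ideal_mono (kernel nu) SD u) h).
Qed.

(** * Universal Galois coverings *)

Section Subgroup.
Variables (G : groupType) (P : set G).
Hypothesis P1 : P 1%g.
Hypothesis PM : forall g h, P g -> P h -> P (g * h)%g.
Hypothesis PV : forall g, P g -> P g^-1%g.

(** The [let] ties the type to the closure proofs, as for [in_sub], so that it can carry a group
    structure. Subgroups serve as deck groups of intermediate coverings and of components. *)
Definition subgrp : Type := let _ := (P1, PM, PV) in {g : G | `[< P g >]}.
HB.instance Definition _ := Choice.copy subgrp {g : G | `[< P g >]}.

Definition subgrp_in (g : G) (Pg : P g) : subgrp := exist _ g (introT (asboolP _) Pg).

Lemma subgrpP (h : subgrp) : P (sval h).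
Proof. exact: (elimT (asboolP _) (svalP h)). Qed.

Definition subgrp_mul (g h : subgrp) : subgrp := subgrp_in (PM (subgrpP g) (subgrpP h)).
Definition subgrp_inv (g : subgrp) : subgrp := subgrp_in (PV (subgrpP g)).

Lemma subgrp_eq (g h : subgrp) : sval g = sval h -> g = h.
Proof. exact: val_inj. Qed.

Lemma subgrp_mulA : associative subgrp_mul.
Proof. by move=> f g h; apply: subgrp_eq; exact: mulgA. Qed.
Lemma subgrp_mul1 : left_id (subgrp_in P1) subgrp_mul.
Proof. by move=> g; apply: subgrp_eq; exact: mul1g. Qed.
Lemma subgrp_mulr1 : right_id (subgrp_in P1) subgrp_mul.
Proof. by move=> g; apply: subgrp_eq; exact: mulg1. Qed.
Lemma subgrp_mulV : left_inverse (subgrp_in P1) subgrp_inv subgrp_mul.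
Proof. by move=> g; apply: subgrp_eq; exact: mulVg. Qed.
Lemma subgrp_mulrV : right_inverse (subgrp_in P1) subgrp_inv subgrp_mul.
Proof. by move=> g; apply: subgrp_eq; exact: mulgV. Qed.

HB.instance Definition _ := isGroup.Build subgrp
  subgrp_mulA subgrp_mul1 subgrp_mulr1 subgrp_mulV subgrp_mulrV.

Lemma subgroup_ex : exists (H : groupType) (i : H -> G),
  [/\ i 1%g = 1%g, forall g h, i (g * h)%g = (i g * i h)%g, injective i,
      forall h, P (i h) & forall g, P g -> exists h, i h = g].
Proof.
exists subgrp, (fun h => sval h).
split; [by []|by []|exact: subgrp_eq|exact: subgrpP|by move=> g Pg; exists (subgrp_in Pg)].
Qed.

End Subgroup.

Section Lifting.
Variables (k : fieldType) (Q' Q : quiver) (I' : hom_sets k Q') (I : hom_sets k Q).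
Arguments I : clear implicits.
Arguments I' : clear implicits.
Variables (F : qmor Q' Q) (G : groupType) (act : G -> qmor Q' Q').
Hypothesis gc : galois_covering I' I F act.

Lemma lift_walk x y (w : walk x y) x' : F x' = x ->
  exists y' (w' : walk x' y'), F y' = y /\ enc (wmap F w') = enc w.
Proof.
elim: w x' => [z|{}x z {}y a w IH|{}x z {}y a w IH] x' ex.
- by exists x', (wnil x').
- have [z' [a' ea]] := lift_arrow_out gc a ex; have [_ ez] := mk_tarrow_ends ea.
  have [y' [w' [ey ew]]] := IH z' ez; exists y', (wfwd a' w'); split=> //=.
  by rewrite ew -[mk_tarrow (qma F a')]/(qmt F (mk_tarrow a')) ea.
- have [z' [a' ea]] := lift_arrow_in gc a ex; have [ez _] := mk_tarrow_ends ea.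
  have [y' [w' [ey ew]]] := IH z' ez; exists y', (wbwd a' w'); split=> //=.
  by rewrite ew -[mk_tarrow (qma F a')]/(qmt F (mk_tarrow a')) ea.
Qed.

Lemma lift_path x y (p : qpath x y) x' : F x' = x ->
  exists y' (p' : qpath x' y'),
    F y' = y /\ enc (walk_of (pmap_quiver F p')) = enc (walk_of p).
Proof.
elim: p x' => [z|{}x z {}y a p IH] x' ex; first by exists x', (pnil x').
have [z' [a' ea]] := lift_arrow_out gc a ex; have [_ ez] := mk_tarrow_ends ea.
have [y' [p' [ey ep]]] := IH z' ez; exists y', (pcons a' p'); split=> //=.
by rewrite ep -[mk_tarrow (qma F a')]/(qmt F (mk_tarrow a')) ea.
Qed.

Lemma lift_path_in x y (p : qpath x y) y' : F y' = y ->
  exists x' (p' : qpath x' y'),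
    F x' = x /\ enc (walk_of (pmap_quiver F p')) = enc (walk_of p).
Proof.
elim: p y' => [z|{}x z {}y a p IH] y' ey; first by exists y', (pnil y').
have [z' [p' [ez ep]]] := IH y' ey.
have [x' [a' ea]] := lift_arrow_in gc a ez; have [ex _] := mk_tarrow_ends ea.
exists x', (pcons a' p'); split=> //=.
by rewrite ep -[mk_tarrow (qma F a')]/(qmt F (mk_tarrow a')) ea.
Qed.

Lemma lift_uniq x1 x2 y1 y2 (w1 : walk x1 y1) (w2 : walk x2 y2) : x1 = x2 ->
  enc (wmap F w1) = enc (wmap F w2) -> enc w1 = enc w2 /\ y1 = y2.
Proof.
elim: w1 x2 y2 w2 => [z|x z y a w IH|x z y a w IH] x2 y2 [] //=.
- move=> x3 z3 y3 b v xx e0; subst x3; have [_ ea ew] := cons_pair_inj e0.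
  have ab := arrow_uniq_out gc (a := a) (b := b) ea; have [_ zz] := mk_tarrow_ends ab.
  by have [-> ->] := IH _ _ v zz ew; rewrite ab.
- move=> x3 z3 y3 b v xx e0; subst x3; have [_ ea ew] := cons_pair_inj e0.
  have ab := arrow_uniq_in gc (a := a) (b := b) ea; have [zz _] := mk_tarrow_ends ab.
  by have [-> ->] := IH _ _ v zz ew; rewrite ab.
Qed.

(** The converse direction is faithfulness applied to a single point of the fibre. *)
Lemma gc_ideal_iff x y (u : kpath k x y) : I' x y u <-> I (F x) (F y) (kqmap k F x y u).
Proof.
split=> [|Iu]; first exact: (gc_ideal gc).
pose t (i : 'I_1) : fiber F (F y) := exist _ y erefl.
have ti : injective t by move=> i j _; rewrite !ord1.
apply: (gc_faithful gc (t := t) ti (u := fun _ => u) _ ord0).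
have e : @kqmap_to k Q' Q F x (F y) (t ord0) u = kqmap k F x y u.
  by apply: tk_inj; rewrite tk_kqmap_to.
rewrite big_ord1 e.
exact: Iu.
Qed.

Lemma kqmap_to_sum x' y (t : fiber F y) n (c : 'I_n -> k) (u : 'I_n -> kpath k x' (sval t)) :
  kqmap_to (\sum_i c i *: u i) = \sum_i c i *: kqmap_to (u i).
Proof.
rewrite /kqmap_to; move: (svalP t) u; generalize (sval t) => z e u; case: _ / e.
rewrite linear_sum.
by apply: eq_bigr => i _; rewrite linearZ_LR.
Qed.

(* Grouping the terms by the end points of their lifts and using faithfulness,
   each group is itself a relation, so minimality leaves only one group. *)
Lemma minimal_relation_lift x' y n (c : 'I_n -> k) (p : 'I_n -> qpath (F x') y)
    (e : 'I_n -> Q') (p' : forall i, qpath x' (e i)) :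
  minimal_relation I c p -> (forall i, F (e i) = y) ->
  (forall i, enc (walk_of (pmap_quiver F (p' i))) = enc (walk_of (p i))) ->
  forall i j, e i = e j.
Proof.
move=> [_ _ Ip minp] Fe pp i j.
pose E : seq {classic Q'} := undup (codom (e : 'I_n -> {classic Q'})).
have eE l : (e l : {classic Q'}) \in E by rewrite mem_undup codom_f.
have FE (a : 'I_(size E)) : F (tnth (in_tuple E) a) = y.
  have : tnth (in_tuple E) a \in E by exact: mem_tnth.
  by rewrite mem_undup => /codomP [l ->].
pose t (a : 'I_(size E)) : fiber F y := exist _ (tnth (in_tuple E) a : Q') (FE a).
have ti : injective t.
  move=> a b /(congr1 sval) /= ab; have /tuple_uniqP : uniq (in_tuple E) by exact: undup_uniq.
  exact.
(* The lift of [p l] if it ends at the [a]-th end point, and zero otherwise; [pselect] supplies the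
   equation for the cast. *)
pose v (a : 'I_(size E)) l : kpath k x' (sval (t a)) :=
  if pselect (e l = sval (t a)) is left el
  then eq_rect (e l) (fun z => kpath k x' z) << p' l >> _ el else 0.
have vE a l : kqmap_to (v a l) =
    if (e l : {classic Q'}) == tnth (in_tuple E) a then << p l >> else 0.
  rewrite /v; case: pselect => [el|nel].
    have -> : ((e l : {classic Q'}) == tnth (in_tuple E) a) = true by apply/eqP.
    apply: tk_inj; rewrite tk_kqmap_to (tk_kqmap F (tk_castr el _)).
    rewrite kqmapU; have := Fe l; move: (pp l); move: (p l).
    move: (pmap_quiver F (p' l)); generalize (F (e l)) => z r r1 rr ez; subst z.
    by move: rr => /enc_inj /walk_of_inj ->.
  have -> : ((e l : {classic Q'}) == tnth (in_tuple E) a) = false by apply/eqP.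
  rewrite /kqmap_to linear0.
  by move: (svalP (t a)); generalize (sval (t a)) => z e0; case: _ / e0.
pose u a := \sum_l c l *: v a l.
have uE a : kqmap_to (u a) =
    \sum_(l | (e l : {classic Q'}) == tnth (in_tuple E) a) c l *: << p l >>.
  rewrite /u kqmap_to_sum [RHS]big_mkcond; apply: eq_bigr => l _.
  by rewrite vE; case: ifP => // _; rewrite scaler0.
have Iu a : I' x' (sval (t a)) (u a).
  apply: (gc_faithful gc (t := t) ti (u := u)).
  rewrite (eq_bigr _ (fun a _ => uE a)) /= (exchange_big_dep xpredT) //=.
  have -> : \sum_l \sum_(a < size E | (e l : {classic Q'}) == tnth (in_tuple E) a) c l *: << p l >> =
      \sum_l c l *: << p l >> :> kpath k (F x') y; last exact: Ip.
  apply: eq_bigr => l _; have [a1 ea] : exists a, (e l : {classic Q'}) = tnth (in_tuple E) a.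
    exact/tnthP.
  rewrite (bigD1 a1) /=; last exact/eqP.
  rewrite big1 ?addr0 // => b /andP[/eqP eb /eqP ba]; case: ba.
  apply: ti; apply: sval_inj => /=; by rewrite -eb -ea.
have [a ea] : exists a, (e i : {classic Q'}) = tnth (in_tuple E) a by exact/tnthP.
have IJ : I (F x') y (\sum_(l in [set l | (e l : {classic Q'}) == e i]%SET) c l *: << p l >>).
  have -> : \sum_(l in [set l | (e l : {classic Q'}) == e i]%SET) c l *: << p l >> =
      kqmap_to (u a) :> kpath k (F x') y.
    by rewrite uE; apply: eq_bigl => l; rewrite inE ea.
  have := gc_ideal gc (Iu a); rewrite /kqmap_to; move: (svalP (t a)) (u a).
  by generalize (sval (t a)) => z e0; case: _ / e0.
apply: contrapT => eij; apply: (minp [set l | (e l : {classic Q'}) == e i]%SET) IJ.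
  by apply/set0Pn; exists i; rewrite inE.
apply/eqP => /setP /(_ j); rewrite !inE => /eqP ji; exact: eij.
Qed.

(** Monodromy depends only on the homotopy class. Unique lifting handles the formal rules; for a
    minimal relation, [minimal_relation_lift] says that all its paths lift to paths with one common
    end. *)
Lemma lift_homotopic x y (w v : walk x y) : homotopic I w v ->
  forall x' y1 y2 (w' : walk x' y1) (v' : walk x' y2), F x' = x ->
  enc (wmap F w') = enc w -> enc (wmap F v') = enc v -> y1 = y2.
Proof.
elim=> {x y w v}.
- move=> x y w x' y1 y2 w' v' _ ew ev.
  by have [] := lift_uniq (w1 := w') (w2 := v') erefl (etrans ew (esym ev)).
- by move=> x y w v _ IH x' y1 y2 w' v' ex ew ev; rewrite (IH _ _ _ v' w').
- move=> x y w v u _ IH1 _ IH2 x' y1 y2 w' u' ex ew eu.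
  have [y3 [v' [_ ev]]] := lift_walk v ex.
  by rewrite (IH1 _ _ _ w' v') // (IH2 _ _ _ v' u').
- move=> x y a x' y1 y2 w' v' ex ew ev.
  have [z [a' ea]] := lift_arrow_out gc a ex.
  have e1 : enc (wmap F (wfwd a' (wbwd a' (wnil x')))) = enc (wmap F w').
    by rewrite ew /= -[mk_tarrow (qma F a')]/(qmt F (mk_tarrow a')) ea.
  have [_ <-] := lift_uniq erefl e1.
  by have [_ ->] := lift_uniq (w1 := v') (w2 := wnil x') erefl ev.
- move=> x y a x' y1 y2 w' v' ex ew ev.
  have [z [a' ea]] := lift_arrow_in gc a ex.
  have e1 : enc (wmap F (wbwd a' (wfwd a' (wnil x')))) = enc (wmap F w').
    by rewrite ew /= -[mk_tarrow (qma F a')]/(qmt F (mk_tarrow a')) ea.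
  have [_ <-] := lift_uniq erefl e1.
  by have [_ ->] := lift_uniq (w1 := v') (w2 := wnil x') erefl ev.
- move=> x y n c p i j mp x' y1 y2 w' v' ex ew ev; subst x.
  have H l : exists s : {y' : Q' & qpath x' y'}, F (projT1 s) = y /\
      enc (walk_of (pmap_quiver F (projT2 s))) = enc (walk_of (p l)).
    by have [y' [p' pP]] := lift_path (p l) erefl; exists (existT _ y' p').
  have [s sP] := choice H.
  have es := minimal_relation_lift (e := fun l => projT1 (s l)) (p' := fun l => projT2 (s l)) mp
    (fun l => proj1 (sP l)) (fun l => proj2 (sP l)).
  have fin l z (r : walk x' z) : enc (wmap F r) = enc (walk_of (p l)) -> z = projT1 (s l).
    move=> er; have e2 : enc (wmap F r) = enc (wmap F (walk_of (projT2 (s l)))).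
      by rewrite er wmap_walk_of (proj2 (sP l)).
    by have [_ ->] := lift_uniq erefl e2.
  by rewrite (fin i _ w') // (fin j _ v').
- move=> x y z t w1 u v w2 _ IH x' y1 y2 w' v' ex ew ev.
  have [z1 [w1' [ez1 ew1]]] := lift_walk w1 ex.
  have [z2 [u' [ez2 eu]]] := lift_walk u ez1.
  have [z3 [v1' [ez3 ev1]]] := lift_walk v ez1.
  have zz := IH _ _ _ u' v1' ez1 eu ev1; subst z3.
  have [z4 [w2' [ez4 ew2]]] := lift_walk w2 ez2.
  have e1 : enc (wmap F (wcat w1' (wcat u' w2'))) = enc (wmap F w').
    by rewrite ew !wmap_cat !enc_cat ew1 eu ew2.
  have e2 : enc (wmap F (wcat w1' (wcat v1' w2'))) = enc (wmap F v').
    by rewrite ev !wmap_cat !enc_cat ew1 ev1 ew2.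
  by have [_ <-] := lift_uniq erefl e1; have [_ <-] := lift_uniq erefl e2.
Qed.

Lemma enc_wmap_act g x y (w : walk x y) : enc (wmap F (wmap (act g) w)) = enc (wmap F w).
Proof.
rewrite !enc_wmap -map_comp; apply: eq_map => -[b a].
by rewrite /= /emap /=; congr pair; exact: (gc_inva gc).
Qed.

End Lifting.

Lemma homotopic_cast (k : fieldType) (Q : quiver) (I : hom_sets k Q) (x y x1 y1 : Q)
    (w v : walk x y) (w1 v1 : walk x1 y1) : x = x1 -> y = y1 ->
  enc w = enc w1 -> enc v = enc v1 -> homotopic I w v -> homotopic I w1 v1.
Proof. by move=> ex ey; subst x1 y1 => /enc_inj -> /enc_inj ->. Qed.

Lemma walk_cast (Q : quiver) (x y x1 y1 : Q) (w : walk x y) : x = x1 -> y = y1 ->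
  exists w1 : walk x1 y1, enc w1 = enc w.
Proof. by move=> ex ey; subst x1 y1; exists w. Qed.

Lemma tk_sum (k : fieldType) (Q : quiver) (x y x1 y1 : Q) n (u : 'I_n -> kpath k x y)
    (v : 'I_n -> kpath k x1 y1) : x = x1 -> y = y1 ->
  (forall i, tk (u i) = tk (v i)) -> tk (\sum_i u i) = tk (\sum_i v i).
Proof.
move=> ex ey; subst x1 y1 => uv.
by rewrite (eq_bigr _ (fun i _ => tk_inj (uv i))).
Qed.

Section Universal.
Variables (k : fieldType) (Q' Q : quiver) (I' : hom_sets k Q') (I : hom_sets k Q).
Arguments I : clear implicits.
Arguments I' : clear implicits.
Variables (F : qmor Q' Q) (G : groupType) (act : G -> qmor Q' Q').
Hypothesis gc : galois_covering I' I F act.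
Hypothesis Q'_connected : connected_quiver Q'.
Hypothesis null_homotopic : forall (x : Q') (w : walk x x), homotopic I' w (wnil x).

Lemma parallel_homotopic (x y : Q') (w v : walk x y) : homotopic I' w v.
Proof.
apply: (ht_trans (v := wcat w (wcat (winv v) v))).
  rewrite -{1}[w]wcat_nil; apply: homotopic_wcat; first exact: ht_refl.
  exact/ht_sym/homotopic_wcatV.
by rewrite wcatA; apply: (homotopic_wcat (w' := wnil x)); [exact: null_homotopic|exact: ht_refl].
Qed.

Lemma push_homotopic (x y : Q') (w v : walk x y) : homotopic I (wmap F w) (wmap F v).
Proof. exact: (homotopic_map (gc_ideal_iff gc) (parallel_homotopic w v)). Qed.

(** The class of [w] is sent to the [g] for which the lift of [w] from [x0] ends at [act g x0]. A
    lift of [wcat w v] is the lift of [w] followed by the translate by [g] of the lift of [v],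
    whence a homomorphism. Injectivity comes from null-homotopy in the cover, surjectivity from its
    connectedness. *)
Lemma deck_iso (x : Q) : exists phi : pi1 I x -> G,
  bijective phi /\ forall a b, phi (a * b)%g = (phi a * phi b)%g.
Proof.
have [x0 ex] := gc_surjv gc x.
pose Ph (w : walk x x) g := exists w' : walk x0 (act g x0), enc (wmap F w') = enc w.
have Ph_ex w : exists g, Ph w g.
  have [y' [w' [ey ew]]] := lift_walk gc w ex.
  have [g gy] : exists g, act g x0 = y' by apply: (gc_fiberv gc); rewrite ex ey.
  by subst y'; exists g, w'.
have Ph_fun w v g h : homotopic I w v -> Ph w g -> Ph v h -> g = h.
  move=> wv [w' ew] [v' ev]; apply: (gc_act_free gc (x := x0)).
  exact: (lift_homotopic gc wv ex ew ev).
have PhM w v g h : Ph w g -> Ph v h -> Ph (wcat w v) (g * h)%g.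
  move=> [w' ew] [v' ev]; rewrite /Ph (gc_actME gc).
  exists (wcat w' (wmap (act g) v')).
  by rewrite wmap_cat !enc_cat ew (enc_wmap_act gc) ev.
have [phi phiP] := choice (fun a : pi1 I x => Ph_ex (pi1_repr a)).
exists phi; split; last first.
  move=> a b; apply: Ph_fun (phiP (a * b)%g) (PhM _ _ _ _ (phiP a) (phiP b)).
  exact: pi1_reprK.
apply: inj_surj_bijective => [a b ab|g].
  have [w' ew] := phiP a; have := phiP b; rewrite -ab => -[v' ev].
  rewrite -[a]pi1_classK -[b]pi1_classK; apply/pi1_classE.
  apply: homotopic_cast ew ev (push_homotopic w' v') => //.
  by rewrite (gc_invv gc).
have [w'] := (proj2 Q'_connected) x0 (act g x0).
have [w ew] := walk_cast (wmap F w') ex (etrans (gc_invv gc g x0) ex).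
exists (pi1_class I w); apply: Ph_fun (phiP _) _; first exact: pi1_reprK.
by exists w'.
Qed.

Section Factor.
Variables (Q2 : quiver) (I2 : hom_sets k Q2) (F2 : qmor Q2 Q) (G2 : groupType).
Arguments I2 : clear implicits.
Variables (act2 : G2 -> qmor Q2 Q2).
Hypothesis gc2 : galois_covering I2 I F2 act2.
Hypothesis Q2_connected : connected_quiver Q2.

(** A vertex [d] goes to the end of the lift along [F2] of the image of any walk from [d0] to [d].
    Two such walks have homotopic images, so the end does not depend on the walk. *)
Lemma factor_ex : exists Fb : qmor Q' Q2, qmcomp F2 Fb = F.
Proof.
have [[d0] conn] := Q'_connected; have [q0 eq0] := gc_surjv gc2 (F d0).
pose P d q := exists (w : walk d0 d) (v : walk q0 q), enc (wmap F2 v) = enc (wmap F w).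
have P_ex d : exists q, P d q /\ F2 q = F d.
  have [w] := conn d0 d; have [q [v [ev ew]]] := lift_walk gc2 (wmap F w) eq0.
  by exists q; split=> //; exists w, v.
have P_fun d q1 q2 : P d q1 -> P d q2 -> q1 = q2.
  move=> [w1 [v1 e1]] [w2 [v2 e2]].
  exact: (lift_homotopic gc2 (push_homotopic w1 w2) eq0 e1 e2).
have [f fP] := choice P_ex.
have arr_ex d e (a : arrow Q' d e) : exists b : arrow Q2 (f d) (f e),
    qmt F2 (mk_tarrow b) = qmt F (mk_tarrow a).
  have [Pd fd] := fP d; have [q [b eb]] := lift_arrow_out gc2 (qma F a) fd.
  have Pq : P e q.
    have [w [v ev]] := Pd; exists (wcat w (wfwd a (wnil e))), (wcat v (wfwd b (wnil q))).
    by rewrite !wmap_cat !enc_cat ev /= -[mk_tarrow (qma F2 b)]/(qmt F2 (mk_tarrow b)) eb.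
  have qe := P_fun _ _ _ Pq (proj1 (fP e)); subst q.
  by exists b.
pose Fb := @QMor Q' Q2 f (fun d e a => projT1 (boolp.cid (arr_ex d e a))).
exists Fb; apply: qmor_eqE; split=> [d|[d [e a]]]; first by case: (fP d).
rewrite /qmt /=; by case: (boolp.cid (arr_ex d e a)).
Qed.

Variable Fb : qmor Q' Q2.
Hypothesis Fb_F : qmcomp F2 Fb = F.

Let FbF x : F2 (Fb x) = F x.
Proof. exact: (congr1 (fun H : qmor Q' Q => H x) Fb_F). Qed.

Let FbFa a : qmt F2 (qmt Fb a) = qmt F a.
Proof. exact: (congr1 (fun H : qmor Q' Q => qmt H a) Fb_F). Qed.

Let FbFw x y (w : walk x y) : enc (wmap F2 (wmap Fb w)) = enc (wmap F w).
Proof.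
rewrite !enc_wmap -map_comp; apply: eq_map => -[b a].
by rewrite /= /emap /=; congr pair; exact: FbFa.
Qed.

Lemma factor_eq (K : qmor Q' Q2) x : qmcomp F2 K = F -> K x = Fb x -> K = Fb.
Proof.
move=> KF Kx; have Kv z : K z = Fb z.
  have [w] := (proj2 Q'_connected) x z.
  have e : enc (wmap F2 (wmap K w)) = enc (wmap F2 (wmap Fb w)).
    rewrite FbFw !enc_wmap -map_comp; apply: eq_map => -[b a].
    by rewrite /= /emap /=; congr pair; exact: (congr1 (fun H : qmor Q' Q => qmt H a) KF).
  by have [] := lift_uniq gc2 Kx e.
apply: qmor_eqE; split=> [//|[d [e a]]].
have h : qmt F2 (qmt K (mk_tarrow a)) = qmt F2 (qmt Fb (mk_tarrow a)).
  by rewrite FbFa; exact: (congr1 (fun H : qmor Q' Q => qmt H (mk_tarrow a)) KF).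
move: h; rewrite /qmt /=; move: (qma K a) (qma Fb a); rewrite (Kv d) => b1 b2.
exact: (arrow_uniq_out gc2).
Qed.

(** The deck group consists of the [g] with [Fb g = Fb]. By [factor_eq] this equation may be tested
    at one vertex, which gives transitivity on the fibres of [Fb]; surjectivity comes from lifting
    walks of the connected [Q2]. *)
Lemma factor_galois : exists (H : groupType) (actH : H -> qmor Q' Q'),
  galois_covering I' I2 Fb actH.
Proof.
pose P (g : G) := qmcomp Fb (act g) = Fb.
have P1 : P 1%g by rewrite /P (gc_act1E gc); case: (Fb).
have PM g h : P g -> P h -> P (g * h)%g.
  move=> Pg Ph; rewrite /P (gc_actME gc) -[RHS]Ph -[in RHS]Pg.
  by [].
have PV g : P g -> P g^-1%g.
  move=> Pg; rewrite /P -[in LHS]Pg.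
  rewrite -[LHS]/(qmcomp Fb (qmcomp (act g) (act g^-1%g))) (gc_actKV gc).
  by case: (Fb).
have [H [i [i1 iM ii iP iS]]] := subgroup_ex P1 PM PV.
have PFb g x : Fb (act g x) = Fb x -> P g.
  move=> gx; apply: (factor_eq (x := x)) => //.
  have -> : qmcomp F2 (qmcomp Fb (act g)) = qmcomp (qmcomp F2 Fb) (act g) by [].
  by rewrite Fb_F (gc_invE gc).
have Hex x y : Fb x = Fb y -> exists h, act (i h) x = y.
  move=> xy; have [g gx] : exists g, act g x = y.
    by apply: (gc_fiberv gc); rewrite -!FbF xy.
  have [h hg] := iS g (PFb g x (etrans (congr1 Fb gx) (esym xy))).
  by exists h; rewrite hg.
exists H, (fun h => act (i h)); split.
- exact: (gc_bound gc).
- by rewrite i1; exact: (gc_act1 gc).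
- by move=> g h; rewrite iM; exact: (gc_actM gc).
- by move=> g; exact: (gc_actI gc).
- move=> q; have [[d0] _] := Q'_connected.
  have [v] := (proj2 Q2_connected) (Fb d0) q.
  have [d [w [ed ew]]] := lift_walk gc (wmap F2 v) (esym (FbF d0)).
  exists d; have e : enc (wmap F2 (wmap Fb w)) = enc (wmap F2 v) by rewrite FbFw.
  by have [] := lift_uniq gc2 erefl e.
- move=> [q [q1 b]]; have [[d0] _] := Q'_connected.
  have [v] := (proj2 Q2_connected) (Fb d0) q.
  have [d [w [ed ew]]] := lift_walk gc (wmap F2 v) (esym (FbF d0)).
  have e : enc (wmap F2 (wmap Fb w)) = enc (wmap F2 v) by rewrite FbFw.
  have [_ Fbd] := lift_uniq gc2 erefl e.
  have Fd : F d = F2 q by rewrite -FbF Fbd.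
  have [d1 [a ea]] := lift_arrow_out gc (qma F2 b) Fd.
  exists (mk_tarrow a); subst q; apply: (arrow_uniq_out gc2 (b := b)).
  by rewrite -[mk_tarrow (qma Fb _)]/(qmt Fb (mk_tarrow a)) FbFa ea.
- move=> x y u I'u; apply/(gc_ideal_iff gc2).
  have := gc_ideal gc I'u; rewrite -[I _ _ _]/(in_tot I (tk _)) -(tk_kqmap_eq u Fb_F).
  by rewrite kqmap_qmcomp.
- move=> x' y n t u ti I2u.
  (* Distinct points of a fibre of [Fb] are distinct points of a fibre of [F], so faithfulness of
     [F] can be used. *)
  pose t' i : fiber F (F2 y) :=
    exist _ (sval (t i)) (etrans (esym (FbF (sval (t i)))) (congr1 F2 (svalP (t i)))).
  have t'i : injective t' by move=> a b /(congr1 sval) /= ab; apply: ti; exact: sval_inj.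
  apply: (gc_faithful gc (t := t') t'i (u := u)).
  have := gc_ideal gc2 I2u; rewrite linear_sum -[I _ _ _]/(in_tot I (tk _)).
  rewrite (tk_sum (v := fun i => kqmap_to (t := t' i) (u i)) (FbF x')) // => j.
  rewrite tk_kqmap_to (tk_kqmap F2 (tk_kqmap_to (t := t j) (u j))) -kqmap_qmcomp.
  exact: (tk_kqmap_eq (u j) Fb_F).

- by move=> g; rewrite (iP g).
- exact: Hex.
- move=> a b ab; have [g gab] : exists g, qmt (act g) a = b.
    by apply: (gc_fibera gc); rewrite -!FbFa ab.
  have ga : act g (projT1 a) = projT1 b by rewrite -gab.
  have Fab : Fb (projT1 a) = Fb (projT1 b) := congr1 (fun t : tarrow Q2 => projT1 t) ab.
  have [h hg] := iS g (PFb g _ (etrans (congr1 Fb ga) (esym Fab))).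
  by exists h; rewrite hg.
- move=> g x /(gc_free gc) ig; apply: ii; by rewrite ig i1.
Qed.

End Factor.

Theorem universal_of_null_homotopic : universal_galois_covering I' I F.
Proof.
split=> //; split; first by exists G, act; split=> // x; exact: deck_iso.
move=> Q2 I2 F2 G2 act2 c2 gc2; have [Fb FbF] := factor_ex gc2.
exists Fb; split; first by rewrite FbF.
exact: (factor_galois gc2 c2 FbF).
Qed.

End Universal.

(** * Components of the preimage of a convex subquiver *)

Section SubquiverMorphisms.
Variables (Q : quiver) (T : set Q).

Lemma qmt_incl_inj : injective (qmt (subquiver_incl T)).
Proof.
move=> [[x1 T1] [[y1 S1] a1]] [[x2 T2] [[y2 S2] a2]] e0.
have e1 : mk_tarrow (a1 : arrow Q x1 y1) = mk_tarrow (a2 : arrow Q x2 y2) := e0.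
have [xx yy] := mk_tarrow_ends e1; subst x2 y2; have aa := mk_tarrow_inj e1.
by clear e1 e0; subst a2; rewrite (Prop_irrelevance T1 T2) (Prop_irrelevance S1 S2).
Qed.

Lemma sub_qmor_eq (Q1 : quiver) (K L : qmor Q1 (subquiver T)) :
  qmcomp (subquiver_incl T) K = qmcomp (subquiver_incl T) L -> qmor_eq K L.
Proof.
move=> KL; split=> [x|a].
  by apply: sval_inj; exact: (congr1 (fun H : qmor Q1 Q => H x) KL).
by apply: qmt_incl_inj; exact: (congr1 (fun H : qmor Q1 Q => qmt H a) KL).
Qed.

End SubquiverMorphisms.

Section Component.
Variables (k : fieldType) (Q' Q : quiver) (I' : hom_sets k Q') (I : hom_sets k Q).
Arguments I : clear implicits.
Arguments I' : clear implicits.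
Variables (F : qmor Q' Q) (G : groupType) (act : G -> qmor Q' Q').
Hypothesis gc : galois_covering I' I F act.
Variable C : set Q.
Hypothesis C_convex : convex C.

Let B : set Q' := [set x | C (F x)].

Definition linked (x y : Q') : Prop :=
  exists (Bx : B x) (By : B y),
    inhabited (walk (exist _ x Bx : subquiver B) (exist _ y By : subquiver B)).

Lemma linked_refl x : B x -> linked x x.
Proof. by move=> Bx; exists Bx, Bx; constructor; exact: wnil. Qed.

Lemma linked_sym x y : linked x y -> linked y x.
Proof. by move=> [Bx [By [w]]]; exists By, Bx; constructor; exact: winv w. Qed.

Lemma linked_trans x y z : linked x y -> linked y z -> linked x z.
Proof.
move=> [Bx [By [w]]] [By' [Bz [v]]]; exists Bx, Bz; constructor.
by rewrite (Prop_irrelevance By' By) in v; exact: wcat w v.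
Qed.

Lemma linked_arrow x y (a : arrow Q' x y) : B x -> B y -> linked x y.
Proof.
move=> Bx By; exists Bx, By; constructor.
exact: (@wfwd (subquiver B) (exist _ x Bx) (exist _ y By) _ a (wnil _)).
Qed.

Lemma linked_act g x y : linked x y -> linked (act g x) (act g y).
Proof.
have Ba z : B z -> B (act g z) by rewrite /B /= (gc_invv gc).
pose aB : qmor (subquiver B) (subquiver B) :=
  @QMor (subquiver B) (subquiver B) (fun z => exist _ (act g (sval z)) (Ba _ (svalP z)))
    (fun _ _ a => qma (act g) a).
move=> [Bx [By [w]]].
exists (Ba _ (svalP (exist _ x Bx : subquiver B))), (Ba _ (svalP (exist _ y By : subquiver B))).
constructor.
exact: (wmap aB w).
Qed.

Lemma linked_path x y (p : qpath x y) : B x -> B y -> linked x y.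
Proof.
elim: p => [z Bz _|{}x z {}y a p IH Bx By]; first exact: linked_refl.
have Bz : B z.
  exact: (C_convex (pcons (qma F a) (pnil _)) (pmap_quiver F p) Bx By).
exact: linked_trans (linked_arrow a Bx Bz) (IH Bz By).
Qed.

Variable d0 : Q'.
Hypothesis C_d0 : C (F d0).

Definition component_of : set Q' := [set x | linked d0 x].
Let D := component_of.

Lemma component_sub x : D x -> C (F x).
Proof. by move=> [_ [Bx _]]. Qed.

Lemma component_base : D d0.
Proof. exact: linked_refl. Qed.

(** The image of the path runs between vertices of the convex set [C], so the path stays in the
    preimage and links its ends. *)
Lemma component_out x y (p : qpath x y) : D x -> C (F y) -> D y.
Proof. by move=> Dx Cy; apply: linked_trans Dx (linked_path p (component_sub Dx) Cy). Qed.

Lemma component_in x y (p : qpath x y) : D y -> C (F x) -> D x.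
Proof.
by move=> Dy Cx; apply: linked_trans Dy (linked_sym (linked_path p Cx (component_sub Dy))).
Qed.

Lemma component_convex : convex D.
Proof.
move=> x z y p q Dx Dy; apply: (component_out p Dx).
exact: (C_convex (pmap_quiver F p) (pmap_quiver F q) (component_sub Dx) (component_sub Dy)).
Qed.

Lemma wverts_prefix (R : quiver) (x y z : R) (w : walk x y) : wverts w z -> inhabited (walk x z).
Proof.
elim: w => [t|t x' t' a w IH|t x' t' a w IH] /=; first by move=> ->; constructor; exact: wnil.
  by move=> [->|/IH [v]]; constructor; [exact: wnil|exact: wfwd a v].
by move=> [->|/IH [v]]; constructor; [exact: wnil|exact: wbwd a v].
Qed.

Lemma component_connected : connected_quiver (subquiver D).
Proof.
split; first by constructor; exact: (exist _ d0 component_base).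
have DB : D `<=` B by move=> x; exact: component_sub.
suff H (y : subquiver D) : inhabited (walk (exist _ d0 component_base : subquiver D) y).
  by move=> x y; have [w] := H x; have [v] := H y; constructor; exact: wcat (winv w) v.
have [Bd0 [By [w]]] := svalP y.
have ww : wverts w `<=` [set z | D (sval z)].
  by move=> [z Bz] /wverts_prefix [v]; exists Bd0, Bz; constructor.
have [||w' _] := @walk_restrict Q' B D DB _ _ w ww (exist _ d0 component_base) y.
- exact: sval_inj.
- exact: sval_inj.
- by constructor.
Qed.

Definition component_mor : qmor (subquiver D) (subquiver C) :=
  @QMor (subquiver D) (subquiver C) (fun x => exist _ (F (sval x)) (component_sub (svalP x)))
    (fun _ _ a => qma F a).

Hypothesis C_covered : forall c, C c -> exists2 d, D d & F d = c.

(** The group is the stabiliser of the component: an element that sends one vertex of [D] into [D]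
    maps [D] to itself. The clauses are reduced to those of [F] through the inclusions [jD] and
    [jC]. *)
Lemma component_galois : exists (H : groupType) (actH : H -> qmor (subquiver D) (subquiver D)),
  galois_covering (@sub_ideal k Q' I' D) (@sub_ideal k Q I C) component_mor actH.
Proof.
pose P (g : G) := D (act g d0).
have PD g x : P g -> D x -> D (act g x).
  by move=> Pg Dx; apply: linked_trans Pg (linked_act g Dx).
have DP g x : D x -> D (act g x) -> P g.
  by move=> Dx Dgx; apply: linked_trans Dgx (linked_sym (linked_act g Dx)).
have P1 : P 1%g by rewrite /P (gc_act1E gc); exact: component_base.
have PM g h : P g -> P h -> P (g * h)%g.
  by move=> Pg Ph; rewrite /P (gc_actME gc); exact: PD.
have PV g : P g -> P g^-1%g.
  by move=> Pg; apply: DP Pg _; rewrite (gc_actVKv gc); exact: component_base.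
have [H [i [i1 iM ii iP iS]]] := subgroup_ex P1 PM PV.
pose actH h : qmor (subquiver D) (subquiver D) :=
  @QMor (subquiver D) (subquiver D)
    (fun x => exist _ (act (i h) (sval x)) (PD _ _ (iP h) (svalP x)))
    (fun _ _ a => qma (act (i h)) a).
pose jD := subquiver_incl D; pose jC := subquiver_incl C.
have jact h : qmcomp jD (actH h) = qmcomp (act (i h)) jD by [].
have jF : qmcomp jC component_mor = qmcomp F jD by [].
have tD a : qmt F (qmt jD a) = qmt jC (qmt component_mor a) by [].
exists H, actH; split.
- exact/sub_ideal_bound/(gc_bound gc).
- apply: sub_qmor_eq; rewrite -[LHS]/(qmcomp (act (i 1%g)) jD) i1 (gc_act1E gc).
  by [].
- move=> g h; apply: sub_qmor_eq.
  rewrite -[LHS]/(qmcomp (act (i (g * h)%g)) jD) iM (gc_actME gc).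
  by [].
- move=> g x y u Iu.
  have Iu' : I' (sval x) (sval y) (kqmap k jD x y u) := Iu.
  have := @gc_actI _ _ _ _ _ _ _ _ gc (i g) _ _ _ Iu'.
  have -> : kqmap k (act (i g)) _ _ (kqmap k jD x y u) = kqmap k jD _ _ (kqmap k (actH g) x y u).
    by rewrite -(kqmap_qmcomp (act (i g)) jD) -(kqmap_qmcomp jD (actH g)).
  by [].
- move=> [c Cc]; have [d Dd dc] := C_covered Cc.
  by exists (exist _ d Dd); apply: sval_inj.
- move=> [[c Cc] [[c1 Cc1] a]]; have [d Dd dc] := C_covered Cc.
  have [d1 [b eb]] := lift_arrow_out gc (a : arrow Q c c1) dc.
  have [_ d1c] := mk_tarrow_ends eb.
  have Dd1 : D d1.
    by apply: (component_out (pcons b (pnil _)) Dd); rewrite [F d1]d1c.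
  exists (@mk_tarrow (subquiver D) (exist _ d Dd) (exist _ d1 Dd1) b).
  by apply: qmt_incl_inj; rewrite -tD.
- move=> x y u Iu; have Iu' : I' (sval x) (sval y) (kqmap k jD x y u) := Iu.
  have := gc_ideal gc Iu'.
  have -> : kqmap k F _ _ (kqmap k jD x y u) = kqmap k jC _ _ (kqmap k component_mor x y u).
    by rewrite -(kqmap_qmcomp F jD) -(kqmap_qmcomp jC component_mor).
  by [].
- move=> x' y n t u ti Iu j.
  pose t' j : fiber F (sval y) := exist _ (sval (sval (t j))) (congr1 sval (svalP (t j))).
  have t'i : injective t' by move=> a b /(congr1 sval) /= ab; apply: ti; do 2!apply: sval_inj.
  apply: (gc_faithful gc (t := t') t'i (u := fun j => kqmap k jD _ _ (u j))).
  have Iu' : I (F (sval x')) (sval y) (kqmap k jC _ _ (\sum_j kqmap_to (u j))) := Iu.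
  rewrite linear_sum in Iu'.
  have e : (\sum_j kqmap_to (t := t' j) (kqmap k jD _ _ (u j))) =
      \sum_j kqmap k jC _ _ (kqmap_to (u j)) :> kpath k (F (sval x')) (sval y); last by rewrite e.
  apply: eq_bigr => l _; apply: tk_inj.
  rewrite tk_kqmap_to (tk_kqmap jC (tk_kqmap_to (u l))) -(kqmap_qmcomp F jD).
  by rewrite -(kqmap_qmcomp jC component_mor).
- move=> h; apply: sub_qmor_eq.
  rewrite -[LHS]/(qmcomp (qmcomp F (act (i h))) jD) (gc_invE gc).
  by [].
- move=> [x Dx] [y Dy] /(congr1 sval) /= xy.
  have [g gx] := gc_fiberv gc xy; have [h hg] := iS g (DP g x Dx (eq_ind_r D Dy gx)).
  by exists h; apply: sval_inj; rewrite /= hg.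
- move=> a b /(congr1 (qmt jC)); rewrite -!tD => ab.
  have [g gab] := gc_fibera gc ab.
  have gx : act g (sval (projT1 a)) = sval (projT1 b).
    exact: (congr1 (fun t : tarrow Q' => projT1 t) gab).
  have [h hg] := iS g (DP g _ (svalP (projT1 a)) (eq_ind_r D (svalP (projT1 b)) gx)).
  by exists h; apply: qmt_incl_inj; rewrite -gab -hg.
- move=> h x /(congr1 sval) /= /(gc_free gc) ih; by apply: ii; rewrite ih i1.
Qed.

End Component.

(** * The radical of a projective module *)

Section ArrowCount.
Variables (Q : quiver) (alpha : tarrow Q).

Definition arrow_sign (c : bool * tarrow Q) : int :=
  if pselect (c.2 = alpha) then (if c.1 then 1 else -1) else 0.

Definition arrow_count (s : seq (bool * tarrow Q)) : int := \sum_(c <- s) arrow_sign c.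

Lemma arrow_count_cat s t : arrow_count (s ++ t) = arrow_count s + arrow_count t.
Proof. exact: big_cat. Qed.

Lemma path_through (x y : Q) (p : qpath x y) : arrow_count (enc (walk_of p)) <> 0 ->
  exists (r : qpath x (projT1 alpha)) (s : qpath (projT1 (projT2 alpha)) y),
    plength p = (plength r + plength s).+1.
Proof.
elim: p => [z|{}x z {}y a p IH] /=; first by rewrite /arrow_count big_nil.
have [ea|na] := pselect (mk_tarrow a = alpha).
  by move=> _; rewrite -ea; exists (pnil x), p.
rewrite /arrow_count big_cons {1}/arrow_sign /=; case: pselect => [//|nb].
rewrite add0r => /IH [r [s rs]]; exists (pcons a r), s.
by rewrite rs.
Qed.

(** If no path of positive length ends at the source of [alpha] or starts at its target, then
    [alpha] is on no path of length at least two. Minimal relations consist of such paths and do not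
    change the signed count. *)
Lemma arrow_count_homotopic (k : fieldType) (I : hom_sets k Q) :
  (forall (x y : Q) (r : qpath x (projT1 alpha)), plength r = 0%N) ->
  (forall (x y : Q) (s : qpath (projT1 (projT2 alpha)) y), plength s = 0%N) ->
  forall (x y : Q) (w v : walk x y), homotopic I w v ->
  arrow_count (enc w) = arrow_count (enc v).
Proof.
move=> r0 s0 x y w v; elim=> {x y w v} //.
- by move=> x y w v u _ -> _ ->.
- move=> x y a; rewrite /arrow_count /= !big_cons big_nil /arrow_sign /=.
  by case: pselect => [e|ne]; rewrite !addr0 ?subrr.
- move=> x y a; rewrite /arrow_count /= !big_cons big_nil /arrow_sign /=.
  by case: pselect => [e|ne]; rewrite !addr0 ?addNr.
- move=> x y n c p i j [_ p2 _ _].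
  have c0 l : arrow_count (enc (walk_of (p l))) = 0.
    apply: contrapT => /path_through [r [s rs]].
    by have := p2 l; rewrite rs (r0 x y r) (s0 x y s).
  by rewrite !c0.
- by move=> x y z t w1 u v w2 _ IH; rewrite !enc_cat !arrow_count_cat IH.
Qed.

End ArrowCount.

Lemma plength_cat (Q : quiver) (x y z : Q) (p : qpath x y) (q : qpath y z) :
  plength (pcat p q) = (plength p + plength q)%N.
Proof. by elim: p q => //= x' y' z' a p IH q; rewrite IH. Qed.

Lemma triangular_parallel (Q : quiver) (x y : Q) (p : qpath x y) :
  triangular Q -> x = y -> plength p = 0%N.
Proof. by move=> tQ e; subst y; exact: tQ. Qed.

(* An arrow between two of the four vertices lies on no longer path inside
   their hull, so going once around the square cannot be null-homotopic. *)
Lemma no_square (k : fieldType) (R : kcat k) (Q' Q : quiver)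
    (nu : kfunctor (pathcat k Q') R) (F : qmor Q' Q) (w0 w1 x0 x1 : Q')
    (a00 : arrow Q' w0 x0) (a10 : arrow Q' w1 x0) (a11 : arrow Q' w1 x1)
    (a01 : arrow Q' w0 x1) :
  strongly_simply_connected nu -> triangular Q ->
  F w0 = F w1 -> F x0 = F x1 -> w0 <> w1 -> x0 <> x1 -> False.
Proof.
move=> ssc tQ ew ex nw nx; have [_ [_ _ fp _]] := ssc.
pose V : set Q' := [set w0; w1] `|` [set x0; x1].
pose S := hull V.
have SV z : V z -> S z by exact: hull_sub.
have Sw0 : S w0 by apply: SV; left; left.
have Sw1 : S w1 by apply: SV; left; right.
have Sx0 : S x0 by apply: SV; right; left.
have Sx1 : S x1 by apply: SV; right; right.
pose W0 : subquiver S := exist _ w0 Sw0; pose W1 : subquiver S := exist _ w1 Sw1.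
pose X0 : subquiver S := exist _ x0 Sx0; pose X1 : subquiver S := exist _ x1 Sx1.
pose al := @mk_tarrow (subquiver S) W0 X0 a00.
have fV : finite_set V by rewrite /V !finite_setU; do !split; exact: finite_set1.
(* Such a path, followed by the image of [a00], would be an oriented cycle in [Q]. *)
have noxw (y z : Q') (p : qpath y z) : F y = F x0 -> F z = F w0 -> False.
  move=> ey ez; have [q ql] : exists q : qpath (F z) (F x0), plength q = 1%N.
    by rewrite ez; exists (pcons (qma F a00) (pnil _)).
  have := triangular_parallel (pcat (pmap_quiver F p) q) tQ ey.
  by rewrite plength_cat ql addn1.
have Vw y : V y -> F y = F w0 \/ F y = F x0.
  by case=> -[->|->]; [left|left|right|right].
have r0 (x : subquiver S) (r : qpath x W0) : plength r = 0%N.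
  rewrite -(plength_pmap (subquiver_incl S)).
  have [a [b [p [_ [Va _]]]]] := svalP x.
  case: (Vw a Va) => ea.
    have := triangular_parallel (pmap_quiver F (pcat p (pmap_quiver (subquiver_incl S) r))) tQ ea.
    by rewrite plength_pmap plength_cat => /eqP; rewrite addn_eq0 => /andP[_ /eqP].
  by case: (noxw a w0 (pcat p (pmap_quiver (subquiver_incl S) r)) ea).
have s0 (y : subquiver S) (s : qpath X0 y) : plength s = 0%N.
  rewrite -(plength_pmap (subquiver_incl S)).
  have [a [b [_ [q [_ Vb]]]]] := svalP y.
  case: (Vw b Vb) => eb.
    by case: (noxw x0 b (pcat (pmap_quiver (subquiver_incl S) s) q) erefl eb).
  have := triangular_parallel (pmap_quiver F (pcat (pmap_quiver (subquiver_incl S) s) q)) tQ (esym eb).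
  by rewrite plength_pmap plength_cat => /eqP; rewrite addn_eq0 => /andP[/eqP].
pose w : walk W0 W0 := @wfwd (subquiver S) W0 X0 W0 a00 (@wbwd (subquiver S) X0 W1 W0 a10
  (@wfwd (subquiver S) W1 X1 W0 a11 (@wbwd (subquiver S) X1 W0 W0 a01 (wnil W0)))).
have h := ssc_null_homotopic ssc (@hull_convex _ V) (hull_finite fp fV) w.
have := arrow_count_homotopic (alpha := al) (fun x _ r => r0 x r) (fun _ y s => s0 y s) h.
(* The loop contains [a00] exactly once: two of the other sides start at [w1] and the last one ends
   at [x1]. Its count is thus 1, against 0 for the trivial walk. *)
rewrite /arrow_count /= !big_cons !big_nil /arrow_sign /=.
case: pselect => [e0|[]//].
case: pselect => [e|n1].
  by case: nw; have [/(congr1 sval) /= -> _] := mk_tarrow_ends e.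
case: pselect => [e|n2].
  by case: nw; have [/(congr1 sval) /= -> _] := mk_tarrow_ends e.
case: pselect => [e|n3 //].
by case: nx; have [_ /(congr1 sval) /= ->] := mk_tarrow_ends e.
Qed.

Lemma no_path_zero (k : fieldType) (Q : quiver) (x y : Q) (u : kpath k x y) :
  (qpath x y -> False) -> u = 0.
Proof. by move=> np; apply/malgP => p; case: (np p). Qed.

Lemma kpath_zero (k : fieldType) (Q : quiver) (x y : Q) (V : lmodType k)
    (f : {linear kpath k x y -> V}) u : (forall p, f << p >> = 0) -> f u = 0.
Proof.
move=> f0; pose z : {linear kpath k x y -> V} := \0%R.
by rewrite (malg_linear_ext (f := f) (g := z)) // => p; rewrite f0.
Qed.

Lemma plength0 (Q : quiver) (x : Q) (p : qpath x x) : plength p = 0%N -> p = pnil x.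
Proof.
move=> p0; apply: walk_of_inj; apply: enc_inj.
by have : forall (y z : Q) (q : qpath y z), plength q = 0%N -> enc (walk_of q) = [::];
  [move=> y z [] | exact].
Qed.

Lemma sub_lift (k : fieldType) (U V : lmodType k) (S : set V) (HS : is_subspace S)
    (f : {linear U -> V}) : (forall u, S (f u)) ->
  exists g : {linear U -> sub_lmod HS}, forall u, sub_inc HS (g u) = f u.
Proof.
move=> Sf; pose g u : sub_lmod HS := sub_in HS (Sf u).
have gl : linear g by move=> a u v; apply: sub_inc_inj; rewrite linearP; exact: (linearP f).
by exists (linfun_of gl).
Qed.

(** * The radical of an indecomposable projective and its lift to the cover *)

Section Radical.
Variables (k : fieldType) (A : kcat k) (Q : quiver) (nu : kfunctor (pathcat k Q) A).
Hypothesis A_lb : locally_bounded A.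
Hypothesis nu_pres : presentation nu.
Hypothesis Q_tri : triangular Q.
Variable x : Q.

Let P : kmod A := kproj (nu x).

Lemma end_scalar (m : hom A (nu x) (nu x)) : exists c : k, m = c *: cid A (nu x).
Proof.
have [u <-] := pres_full nu_pres m; exists (u@_(pnil x)).
have -> : u = u@_(pnil x) *: << pnil x >> :> kpath k x x.
  apply/malgP => p; rewrite (plength0 (Q_tri p)) mcoeffZ mcoeffU eqxx mulr1.
  by [].
rewrite (linearZ_LR (fhom nu)) mcoeffZ mcoeffU eqxx mulr1; congr (_ *: _).
exact: (fhom_id nu x).
Qed.

(** In a triangular quiver the endomorphisms of [nu x] are scalars, so the radical of [P] is zero at
    [nu x] and everything elsewhere. *)
Definition proj_radical : subsets P := fun a => [set m | a = nu x -> m = 0].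
Arguments proj_radical : clear implicits.

Lemma proj_radical_sub : submodule proj_radical.
Proof.
split=> [a _ //|a c u v Nu Nv e|a b f u Nu e].
  by rewrite (Nu e) (Nv e) scaler0 addr0.
have [v bv] := nu_surj nu_pres b; subst b; subst a.
have [vx|vx] := pselect (nu v = nu x); first by rewrite (Nu vx) mact0.
have [f' ff] := pres_full nu_pres f; have [u' uu] := pres_full nu_pres u.
rewrite -ff -uu /= -fhom_comp.
suff -> : @kcomp k (pathcat k Q) _ _ _ f' u' = 0 by rewrite linear0.
(* Paths in both directions between [x] and [v] would form a cycle, so one of the two factors is
   zero. *)
have [n1|n2] : (qpath x v -> False) \/ (qpath v x -> False).
  have [[p]|np1] := pselect (inhabited (qpath x v)); last by left=> p; apply: np1; constructor.
  right=> q; apply: vx; have := Q_tri (pcat p q); rewrite plength_cat => /eqP.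
  rewrite addn_eq0 => /andP[/eqP p0 _]; clear -p0.
  by case: p p0.
- by rewrite (no_path_zero f' n1); exact: (linear0 (linfun_of (@comp_linl _ (pathcat k Q) _ _ _ u'))).
- by rewrite (no_path_zero u' n2); exact: (linear0 (linfun_of (@comp_linr _ (pathcat k Q) _ _ _ f'))).
Qed.

(** A nonzero element at [nu x] is a multiple of the identity, which generates [P]. Hence
    [proj_radical] is the only maximal submodule. *)
Lemma proper_sub_radical (N : subsets P) : submodule N -> N <> @full_sub k A P ->
  forall a, N a `<=` proj_radical a.
Proof.
move=> sN Nf a m Nm e; subst a; have [c mc] := end_scalar m.
have [c0|cn0] := eqVneq c 0; first by rewrite mc c0 scale0r.
case: Nf; apply: functional_extensionality_dep => b; apply/predeqP => g; split=> // _.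
have N1 : N (nu x) (cid A (nu x)).
  have := submodP sN c^-1 Nm (submod0 sN (nu x)).
  by rewrite addr0 mc scalerA mulVf // scale1r.
by have := submod_act sN (g : hom A b (nu x)) N1; rewrite /= comp_idr.
Qed.

Lemma radical_kproj : radical P = proj_radical.
Proof.
have nfull : proj_radical <> @full_sub k A P.
  move=> e; have [n0 _] := lb_local A_lb (nu x); apply: n0.
  have h : proj_radical (nu x) (cid A (nu x)) by rewrite e.
  exact: h.
apply: functional_extensionality_dep => a; apply/predeqP => m; split.
  apply; split=> //; first exact: proj_radical_sub.
  move=> N' sN' RN'; have [->|nf] := pselect (N' = @full_sub k A P); first by right.
  left; apply: functional_extensionality_dep => b; apply/predeqP => n; split; last exact: RN'.
  exact: proper_sub_radical.
move=> Rm N [sN Nf Nmax].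
by have [<-|] := Nmax _ proj_radical_sub (proper_sub_radical sN Nf).
Qed.

End Radical.

Arguments proj_radical {k A Q} nu x a : rename.

Section RadicalCover.
Variables (k : fieldType) (A : kcat k) (Q : quiver) (nu : kfunctor (pathcat k Q) A).
Hypothesis A_lb : locally_bounded A.
Hypothesis nu_pres : presentation nu.
Hypothesis Q_tri : triangular Q.
Variables (At : kcat k) (Qt : quiver) (nut : kfunctor (pathcat k Qt) At).
Hypothesis At_ssc : strongly_simply_connected nut.
Variables (F : qmor Qt Q) (G : groupType) (act : G -> qmor Qt Qt).
Hypothesis gc : galois_covering (kernel nut) (kernel nu) F act.
Variable xt : Qt.

Let x : Q := F xt.
Let P : kmod A := kproj (nu x).

Definition radA : kmod A := subkmod (proj_radical_sub nu_pres Q_tri x).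
Definition radA_inc : kmor radA P := subkmod_inc (proj_radical_sub nu_pres Q_tri x).
Definition radQ : kmod (pathcat k Q) := pull nu radA.
(** This is [P] pulled back to the cover, not the projective at [xt]; the latter corresponds to the
    part coming from paths to [xt]. Working inside it, the relations of the cover act by zero
    because [F] maps them to relations. *)
Definition projT : kmod (pathcat k Qt) := pull (kquiver k F) (pull nu P).

Definition lift_map (y : Qt) : {linear kpath k y xt -> hom A (nu (F y)) (nu x)} :=
  (fhom nu \o kqmap k F y xt)%FUN.

(* The push-down of this module is [radQ], the radical of [P]. *)
Definition radT_subsets : subsets projT :=
  fun y => [set m | (exists u, m = lift_map y u) /\ proj_radical nu x (nu (F y)) m].

Lemma radT_submodule : submodule radT_subsets.
Proof.
have sP := proj_radical_sub nu_pres Q_tri x.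
split=> [y|y c u v [[u' ->] Ru] [[v' ->] Rv]|y z f u [[u' ->] Ru]]; split.
- by exists 0; rewrite linear0.
- exact: (submod0 sP).
- by exists (c *: u' + v'); rewrite linearP.
- exact: (submodP sP).
- exists (@kcomp k (pathcat k Qt) _ _ _ f u').
  have e : kqmap k F y xt (kpath_comp f u') = kpath_comp (kqmap k F y z f) (kqmap k F z xt u').
    exact: kqmap_comp.
  rewrite /lift_map -[RHS]/(fhom nu (kqmap k F y xt (kpath_comp f u'))) e.
  by rewrite [RHS](fhom_comp nu).
- exact: (submod_act sP).
Qed.

Definition radT : kmod (pathcat k Qt) := subkmod radT_submodule.
Definition radT_inc : kmor radT projT := subkmod_inc radT_submodule.

Lemma radA_inc_inj a : injective (radA_inc a).
Proof. exact: subkmod_inc_inj. Qed.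

Lemma radT_inc_inj y : injective (radT_inc y).
Proof. exact: subkmod_inc_inj. Qed.

Lemma radT_zero (y : Qt) (m : radT y) : F y = x -> m = 0.
Proof.
move=> yx; apply: radT_inc_inj; rewrite linear0.
have [_ h] := subkmod_incP m; apply: h; by rewrite yx.
Qed.

Lemma radT_elt (y : Qt) (u : kpath k y xt) : F y <> x ->
  exists m : radT y, radT_inc y m = lift_map y u.
Proof.
move=> nyx; apply: subkmod_in; split; first by exists u.
by move=> /(nu_inj nu_pres).
Qed.

Lemma radT_lift (y : Qt) : F y <> x ->
  exists g : {linear kpath k y xt -> radT y}, forall u, radT_inc y (g u) = lift_map y u.
Proof.
move=> nyx; apply: (@sub_lift k _ _ _ (submod_subspace radT_submodule y) (lift_map y)).
move=> u; split; first by exists u.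
by move=> /(nu_inj nu_pres).
Qed.

Lemma radA_zero (b : Q) (m : radA (nu b)) : b = x -> m = 0.
Proof.
move=> bx; apply: radA_inc_inj; rewrite linear0; apply: (subkmod_incP m).
by rewrite bx.
Qed.

Definition castP (b c : Q) (e : b = c) : {linear P (nu b) -> P (nu c)} :=
  eq_rect b (fun z => {linear P (nu b) -> P (nu z)}) idfun c e.

Lemma castP_radical b c (e : b = c) m :
  proj_radical nu x (nu b) m -> proj_radical nu x (nu c) (castP e m).
Proof. by case: _ / e. Qed.

Lemma iota_ex (b : Q) (t : fiber F b) : exists g : {linear radT (sval t) -> radQ b},
  forall m, radA_inc (nu b) (g m) = castP (svalP t) (radT_inc (sval t) m).
Proof.
have sP := proj_radical_sub nu_pres Q_tri x.
pose f : {linear radT (sval t) -> P (nu b)} := (castP (svalP t) \o radT_inc (sval t))%FUN.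
apply: (@sub_lift k _ _ _ (submod_subspace (proj_radical_sub nu_pres Q_tri x) (nu b)) f).
by move=> m; have [_ h] := subkmod_incP m; exact: (castP_radical (svalP t) h).
Qed.

Definition iota (b : Q) (t : fiber F b) : {linear radT (sval t) -> radQ b} :=
  projT1 (boolp.cid (iota_ex t)).

Lemma iotaE (b : Q) (t : fiber F b) m :
  radA_inc (nu b) (iota t m) = castP (svalP t) (radT_inc (sval t) m).
Proof. by rewrite /iota; case: boolp.cid. Qed.

Lemma iotaE_exist (b : Q) (y : Qt) (e : F y = b) (m : radT y) :
  radA_inc (nu b) (iota (exist _ y e) m) = castP e (radT_inc y m).
Proof. by rewrite iotaE (Prop_irrelevance (svalP (exist _ y e)) e). Qed.

Lemma iota_act (b1' b2' : Qt) (a : arrow Qt b1' b2') (b1 b2 : Q)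
  (a0 : arrow Q b1 b2) (e1 : F b1' = b1) (e2 : F b2' = b2) :
  qmt F (mk_tarrow a) = mk_tarrow a0 -> forall m : radT b2',
  mact radQ (arr k a0) (iota (exist _ b2' e2) m) = iota (exist _ b1' e1) (mact radT (arr k a) m).
Proof.
move=> ea m; apply: radA_inc_inj; rewrite iotaE_exist.
rewrite -[LHS]/(mact (pull nu P) (arr k a0) (radA_inc (nu b2) (iota (exist _ b2' e2) m))).
rewrite iotaE_exist -[radT_inc b1' _]/(mact projT (arr k a) (radT_inc b2' m)).
rewrite -[mact projT _ _]/(mact (pull nu P) (fhom (kquiver k F) (arr k a)) (radT_inc b2' m)).
rewrite kquiver_arr; subst b1 b2.
by rewrite -(mk_tarrow_inj (ea : mk_tarrow (qma F a) = mk_tarrow a0)).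
Qed.

(** A path ending at [x] lifts to a path ending at [xt], and its start selects the summand. *)
Lemma iota_pel (b : Q) (p : qpath b x) : b <> x ->
  exists s : {t : fiber F b & radT (sval t)},
    radA_inc (nu b) (iota (projT1 s) (projT2 s)) = fhom nu (pel k p).
Proof.
move=> bx; have [y [p' [ey ep]]] := lift_path_in gc p (erefl x).
have nyx : F y <> x by rewrite ey.
have [m mE] := radT_elt (pel k p') nyx.
exists (existT _ (exist _ y ey : fiber F b) m).
rewrite [LHS](iotaE_exist ey m) mE.
rewrite -[lift_map y _]/(fhom nu (fhom (kquiver k F) (pel k p'))) kquiver_pel.
clear m mE bx nyx; subst b; congr (fhom nu (pel k _)).
exact: walk_of_inj (enc_inj ep).
Qed.

Lemma iota_span (b : Q) (v : radQ b) :
  exists (n : nat) (t : 'I_n -> fiber F b) (y : forall i, radT (sval (t i))),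
     v = \sum_i iota (t i) (y i).
Proof.
have [bx|bx] := pselect (b = x).
  have f : 'I_0 -> fiber F b by case.
  exists 0%N, f, (fun i => 0).
  by rewrite big_ord0 (radA_zero v bx).
have [s sP] := choice (fun p : qpath b x => iota_pel p bx).
have [u uv] := pres_full nu_pres (radA_inc (nu b) v : hom A (nu b) (nu x)).
pose l := in_tuple (msupp u : seq _).
exists _, (fun i => projT1 (s (tnth l i))), (fun i => u@_(tnth l i) *: projT2 (s (tnth l i))).
apply: radA_inc_inj; rewrite -uv linear_sum {1}[u]monalgE linear_sum big_tnth.
apply: eq_bigr => i _; rewrite !linearZ_LR sP.
have -> : << u@_(tnth l i) *g tnth l i >> = u@_(tnth l i) *: (<< tnth l i >> : kpath k b x).
  by apply/malgP => q; rewrite mcoeffZ !mcoeffU mulrnAr mulr1.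
by rewrite linearZ_LR.
Qed.

Lemma kqmap_from_nu (b : Q) (t : fiber F b) (u : kpath k (sval t) xt) :
  fhom nu (kqmap_from u) = castP (svalP t) (lift_map (sval t) u).
Proof.
by rewrite /kqmap_from; move: (svalP t) u; generalize (sval t) => y e u; case: _ / e.
Qed.

(** The summands are represented by elements with different starts and common end [xt], which calls
    for the dual faithfulness [gc_faithful_in]. *)
Lemma iota_indep (b : Q) (n : nat) (t : 'I_n -> fiber F b) (y : forall i, radT (sval (t i))) :
  injective t -> \sum_i iota (t i) (y i) = 0 -> forall i, y i = 0.
Proof.
move=> ti y0.
have ex i : exists u, radT_inc (sval (t i)) (y i) = lift_map (sval (t i)) u.
  by have [] := subkmod_incP (y i).
pose u i := projT1 (boolp.cid (ex i)).
have uP i : radT_inc (sval (t i)) (y i) = lift_map (sval (t i)) (u i).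
  by rewrite /u; case: boolp.cid.
have I0 : kernel nu b (F xt) (\sum_i kqmap_from (u i)).
  rewrite /kernel /= linear_sum -[RHS](linear0 (radA_inc (nu b))) -y0 linear_sum.
  by apply: eq_bigr => i _; rewrite kqmap_from_nu iotaE uP.
move=> i; apply: radT_inc_inj; rewrite linear0 uP.
exact: (gc_ideal gc (gc_faithful_in gc ti I0 i)).
Qed.

Lemma iota_direct_sum b : is_direct_sum (@iota b).
Proof. by split; [exact: iota_span|exact: iota_indep]. Qed.

Lemma kpath_enum (y z : Qt) (s : seq (qpath y z)) (u : kpath k y z) : uniq s ->
  (forall p, p \in s) -> u = \sum_(p <- s) u@_p *: << p >>.
Proof.
move=> us sP; apply/malgP => q; rewrite raddf_sum (bigD1_seq q) //= mcoeffZ mcoeffUU mulr1.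
by rewrite big1 ?addr0 // => p /negPf pq; rewrite mcoeffZ mcoeffU pq mulr0.
Qed.

(** The support lies among the vertices with a nonzero morphism to [xt], finite in number by local
    boundedness. Each space is spanned by the finitely many paths to [xt]. *)
Lemma radT_fin_length : fin_length radT.
Proof.
have [At_lb [nut_pres _ fp _]] := At_ssc.
split.
  apply: (@sub_finite_set _ _ (fob nut @^-1` [set y | exists f : hom At y (nut xt), f <> 0])).
    move=> y [m mn0]; have [[u um] _] := subkmod_incP m.
    exists (fhom nut u) => u0; apply: mn0; apply: radT_inc_inj; rewrite linear0.
    by rewrite [LHS]um; exact: (gc_ideal gc u0).
  by apply: finite_preimage; [move=> ? ? _ _ /(nu_inj nut_pres)|exact: (lb_in At_lb)].
move=> y; have [yx|nyx] := pselect (F y = x).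
  exists 0%N, (fun i => 0) => v; exists (fun i => 0).
  by rewrite big_ord0 (radT_zero v yx).
have [g gP] := radT_lift nyx.
have /finite_seqP [s sE] := fp y xt; pose l := in_tuple (undup s).
exists _, (fun i => g << tnth l i >>) => v; have [[u uv] _] := subkmod_incP v.
exists (fun i => u@_(tnth l i)); apply: radT_inc_inj.
have su : u = \sum_(p <- undup s) u@_p *: << p >> :> kpath k y xt.
  apply: kpath_enum; first exact: undup_uniq.
  by move=> p; rewrite mem_undup; have : [set` s] p by rewrite -sE.
rewrite [LHS]uv {1}su -gP !linear_sum big_tnth.
by apply: eq_bigr => i _; rewrite !linearZ_LR.
Qed.

End RadicalCover.

Lemma count_lt (T : eqType) (a b : pred T) (s : seq T) z :
  (forall y, a y -> b y) -> z \in s -> b z -> ~~ a z -> (count a s < count b s)%N.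
Proof.
move=> ab + bz az; elim: s => //= y s IH; rewrite inE => /orP[/eqP <-|/IH lt].
  by rewrite bz (negPf az) ltnS sub_count.
have := ab y; case: (a y) => [/(_ isT) -> |_]; first by rewrite ltn_add2l.
by rewrite add0n (leq_trans lt) // leq_addl.
Qed.

(** The vertex minimises the number of support vertices reachable from it. Moving along a nontrivial
    path loses at least the starting vertex, as there are no cycles. *)
Lemma maximal_support (k : fieldType) (Q : quiver) (M : kmod (pathcat k Q)) :
  triangular Q -> finite_set (supp M) -> (exists z, supp M z) ->
  exists z : Q, supp M z /\ forall (y : Q) (p : qpath z y), supp M y -> plength p = 0%N.
Proof.
move=> tQ /finite_enum [s [us sP]] [z0 Mz0].
pose c (z : Q) := count (fun y : Q => `[< inhabited (qpath z y) >]) s.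
have ex : exists n, `[< exists z : Q, supp M z /\ c z = n >].
  by exists (c z0); apply/asboolP; exists z0.
case: (ex_minnP ex) => n /asboolP [z [Mz cz]] nmin; exists z; split=> // y p My.
apply: contrapT => p0; have := nmin (c y); rewrite -cz leqNgt => h.
suff lt : (c y < c z)%N by move: h; rewrite lt => h; have : false by apply: h; apply/asboolP; exists y.
apply: (@count_lt {classic Q} _ _ s z).
- by move=> t /asboolP [q]; apply/asboolP; constructor; exact: pcat p q.
- exact/sP.
- by apply/asboolP; constructor; exact: pnil.
- apply/asboolP => -[q]; apply: p0; have := tQ _ (pcat p q); rewrite plength_cat => /eqP.
  by rewrite addn_eq0 => /andP[/eqP].
Qed.

Lemma fin_length_fin_gen (k : fieldType) (C : kcat k) (M : kmod C) : fin_length M -> fin_gen M.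
Proof.
move=> [fM dM]; pose E := {y : C & M y}.
have [d dP] := choice dM.
pose b y := projT1 (boolp.cid (dP y)).
have bP y (v : M y) : exists c : 'I_(d y) -> k, v = \sum_i c i *: b y i.
  by rewrite /b; case: boolp.cid.
pose S : set E := \bigcup_(y in supp M) range (fun i => existT (fun y => M y : Type) y (b y i) : E).
have fS : finite_set S.
  by apply: bigcup_finite => // y _; apply: finite_image; exact: finite_finset.
have [L [uL LP]] := finite_enum fS.
have H (y : C) (m : M y) : exists f : forall s : E, hom C y (projT1 s),
    m = \sum_(s <- L) mact M (f s) (projT2 s).
  have [yM|nyM] := pselect (supp M y); last first.
    exists (fun s => 0); rewrite (notin_supp m nyM) big1 // => s _.
    exact: (linear0 (@mact_l k C M y (projT1 s) (projT2 s))).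
  have [c ->] := bP y m; elim/big_ind: _ => [|m1 m2 [f1 ->] [f2 ->]|i _].
  - exists (fun s => 0); rewrite big1 // => s _.
    exact: (linear0 (@mact_l k C M y (projT1 s) (projT2 s))).
  - exists (fun s => f1 s + f2 s); rewrite -big_split; apply: eq_bigr => s _ /=.
    by rewrite -(linearD (@mact_l k C M y (projT1 s) (projT2 s))).
  - pose s0 : {classic E} := existT _ y (b y i).
    have s0L : s0 \in L by apply/LP; exists y => //; exists i.
    pose f : forall s : {classic E}, hom C y (projT1 s) :=
      @dfwith {classic E} (fun s => hom C y (projT1 s)) (fun s => 0) s0 (c i *: cid C y).
    exists f; rewrite (bigD1_seq s0) //= {1}/f dfwith_in big1 => [|s ss0].
      have := linearZ_LR (@mact_l k C M y y (b y i)) (c i) (cid C y).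
      by rewrite addr0 /= /linear_of mact_id.
    rewrite /f dfwith_out 1?eq_sym //.
    exact: (linear0 (@mact_l k C M y (projT1 s) (projT2 s))).
exists (size L), (fun i => projT1 (tnth (in_tuple L) i)), (fun i => projT2 (tnth (in_tuple L) i)).
move=> y m; have [f ->] := H y m.
by exists (fun i => f (tnth (in_tuple L) i)); rewrite big_tnth.
Qed.

Lemma qpath_cons (Q : quiver) (x y : Q) (p : qpath x y) : x <> y ->
  exists z (a : arrow Q x z) (q : qpath z y), p = pcons a q.
Proof. by case: p => [//|x' z y' a q _]; exists z, a, q. Qed.

(** * Supports of the shifts of a summand *)

Section Supports.
Variables (k : fieldType) (A : kcat k) (Q : quiver) (nu : kfunctor (pathcat k Q) A).
Hypothesis nu_pres : presentation nu.
Hypothesis Q_tri : triangular Q.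
Variables (At : kcat k) (Qt : quiver) (nut : kfunctor (pathcat k Qt) At).
Hypothesis At_ssc : strongly_simply_connected nut.
Variables (F : qmor Qt Q) (G : groupType) (act : G -> qmor Qt Qt).
Hypothesis gc : galois_covering (kernel nut) (kernel nu) F act.
Variable xt : Qt.

Let Rt := radT nu_pres Q_tri F xt.

(** Without such an arrow, every path from [z] to [xt] starts with an arrow to some [z1 <> xt], so
    it is that arrow acting on an element of the radical at [z1]. Maximality makes [M] zero at [z1],
    hence [prj] kills all of the radical at [z], against [supp M z]. *)
Lemma maximal_arrow (M : kmod (pathcat k Qt)) (inc : kmor M Rt) (prj : kmor Rt M) (z : Qt) :
  (forall y m, prj y (inc y m) = m) -> supp M z ->
  (forall (y : Qt) (p : qpath z y), supp M y -> plength p = 0%N) -> inhabited (arrow Qt z xt).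
Proof.
move=> pi [m mn0] zmax; apply: contrapT => na; apply: (mn0).
have nzx : F z <> F xt.
  by move=> zx; apply: (mn0); rewrite -(pi z m) [inc z m](radT_zero _ zx) linear0.
have [g gP] := radT_lift nu_pres Q_tri nzx.
have [[u uE] _] := subkmod_incP (inc z m).
have -> : m = prj z (g u).
  by rewrite -{1}(pi z m); congr (prj z _); apply: radT_inc_inj; rewrite gP.
apply: (kpath_zero (f := (prj z \o g)%FUN)) => p.
have nzxt : z <> xt by move=> e; apply: (nzx); rewrite e.
have [z1 [a [p' pE]]] := qpath_cons p nzxt.
have nz1 : z1 <> xt by move=> e; apply: (na); rewrite -e; constructor.
have nFz1 : F z1 <> F xt.
  move=> e; have := triangular_parallel (pmap_quiver F p') Q_tri e; rewrite plength_pmap.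
  by have [z2 [b [q ->]]] := qpath_cons p' nz1.
have [r rE] := radT_elt nu_pres Q_tri (pel k p') nFz1.
have gE : g << p >> = mact Rt (arr k a) r.
  apply: radT_inc_inj; rewrite gP pE.
  have e : << pcons a p' >> = kpath_comp (arr k a) (pel k p') := pel_cons k a p'.
  rewrite e -[RHS]/(mact (projT nu F xt) (arr k a) (radT_inc nu_pres Q_tri F xt z1 r)) rE.
  rewrite -[LHS]/(fhom nu (kqmap k F z xt (kpath_comp (arr k a) (pel k p')))) kqmap_comp.
  exact: (fhom_comp nu).
rewrite /= gE kmor_act (notin_supp (prj z1 r)) ?mact0 //.
by move=> /(zmax z1 (pcons a (pnil _))).
Qed.

(** Recording only the length lets a path be moved along equations between end points by
    rewriting. *)
Definition reach (Q0 : quiver) n (y z : Q0) : Prop := exists p : qpath y z, plength p = n.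

Lemma reach_map (Q1 Q2 : quiver) (K : qmor Q1 Q2) n (y z : Q1) :
  reach n y z -> reach n (K y) (K z).
Proof. by move=> [p pn]; exists (pmap_quiver K p); rewrite plength_pmap. Qed.

(* A vertex maximal in the support of M has an arrow to [xt].  If two shifts had
   the same support, some f <> 1 would permute these maximal vertices, and the
   vertices z, f z, xt and f^-1 xt would span a square as in [no_square]. *)
Lemma shifted_supports (M : kmod (pathcat k Qt)) (inc : kmor M Rt) (prj : kmor Rt M) :
  (forall y m, prj y (inc y m) = m) -> indecomposable M ->
  forall g h, g != h -> ~ (forall y, supp M (act g y) <-> supp M (act h y)).
Proof.
move=> pi [Mn0 _] g h gh gsh; have [_ [_ Qt_tri _ _]] := At_ssc.
have fM : finite_set (supp M).
  apply: sub_finite_set (proj1 (radT_fin_length nu_pres Q_tri At_ssc gc xt)) => y [m mn0].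
  by exists (inc y m) => im0; apply: mn0; rewrite -(pi y m) im0 linear0.
pose maxi z := supp M z /\ forall (y : Qt) (p : qpath z y), supp M y -> plength p = 0%N.
pose f := (h * g^-1)%g.
have fE z : act f z = act h (act g^-1%g z) by rewrite /f (gc_actME gc).
have fn1 : f <> 1%g.
  by move=> f1; move/eqP: gh; apply; rewrite -[LHS]mul1g -f1 /f -mulgA mulVg mulg1.
have maxf z : maxi z -> maxi (act f z).
  move=> [Mz zmax]; split.
    by rewrite fE; apply/gsh; rewrite (gc_actKVv gc).
  move=> y p My; have : reach (plength p) (act f z) y by exists p.
  move: (plength p) => n pr {p}.
  have := reach_map (act g) (reach_map (act h^-1%g) pr).
  rewrite fE (gc_actVKv gc) (gc_actKVv gc) => -[q <-]; apply: zmax.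
  by apply/gsh; rewrite (gc_actKVv gc).
have maxa z : maxi z -> inhabited (arrow Qt z xt).
  by move=> [Mz zmax]; apply: maximal_arrow pi Mz zmax.
have [z mz] : exists z, maxi z by apply: maximal_support.
(* The third vertex is needed for the fourth side: the arrows from [f z] and [f (f z)] to [xt],
   translated by the inverse of [f], become arrows from [z] and [f z] to [f^-1 xt]. *)
have mfz := maxf _ mz; have mffz := maxf _ mfz.
have [a0] := maxa _ mz; have [a1] := maxa _ mfz; have [a2] := maxa _ mffz.
have b1 : arrow Qt z (act f^-1%g xt) by rewrite -(gc_actVKv gc f z); exact: (qma (act f^-1%g) a1).
have b2 : arrow Qt (act f z) (act f^-1%g xt).
  by rewrite -(gc_actVKv gc f (act f z)); exact: (qma (act f^-1%g) a2).
apply: (@no_square _ _ _ _ _ F _ _ _ _ a0 a1 b2 b1 At_ssc Q_tri).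
- by rewrite (gc_invv gc).
- by rewrite (gc_invv gc).
- by move=> /esym /(gc_free gc).
- move=> e; apply: fn1; apply: (gc_free gc (x := xt)).
  by rewrite {1}e (gc_actKVv gc).
Qed.

End Supports.

Lemma direct_summand_split (k : fieldType) (C : kcat k) (X M : kmod C) (R : subsets M)
    (sR : submodule R) : direct_summand X R ->
  exists (j : kmor X (subkmod sR)) (p : kmor (subkmod sR) X), forall x m, p x (j x m) = m.
Proof.
move=> [i [N [i_inj sN d]]].
have sI : submodule (kmor_image i).
  split=> [x|x a _ _ [u _ <-] [v _ <-]|x y f _ [u _ <-]].
  - by exists 0 => //; rewrite linear0.
  - by exists (a *: u + v) => //; rewrite linearP.
  - by exists (mact X f u) => //; rewrite kmor_act.
have iR x m : R x (i x m).
  have [/(_ (i x m)) [_ h] _] := d x; apply: h; exists (i x m), 0.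
  by rewrite addr0; split=> //; [exists m|exact: submod0].
have [j jE] := subkmod_lift sR iR.
have [c cE] : exists c : kmor X (subkmod sI), forall x m, subkmod_inc sI x (c x m) = i x m.
  by apply: subkmod_lift => x m; exists m.
have [r [cr rc]] : kbij c.
  apply: kbijP => [x u v uv|x n]; first by apply: i_inj; rewrite -!cE uv.
  have [m _ mn] := subkmod_incP n; exists m.
  by apply: subkmod_inc_inj; rewrite cE.
have [q qP] := dsum_proj sR sI sN d.
exists j, (kcmp r q) => x m; rewrite /= -[RHS](cr x); congr (r x _).
apply: subkmod_inc_inj; apply/eqP; rewrite cE eq_sym -subr_eq0; apply/eqP.
have [_] := d x; apply.
  have := submodP sI (-1) (subkmod_incP (q x (j x m))) (ex_intro2 _ _ m Logic.I erefl : kmor_image i (i x m)).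
  by rewrite scaleN1r addrC.
by have := qP x (j x m); rewrite jE.
Qed.

Lemma hom_path (k : fieldType) (Q : quiver) (M : kmod (pathcat k Q)) (y z : Q)
    (u : hom (pathcat k Q) y z) (m : M z) : mact M u m <> 0 -> inhabited (qpath y z).
Proof.
move=> um; apply: contrapT => np; apply: um.
rewrite (no_path_zero u) => [|p]; last by apply: np; constructor.
exact: (linear0 (@mact_l k _ M y z m)).
Qed.

(** * The push-down onto the convex hull of the support *)

Section SupportHull.
Variables (k : fieldType) (A : kcat k) (Q : quiver) (nu : kfunctor (pathcat k Q) A).
Variables (At : kcat k) (Qt : quiver) (nut : kfunctor (pathcat k Qt) At).
Hypothesis At_ssc : strongly_simply_connected nut.
Variables (F : qmor Qt Q) (G : groupType) (act : G -> qmor Qt Qt).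
Hypothesis gc : galois_covering (kernel nut) (kernel nu) F act.
Variable X : kmod A.
Variable M : kmod (pathcat k Qt).
Variable iota : forall (b : Q) (t : fiber F b), {linear M (sval t) -> X (nu b)}.
Hypothesis M_indecomposable : indecomposable M.
Hypothesis M_fin : fin_length M.
Hypothesis M_annihilated : annihilated (kernel nut) M.
Hypothesis iota_sum : forall b, is_direct_sum (@iota b).
Hypothesis iota_act : forall (b1' b2' : Qt) (a : arrow Qt b1' b2') (b1 b2 : Q)
    (a0 : arrow Q b1 b2) (e1 : F b1' = b1) (e2 : F b2' = b2),
    qmt F (mk_tarrow a) = mk_tarrow a0 -> forall m : M b2',
    mact (pull nu X) (arr k a0) (iota (exist _ b2' e2) m) =
    iota (exist _ b1' e1) (mact M (arr k a) m).

Let C := support_hull nu X.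

Lemma support_hull_convex : convex C.
Proof. by rewrite /C /support_hull convex_hullE; exact: hull_convex. Qed.

Lemma iota_inj b (t : fiber F b) m : iota t m = 0 -> m = 0.
Proof.
move=> e; have [_ h] := iota_sum b.
apply: (h 1%N (fun _ => t) (fun _ => m) _ _ ord0) => [i j _|]; first by rewrite !ord1.
by rewrite big_ord1.
Qed.

Lemma supp_hull (y : Qt) : supp M y -> C (F y).
Proof.
move=> [m mn0]; rewrite /C /support_hull convex_hullE; apply: hull_sub.
by exists (iota (exist _ y erefl : fiber F (F y)) m) => /iota_inj.
Qed.

Lemma supp_covered (b : Q) : (exists m : X (nu b), m <> 0) -> exists2 y, supp M y & F y = b.
Proof.
move=> [m mn0]; apply: contrapT => ny; apply: mn0.
have [n [t [y ->]]] := proj1 (iota_sum b) m; apply: big1 => i _.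
rewrite [y i](@notin_supp k _ M) ?linear0 // => st; apply: ny.
by exists (sval (t i)); [exact: st|exact: (svalP (t i))].
Qed.

Variable d0 : Qt.
Hypothesis d0_supp : supp M d0.

Let D : set Qt := component_of F C d0.
Let C_d0 : C (F d0) := supp_hull d0_supp.

(** A nonzero action joins two support vertices by a path, and both lie over [C]; hence it cannot
    cross the boundary of [D]. The parts of [M] inside and outside [D] are therefore complementary
    submodules, and the part inside is nonzero at [d0]. *)
Lemma supp_component (y : Qt) : supp M y -> D y.
Proof.
have [_ iM] := M_indecomposable.
have C_conv := support_hull_convex.
pose N1 : subsets M := fun y => [set m | D y \/ m = 0].
pose N2 : subsets M := fun y => [set m | ~ D y \/ m = 0].
have s1 : submodule N1.
  split=> [z|z a u v|z t f u]; first by right.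
    by move=> [Du|->] [Dv|->]; [left|left|left|right; rewrite scaler0 addr0].
  move=> [Dt|->]; last by right; rewrite mact0.
  have [fu|fu] := pselect (mact M f u = 0); [by right|left].
  have [p] := hom_path fu; apply: (component_in C_conv p Dt).
  by apply: supp_hull; exists (mact M f u).
have s2 : submodule N2.
  split=> [z|z a u v|z t f u]; first by right.
    by move=> [Du|->] [Dv|->]; [left|left|left|right; rewrite scaler0 addr0].
  have [fu _|fu] := pselect (mact M f u = 0); first by right.
  move=> [Dt|u0]; last by case: fu; rewrite u0 mact0.
  left=> Dz; apply: Dt; have [p] := hom_path fu.
  apply: (component_out C_conv p Dz); apply: supp_hull; exists u => u0.
  by apply: fu; rewrite u0 mact0.
case: (iM _ _ s1 s2) => [z|N10|N20 [m mn0]].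
- split=> [m|m [Dz|//] [//|//]]; split=> // _.
  have [Dz|Dz] := pselect (D z).
    by exists m, 0; rewrite addr0; split=> //; [left|right].
  by exists 0, m; rewrite add0r; split=> //; [right|left].
- case: d0_supp => m mn0; have : N1 d0 m by left; exact: (component_base C_d0).
  by rewrite N10 => /mn0.
- apply: contrapT => nD; have : N2 y m by left.
  by rewrite N20 => /mn0.
Qed.

(** A vertex of the hull lies on a path from the support of [X]; lifted from a support vertex of
    [M], this path stays in [D]. *)
Lemma hull_covered c : C c -> exists2 d, D d & F d = c.
Proof.
move=> Cc; have := Cc; rewrite /C /support_hull convex_hullE => -[a [b [p [q [Xa Xb]]]]].
have [y sy ya] := supp_covered Xa; have [d [p' [dc _]]] := lift_path gc p ya.
exists d => //; apply: (component_out support_hull_convex p' (supp_component sy)).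
by rewrite dc.
Qed.

Lemma component_pushdown : module_first_kind nu X.
Proof.
have C_conv := support_hull_convex.
pose Ft : qmor (subquiver D) (subquiver C) := component_mor F C d0.
exists (subquiver D), (@sub_ideal k Qt (kernel nut) D), Ft; split.
  have [H [actH gcH]] := component_galois gc C_conv C_d0 hull_covered.
  apply: (universal_of_null_homotopic gcH).
    exact: (component_connected C_d0).
  apply: (convex_component_null_homotopic At_ssc).
  exact: (component_convex C_conv).
pose Y : kmod (pathcat k (subquiver D)) := pull (kquiver k (subquiver_incl D)) M.
exists Y; split.
- by move=> x y u Iu m; exact: M_annihilated Iu m.
- apply: fin_length_fin_gen; apply: pull_fin_length => //.
  by move=> x y; exact: sval_inj.
pose tF (b : subquiver C) (t : fiber Ft b) : fiber F (sval b) :=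
  exist _ (sval (sval t)) (congr1 sval (svalP t)).
pose iY (b : subquiver C) (t : fiber Ft b) : {linear Y (sval t) -> X (nu (sval b))} := iota (tF b t).
exists iY; split.
  move=> b; split=> [v|n t y ti y0 i].
    (* [d1] is a default point of the fibre: a summand at a point outside the support is zero and
       may be placed there. *)
    have [d1 Dd1 dc1] := hull_covered (svalP b).
    have [n [t [y ->]]] := proj1 (iota_sum (sval b)) v.
    have H i : exists s : {t : fiber Ft b & Y (sval t)},
        iY b (projT1 s) (projT2 s) = iota (t i) (y i).
      move: (t i) (y i) => [z ez] yi; have [st|nst] := pselect (supp M z).
        have e : Ft (exist _ z (supp_component st)) = b by apply: sval_inj; exact: ez.
        pose t1 : fiber Ft b := exist _ (exist _ z (supp_component st)) e.
        exists (existT (fun t : fiber Ft b => Y (sval t)) t1 yi).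
        have e2 : F z = sval b := congr1 sval (svalP t1).
        by rewrite /= /iY /tF /= (Prop_irrelevance (congr1 sval (svalP t1)) ez).
      have e : Ft (exist _ d1 Dd1) = b by apply: sval_inj.
      exists (existT (fun t : fiber Ft b => Y (sval t)) (exist _ _ e) 0).
      by rewrite linear0 (notin_supp yi nst) linear0.
    have [s sP] := choice H.
    exists n, (fun i => projT1 (s i)), (fun i => projT2 (s i)).
    by apply: eq_bigr => i _; rewrite sP.
  have [_ h] := iota_sum (sval b).
  apply: (h n (fun i => tF b (t i)) y _ y0 i) => i1 i2 /(congr1 sval) /= e.
  by apply: ti; do 2!apply: sval_inj.
move=> b1 b2 f m.
pose XC := pull (restricted_presentation nu C) (pull (fullsub_incl _) X).
pose g (b : subquiver D) : {linear Y b -> pull (kquiver k Ft) XC b} :=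
  iY (Ft b) (exist _ b erefl).
symmetry; apply: (@arrow_act k (subquiver D) Y (pull (kquiver k Ft) XC) g) => x y a n.
have ea : qmt F (mk_tarrow (a : arrow Qt (sval x) (sval y))) =
  mk_tarrow (qma F (a : arrow Qt (sval x) (sval y))) by [].
have ia := iota_act (congr1 sval (svalP (exist _ x erefl : fiber Ft (Ft x))))
  (congr1 sval (svalP (exist _ y erefl : fiber Ft (Ft y)))) ea n.
have e1 : mact Y (arr k a) n = mact M (arr k (a : arrow Qt (sval x) (sval y))) n.
  by rewrite -(kquiver_arr k (subquiver_incl D) a).
rewrite e1 [LHS](esym ia) -[RHS]/(mact X (fhom nu (fhom (kquiver k (subquiver_incl C))
  (fhom (kquiver k Ft) (arr k a)))) (g y n)).
by rewrite !kquiver_arr.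
Qed.

End SupportHull.

Theorem corollary2p7
    (k : closedFieldType)
    (A : kcat k)
    (A_locally_bounded : locally_bounded A)
    (A_finite : finite_set [set: A])
    (A_connected : connected_kcat A)
    (Q : quiver) (nu : kfunctor (pathcat k Q) A)
    (A_presentation : presentation nu)
    (A_triangular : triangular Q)
    (At : kcat k) (Qt : quiver) (nut : kfunctor (pathcat k Qt) At)
    (At_ssc : strongly_simply_connected nut)
    (F : qmor Qt Q) (G : groupType) (act : G -> qmor Qt Qt)
    (F_galois : galois_covering (kernel nut) (kernel nu) F act) :
  first_kind nu.
Proof.
move=> x X _ X_indec X_summand.
have [xt ext] := gc_surjv F_galois x; subst x.
rewrite (radical_kproj A_locally_bounded A_presentation A_triangular) in X_summand.
have [j [p pj]] :=
  direct_summand_split (proj_radical_sub A_presentation A_triangular (F xt)) X_summand.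
have nu_i := nu_inj A_presentation; have nu_s := nu_surj A_presentation.
have XQ_indec : indecomposable (pull nu X).
  by apply: pull_indecomposable => //; exact: (pres_full A_presentation).
have XQ_fin : fin_length (pull nu X).
  apply: pull_fin_length => //; split; first exact: sub_finite_set A_finite.
  move=> a; have [v va] := nu_s a; subst a.
  have [n Pn] := lb_fin_dim A_locally_bounded (nu v) (nu (F xt)).
  (* [X] is a quotient of the radical, which is zero at [nu (F xt)] and the whole space of morphisms
     elsewhere. *)
  have [vx|nvx] := pselect (nu v = nu (F xt)).
    exists 0%N, (fun i => 0) => m; exists (fun i => 0); rewrite big_ord0 -(pj _ m).
    have -> : j (nu v) m = 0; last by rewrite linear0.
    by apply: subkmod_inc_inj; rewrite linear0; apply: (subkmod_incP (j (nu v) m)).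
  exists n; apply: (@spanned_image _ _ _ (p (nu v)) n) => [m|]; first by exists (j _ m).
  have [g gE] := @sub_lift k _ _ _ (submod_subspace
    (proj_radical_sub A_presentation A_triangular (F xt)) (nu v)) idfun (fun u vx => False_ind _ (nvx vx)).
  apply: (@spanned_image _ _ _ g n) Pn => m; exists (subkmod_inc _ (nu v) m).
  by apply: subkmod_inc_inj; exact: gE.
have XQ_nonzero : exists x (m : pull nu X x), m <> 0 by case: XQ_indec.
have [M [inc [inc_inj M_indec M_fin [iX [iX_sum iX_act]]]]] :=
  gradable_summand F_galois (radT_fin_length A_presentation A_triangular At_ssc F_galois xt)
    (iota_direct_sum A_presentation A_triangular F_galois xt)
    (@iota_act k A Q nu A_presentation A_triangular Qt F xt)
    (j := kpull nu j) (p := kpull nu p) (indecomposable_fitting XQ_fin XQ_indec) XQ_nonzero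
    (fun v m => pj (nu v) m)
    (@shifted_supports _ _ _ _ A_presentation A_triangular _ _ _ At_ssc _ _ _ F_galois xt).
have [[d0 [m0 m0n0]] _] := M_indec.
apply: (component_pushdown At_ssc F_galois M_indec M_fin _ iX_sum iX_act (d0 := d0)); last first.
  by exists m0.
(* [M] embeds into [projT], where [u] acts through its image under [F], a relation of [A]. *)
move=> y z u Iu m; apply: inc_inj; rewrite linear0 kmor_act; apply: radT_inc_inj; rewrite linear0.
have Fu : fhom nu (kqmap k F y z u) = 0 := gc_ideal F_galois Iu.
rewrite kmor_act; rewrite -[LHS]/(kcomp (fhom nu (kqmap k F y z u)) _) Fu.
exact: (linear0 (linfun_of (@comp_linl k A _ _ _ _))).
Qed.
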